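(* Let $x\neq0$, let $n,t\in\mathbb{N}$ with $1\le t\le n$, and let $\lambda\vdash n-t$. Then there is an exact sequence of $\mathbb{A}_{n-1}$-modules $$0\longrightarrow \bigoplus_{\alpha\sqsubseteq\lambda}\mathscr{M}_{\mathbb{A}_{n-1}}(\alpha)\longrightarrow \operatorname{res}_{n-1}\big(\mathscr{M}_{\mathbb{A}_n}(\lambda)\big)\longrightarrow \bigoplus_{\lambda\sqsubset\beta}\mathscr{M}_{\mathbb{A}_{n-1}}(\beta)\longrightarrow 0,$$ where a summand $\mathscr{M}_{\mathbb{A}_{n-1}}(\beta)$ with $|\beta|>n-1$ is interpreted as $0$.
   Context: Let $K$ be a field, $x$ an element transcendental or algebraic over $K$, $F=K(x)$ of characteristic zero. $\mathscr{A}_n$ is the set of graphs on $\{1,\dots,n\}\cup\{1',\dots,n'\}$ (top row $1..n$, bottom row $1'..n'$) with all vertex degrees $0$ or $1$; degree-$0$ vertices carry loops; arcs within a row are horizontal, between rows vertical. Product: stack $\mathfrak a$ above $\mathfrak b$ identifying bottom vertex $i'$ of $\mathfrak a$ with top vertex $i$ of $\mathfrak b$; $\ell(\mathfrak a,\mathfrak b)$ = number of components lying entirely in the middle row; $G'(\mathfrak a,\mathfrak b)$ = diagram on the outer rows joining two vertices iff connected by a path; $\mathfrak a\mathfrak b=x^{\ell(\mathfrak a,\mathfrak b)}G'(\mathfrak a,\mathfrak b)$. This gives the algebra $\mathbb{A}_n$ with basis $\mathscr{A}_n$. $S_n$ = diagrams with $n$ vertical arcs; $S_{n-t}\subset S_n$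 = permutations fixing $n-t+1,\dots,n$. $\epsilon_n\colon\mathbb{A}_{n-1}\to\mathbb{A}_n$ adds vertices $n,n'$ joined by the arc $(n,n')$, and $\operatorname{res}_{n-1}(M)$ is an $\mathbb{A}_n$-module $M$ regarded as $\mathbb{A}_{n-1}$-module via $\epsilon_n$. For $0\le m\le n$, $\mathbb{A}_n^m$ = span of diagrams with at most $m$ vertical arcs ($\mathbb{A}_n^{-1}=0$), $\mathbb{I}_n^m=\mathbb{A}_n^m/\mathbb{A}_n^{m-1}$ (basis: diagrams with exactly $m$ vertical arcs; products with fewer vertical arcs are $0$). $\mathfrak u_{n,t}$ = diagram with arcs $(i,i')$, $1\le i\le n-t$, other vertices isolated. For $\lambda\vdash n-t$ ($0\le t\le n$) with Specht module $S^\lambda$ over $F$, and $x\neq 0$, $\mathscr{M}_{\mathbb{A}_n}(\lambda)=\mathbb{I}_n^{n-t}\mathfrak u_{n,t}\otimes_{F[S_{n-t}]}S^\lambda$, an $\mathbb{A}_n$-module via $\mathfrak b\cdot(\mathfrak a\otimes v)=(\mathfrak b\mathfrak a)\otimes v$ (product in $\mathbb{I}_n^{n-t}$). For partitions: $\alpha\sqsubset\lambda$ means $\alpha$ is obtained from $\lambda$ by removing one box (an inner corner); $\lambda\sqsubset\beta$ means $\beta$ is obtained from $\lambda$ by adding one box; $\alpha\sqsubseteq\lambda$ means $\alpha\sqsubset\lambda$ or $\alpha=\lambda$. *)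

(* Defs.v *)
From HB Require Import structures.
From mathcomp Require Import all_boot all_order all_algebra fingroup perm.
Set Implicit Arguments.
Unset Strict Implicit.
Unset Printing Implicit Defensive.
Import Order.TTheory GRing.Theory.
Local Open Scope ring_scope.

(* Diagrams.  Vertices of a diagram on {1..m} u {1'..m'}: (false, i) is the
   top vertex i+1, (true, i) is the bottom vertex (i+1)'.  A diagram (graph
   with all degrees 0 or 1) is encoded as an involution d of the vertex set:
   d v = w (w <> v) means v and w are joined by an arc, d v = v means v is
   isolated (carries a loop).                                               *)
Definition vtx (m : nat) := (bool * 'I_m)%type.
Definition rawd (m : nat) := {ffun vtx m -> vtx m}.
Definition is_diagram m (d : rawd m) : bool := [forall v, d (d v) == v].

Definition nvert m (d : rawd m) : nat := #|[set i : 'I_m | (d (false, i)).1]|.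

(* Stacking a above b: rows 0 (top of a), 1 (middle: bottom of a = top of b),
   2 (bottom of b). *)
Definition upper_emb m (v : vtx m) : 'I_3 * 'I_m :=
  (if v.1 then @inord 2 1 else @inord 2 0, v.2).
Definition lower_emb m (v : vtx m) : 'I_3 * 'I_m :=
  (if v.1 then @inord 2 2 else @inord 2 1, v.2).
Definition outer_emb m (v : vtx m) : 'I_3 * 'I_m :=
  if v.1 then lower_emb v else upper_emb v.

Definition stack_edge m (a b : rawd m) : rel ('I_3 * 'I_m) := fun w1 w2 =>
  [exists v, [&& v != a v, upper_emb v == w1 & upper_emb (a v) == w2]] ||
  [exists v, [&& v != b v, lower_emb v == w1 & lower_emb (b v) == w2]].
Definition stack_conn m (a b : rawd m) := connect (stack_edge a b).

Definition Gp m (a b : rawd m) : rawd m :=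
  [ffun v => odflt v [pick w | (w != v) &&
                               stack_conn a b (outer_emb v) (outer_emb w)]].

Definition ell m (a b : rawd m) : nat :=
  #|[set w : 'I_3 * 'I_m | (fingraph.root (stack_edge a b) w == w) &&
       [forall w', stack_conn a b w w' ==> (w'.1 == @inord 2 1)]]|.

(* The algebra F[diagrams] (vectors indexed by diagrams) and the product in
   I_m^k = A_m^k / A_m^(k-1): a b = x^l(a,b) G'(a,b) if G'(a,b) has exactly
   k vertical arcs, and 0 otherwise.                                        *)
Definition Alg (F : fieldType) m := {ffun rawd m -> F^o}.
Definition dbasis (F : fieldType) m (d : rawd m) : Alg F m :=
  [ffun c => (c == d)%:R].

Definition prodI (F : fieldType) (x : F) m (k : nat) (a c : rawd m) : Alg F m :=
  [ffun d => if (d == Gp a c) && (nvert d == k) then x ^+ ell a c else 0].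

Definition mulI (F : fieldType) (x : F) m (k : nat) (p q : Alg F m) : Alg F m :=
  \sum_(a | is_diagram a) \sum_(c | is_diagram c) (p a * q c) *: prodI x k a c.

Definition uD m (k : nat) : rawd m :=
  [ffun v : vtx m => if (v.2 < k)%N then (~~ v.1, v.2) else v].

(* The permutation g, as an element of the diagram group S_m: bottom j' is
   joined to top g(j) (so that g |-> permD g is a group homomorphism for the
   diagram product). *)
Definition permD m (g : {perm 'I_m}) : rawd m :=
  [ffun v : vtx m => if v.1 then (false, g v.2) else (true, (g^-1)%g v.2)].
Definition in_Sk m (k : nat) (g : {perm 'I_m}) : bool :=
  [forall j : 'I_m, (k <= j)%N ==> (g j == j)].

Definition Iu_space (F : fieldType) (x : F) m (k : nat) : {vspace Alg F m} :=
  <<[seq mulI x k (dbasis F a) (dbasis F (uD m k))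
    | a <- enum (rawd m) & is_diagram a && (nvert a == k)]>>%VS.

(* Partitions of size <= m, padded with zeros: rows indexed by 'I_m.+1.     *)
Definition Ptn m := {ffun 'I_m.+1 -> 'I_m.+1}.
Definition psize m (al : Ptn m) : nat := (\sum_(i < m.+1) (al i : nat))%N.
Definition is_partition m (al : Ptn m) : bool :=
  [forall i : 'I_m.+1, forall j : 'I_m.+1, (i <= j)%N ==> (al j <= al i)%N].

Definition pv m (al : Ptn m) (j : nat) : nat :=
  if @insub _ (fun j => j < m.+1)%N _ j is Some i then (al i : nat) else 0%N.

Definition box_removed m1 m2 (al : Ptn m1) (la : Ptn m2) : bool :=
  [exists i : 'I_(maxn m1 m2).+1, ((pv al i).+1 == pv la i) &&
     [forall j : 'I_(maxn m1 m2).+1, (j != i) ==> (pv al j == pv la j)]].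
Definition same_ptn m1 m2 (al : Ptn m1) (la : Ptn m2) : bool :=
  [forall j : 'I_(maxn m1 m2).+1, pv al j == pv la j].

(* Tabloids (row of each entry 1..k), tableaux (box of each entry) *)
Definition Tab m := {ffun 'I_m -> 'I_m.+1}.
Definition Tbl m := {ffun 'I_m -> 'I_m.+1 * 'I_m.+1}.
Definition is_tableau m (al : Ptn m) (t : Tbl m) : bool :=
  [forall j : 'I_m, (j < psize al)%N ==> ((t j).2 < al (t j).1)%N] &&
  [forall j : 'I_m, forall j' : 'I_m,
     [&& (j < psize al)%N, (j' < psize al)%N & t j == t j'] ==> (j == j')].
Definition tabloid_of m (al : Ptn m) (t : Tbl m) : Tab m :=
  [ffun j : 'I_m => if (j < psize al)%N then (t j).1 else ord0].
Definition colstab m (al : Ptn m) (t : Tbl m) (s : {perm 'I_m}) : bool :=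
  [forall j : 'I_m, if (j < psize al)%N then (t (s j)).2 == (t j).2
                    else s j == j].

Definition MF (F : fieldType) m := {ffun Tab m -> F^o}.
Definition tdelta (F : fieldType) m (r : Tab m) : MF F m :=
  [ffun r' => (r' == r)%:R].
Definition polytab (F : fieldType) m (al : Ptn m) (t : Tbl m) : MF F m :=
  \sum_(s : {perm 'I_m} | colstab al t s)
     ((-1) ^+ odd_perm s) *: tdelta F (tabloid_of al [ffun j => t ((s^-1)%g j)]).
Definition specht (F : fieldType) m (al : Ptn m) : {vspace MF F m} :=
  <<[seq polytab F al t | t <- enum (Tbl m) & is_tableau al t]>>%VS.
(* left action of g in S_k on M^al: g.{T} = {gT} *)
Definition gact (F : fieldType) m (g : {perm 'I_m}) (w : MF F m) : MF F m :=
  [ffun r : Tab m => w [ffun j => r (g j)]].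

(* Cell modules M_{A_m}(al) = I_m^k u_{m,m-k} (x)_{F[S_k]} S^al  (k = |al|),
   realised as a subquotient modU / modR of the ambient space
   F[diagrams] (x)_F F[tabloids] = F[diagrams x tabloids]:
   modU = (I_m^k u) (x)_F S^al, modR = span of (v g) (x) w - v (x) (g w).   *)
Definition Amb (F : fieldType) m := {ffun (rawd m * Tab m) -> F^o}.
Definition tens (F : fieldType) m (v : Alg F m) (w : MF F m) : Amb F m :=
  [ffun p => v p.1 * w p.2].

Definition modU (F : fieldType) (x : F) m (al : Ptn m) : {vspace Amb F m} :=
  <<[seq tens v w | v <- vbasis (Iu_space x m (psize al)),
                    w <- vbasis (specht F al)]>>%VS.
Definition modR (F : fieldType) (x : F) m (al : Ptn m) : {vspace Amb F m} :=
  (\sum_(v <- vbasis (Iu_space x m (psize al)))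
   \sum_(g : {perm 'I_m} | in_Sk (psize al) g)
   \sum_(w <- vbasis (specht F al))
     <[tens (mulI x (psize al) v (dbasis F (permD g))) w
       - tens v (gact g w)]>)%VS.

(* action of a diagram b of A_m: b.(c (x) w) = (b c) (x) w, product in I_m^k *)
Definition modact (F : fieldType) (x : F) m (k : nat) (b : rawd m)
    (f : Amb F m) : Amb F m :=
  [ffun p => \sum_(c | is_diagram c) f (c, p.2) * prodI x k b c p.1].

Definition DS (F : fieldType) m := {ffun Ptn m -> Amb F m}.
Definition inj_ds (F : fieldType) m (al : Ptn m) : 'Hom(Amb F m, DS F m) :=
  linfun (fun v : Amb F m => [ffun be => if be == al then v else 0] : DS F m).
Definition dsU (F : fieldType) (x : F) m (S : {set Ptn m}) : {vspace DS F m} :=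
  (\sum_(al in S) (inj_ds F al @: modU x al))%VS.
Definition dsR (F : fieldType) (x : F) m (S : {set Ptn m}) : {vspace DS F m} :=
  (\sum_(al in S) (inj_ds F al @: modR x al))%VS.
Definition dsact (F : fieldType) (x : F) m (b : rawd m) (f : DS F m) : DS F m :=
  [ffun al => modact x (psize al) b (f al)].

Definition eps n (b : rawd n.-1) : rawd n :=
  [ffun v : vtx n =>
     if @insub _ (fun j => j < n.-1)%N _ (val v.2) is Some i then
       let w := b (v.1, i) in (w.1, widen_ord (leq_pred n) w.2)
     else (~~ v.1, v.2)].

(* Maps between subquotients U/R and exactness.  A linear map f of the
   ambient spaces with f(U1) <= U2, f(R1) <= R2 induces U1/R1 -> U2/R2.     *)
Definition sq_exact (F : fieldType) (V1 V2 V3 : vectType F)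
    (U1 R1 : {vspace V1}) (U2 R2 : {vspace V2}) (U3 R3 : {vspace V3})
    (f : 'Hom(V1, V2)) (g : 'Hom(V2, V3)) : Prop :=
  [/\ (f @: U1 <= U2)%VS, (f @: R1 <= R2)%VS,
      (g @: U2 <= U3)%VS & (g @: R2 <= R3)%VS] /\
  [/\ (* induced f injective *)
      (U1 :&: f @^-1: R2 <= R1)%VS,
      (* im f <= ker g *)
      (g @: (f @: U1) <= R3)%VS,
      (* ker g <= im f *)
      (U2 :&: g @^-1: R3 <= f @: U1 + R2)%VS &
      (* induced g surjective *)
      (U3 <= g @: U2 + R3)%VS].

Definition sq_equivariant (F : fieldType) (A : Type) (V W : vectType F)
    (P : pred A) (actV : A -> V -> V) (actW : A -> W -> W)
    (U : {vspace V}) (RW : {vspace W}) (f : 'Hom(V, W)) : Prop :=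
  forall a, P a -> forall v, v \in U -> f (actV a v) - actW a (f v) \in RW.

Definition alphas n (la : Ptn n) : {set Ptn n.-1} :=
  [set al : Ptn n.-1 | [&& is_partition al, (psize al <= n.-1)%N &
                          box_removed al la || same_ptn al la]].
Definition betas n (la : Ptn n) : {set Ptn n.-1} :=
  [set be : Ptn n.-1 | [&& is_partition be, (psize be <= n.-1)%N &
                          box_removed la be]].

(* Main.v *)
Require Import Defs.
From HB Require Import structures.
From mathcomp Require Import all_boot all_order all_algebra fingroup perm.
From mathcomp Require Import zify.
Set Implicit Arguments.
Unset Strict Implicit.
Unset Printing Implicit Defensive.
Import Order.TTheory GRing.Theory Num.Theory.
Local Open Scope ring_scope.

(** Write k = |la|.  The module M_n(la) has a basis of diagrams with k through strands tensored with
    S^la, and restricting to A_{n-1} sorts these diagrams by what happens at the vertex n.  Those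
    with n isolated or on a through strand span a submodule, isomorphic to M_{n-1}(la) and to
    M_{n-1} of the restriction of S^la to S_{k-1}; in the quotient n is joined to another top vertex i,
    and turning that arc into a (k+1)-st through strand at i identifies it with M_{n-1} of the module
    induced from S^la to S_{k+1}.  In characteristic 0 the branching rules split both modules.

    For the branching rules, adding or removing an entry gives nonzero equivariant maps between S^al
    and S^be whenever be covers al.  The column antisymmetriser of a tableau of shape la maps S^la
    to a line and kills S^mu when mu is different from la and not larger in the order given by
    sum_i i mu_i; hence these maps are jointly injective, so dim S^la >= sum_{al < la} dim S^al and
    (k+1) dim S^la >= sum_{be > la} dim S^be.  The identity UD - DU = 1 of Young's lattice forces
    equality.

    An element of the numerator of a tensor product over F[S_k] is a relation if and only if its sum
    over the diagonal action of S_k vanishes. *)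

(** * Tabloids and polytabloids *)

(** The field has characteristic 0 but no order, and polytabloids span the Specht modules without
    being independent. So equivariant maps are built on the whole tabloid module and cut down by
    [frame], a self-adjoint operator with image in the Specht module, on which it acts by a nonzero
    scalar. That scalar is, up to the order of a column stabiliser, a sum of squares of integers, so
    its positivity is settled over the integers and only its non-vanishing is carried to the field.
    On the diagram side, the diagonal sum need only be tested at one diagram of each orbit of the
    right action of S_k. If n is on a through strand, the representative has the strand of n ending
    at the k-th bottom vertex, and the permutations that keep it there form S_{k-1}: this is how the
    restriction of the Specht module appears. If n is joined to the top vertex i, bending the arc
    down gives k+1 strands, and the transpositions representing the cosets of S_k in S_{k+1} supply
    the summands of the induced module. *)

Section GroupAction.
Variables (F : fieldType) (N : nat).
Implicit Types (w v : MF F N) (g h s : {perm 'I_N}).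

Lemma gact_is_linear g : linear (@gact F N g).
Proof. by move=> a w v; apply/ffunP=> r; rewrite !ffunE. Qed.
HB.instance Definition _ g :=
  GRing.isLinear.Build F (MF F N) (MF F N) _ (@gact F N g) (gact_is_linear g).

Lemma gact1 w : gact 1%g w = w.
Proof.
by apply/ffunP=> r; rewrite ffunE; congr (w _); apply/ffunP=> j; rewrite ffunE perm1.
Qed.

(** Permutations multiply from left to right, so [h * g] is [g] after [h] and [gact] is a left
    action for composition of functions; [rmulM] is the matching right action on diagrams. *)
Lemma gactM g h w : gact g (gact h w) = gact (h * g)%g w.
Proof.
apply/ffunP=> r; rewrite !ffunE; congr (w _).
by apply/ffunP=> j; rewrite !ffunE permM.
Qed.

Lemma gact_tdelta g (r : Tab N) :
  gact g (tdelta F r) = tdelta F [ffun j => r ((g^-1)%g j)].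
Proof.
apply/ffunP=> r'; rewrite !ffunE; congr (_ %:R); congr (nat_of_bool _).
apply/eqP/eqP=> [<-|->]; apply/ffunP=> j; rewrite !ffunE ?permKV ?permK //.
Qed.

Definition dot w v : F := \sum_r w r * v r.

Lemma dotC w v : dot w v = dot v w.
Proof. by apply: eq_bigr => r _; rewrite mulrC. Qed.

Lemma dot_is_linear w : linear (dot w : MF F N -> F^o).
Proof.
move=> a u v; rewrite /dot scaler_sumr -big_split /=; apply: eq_bigr => r _.
by rewrite !ffunE mulrDr; congr (_ + _); rewrite /GRing.scale /= mulrCA.
Qed.
HB.instance Definition _ w :=
  GRing.isLinear.Build F (MF F N) F^o _ (dot w : MF F N -> F^o) (dot_is_linear w).

Lemma dot_sumr (I : Type) (r : seq I) (P : pred I) w (f : I -> MF F N) :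
  dot w (\sum_(i <- r | P i) f i) = \sum_(i <- r | P i) dot w (f i).
Proof. exact: (raddf_sum (dot w : MF F N -> F^o)). Qed.
Lemma dot_suml (I : Type) (r : seq I) (P : pred I) w (f : I -> MF F N) :
  dot (\sum_(i <- r | P i) f i) w = \sum_(i <- r | P i) dot (f i) w.
Proof. by rewrite dotC dot_sumr; apply: eq_bigr => i _; rewrite dotC. Qed.
Lemma dotZr a w v : dot w (a *: v) = a * dot w v.
Proof. exact: (linearZ_LR (dot w : MF F N -> F^o)). Qed.
Lemma dotZl a w v : dot (a *: w) v = a * dot w v.
Proof. by rewrite dotC dotZr dotC. Qed.
Lemma dotDr w u v : dot w (u + v) = dot w u + dot w v.
Proof. exact: (raddfD (dot w : MF F N -> F^o)). Qed.
Lemma dot0r w : dot w 0 = 0.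
Proof. exact: (raddf0 (dot w : MF F N -> F^o)). Qed.
Lemma dot0l w : dot 0 w = 0.
Proof. by rewrite dotC dot0r. Qed.

Lemma dot_tdelta w r : dot w (tdelta F r) = w r.
Proof.
rewrite /dot (bigD1 r) //= big1 ?addr0 ?ffunE ?eqxx ?mulr1 // => r' /negPf ne.
by rewrite ffunE ne mulr0.
Qed.

Lemma MF_expand w : w = \sum_r w r *: tdelta F r.
Proof.
apply/ffunP=> r; rewrite sum_ffunE (bigD1 r) //= big1 ?addr0 => [|r' ne].
  by rewrite !ffunE eqxx; rewrite /GRing.scale /= mulr1.
by rewrite !ffunE eq_sym (negPf ne) scaler0.
Qed.

Lemma dot_gactl g w v : dot (gact g w) v = dot w (gact g^-1%g v).
Proof.
rewrite /dot.
have bij : bijective (fun r : Tab N => [ffun j => r (g j)] : Tab N).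
  exists (fun r : Tab N => [ffun j => r ((g^-1)%g j)] : Tab N) => r;
  by apply/ffunP=> j; rewrite !ffunE ?permKV ?permK.
rewrite [RHS](reindex _ (onW_bij _ bij)) /=; apply: eq_bigr => r _.
rewrite !ffunE; congr (_ * v _); apply/ffunP=> j; by rewrite !ffunE permKV.
Qed.

Lemma in_SkP k g : reflect (forall j : 'I_N, (k <= j)%N -> g j = j) (in_Sk k g).
Proof.
by apply: (iffP forallP) => H j; [move=> kj; apply/eqP/(implyP (H j))|
  apply/implyP=> kj; rewrite H].
Qed.

Lemma in_Sk1 k : @in_Sk N k 1%g.
Proof. by apply/in_SkP=> j; rewrite perm1. Qed.
Lemma in_SkM k g h : in_Sk k g -> in_Sk k h -> in_Sk k (g * h)%g.
Proof.
by move=> /in_SkP G /in_SkP H; apply/in_SkP=> j kj; rewrite permM G ?H.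
Qed.
Lemma in_SkV k g : in_Sk k (g^-1)%g = in_Sk k g.
Proof.
suff H h : in_Sk k h -> in_Sk k (h^-1)%g.
  by apply/idP/idP => /H //; rewrite invgK.
by move=> /in_SkP G; apply/in_SkP=> j kj; rewrite -{1}(G j kj) permK.
Qed.
Lemma in_Sk_lt k g (j : 'I_N) : in_Sk k g -> (g j < k)%N = (j < k)%N.
Proof.
move=> gS; case: (ltnP j k) => jk; last by rewrite (in_SkP _ _ gS) // ltnNge jk.
rewrite ltnNge; apply/negP=> gk.
have := in_SkP _ _ gS _ gk; move/perm_inj=> E; by move: gk; rewrite E leqNgt jk.
Qed.

End GroupAction.

(** * Column stabilisers, column antisymmetrisers and polytabloids *)

Section Polytabloids.
Variables (F : fieldType) (N : nat).
Implicit Types (w v : MF F N) (g h s : {perm 'I_N}) (al la mu : Ptn N) (t : Tbl N).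

Definition tblact g t : Tbl N := [ffun j => t ((g^-1)%g j)].

Lemma colstabP al t s :
  reflect (in_Sk (psize al) s /\ forall j : 'I_N, (t (s j)).2 = (t j).2 \/ (psize al <= j)%N)
    (colstab al t s).
Proof.
apply: (iffP forallP) => [H|[/in_SkP S H] j].
  split=> [|j]; first by apply/in_SkP=> j kj; have := H j; rewrite ltnNge kj => /eqP.
  by have := H j; case: ltnP => kj; [move/eqP; left | right].
case: ltnP => kj; last by rewrite S.
by case: (H j) => [->|] //; rewrite leqNgt kj.
Qed.

Lemma colstab_Sk al t s : colstab al t s -> in_Sk (psize al) s.
Proof. by case/colstabP. Qed.
Lemma colstab_col al t s (j : 'I_N) : colstab al t s -> (j < psize al)%N -> (t (s j)).2 = (t j).2.
Proof. by case/colstabP=> _ /(_ j) [] // H; rewrite ltnNge H. Qed.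

Lemma colstab1 al t : colstab al t 1%g.
Proof. by apply/forallP=> j; rewrite perm1 eqxx; case: ifP. Qed.

Lemma colstabM al t s s' : colstab al t s -> colstab al t s' -> colstab al t (s * s')%g.
Proof.
move=> S S'; apply/colstabP; split=> [|j]; first by rewrite in_SkM ?(colstab_Sk S) ?(colstab_Sk S').
case: (ltnP j (psize al)) => kj; [left | by right].
by rewrite permM (colstab_col S') ?(in_Sk_lt _ (colstab_Sk S)) // (colstab_col S).
Qed.

Lemma colstabV al t s : colstab al t (s^-1)%g = colstab al t s.
Proof.
suff H u : colstab al t u -> colstab al t (u^-1)%g.
  by apply/idP/idP => /H //; rewrite invgK.
move=> S; have SV : in_Sk (psize al) (u^-1)%g by rewrite in_SkV (colstab_Sk S).
apply/colstabP; split=> // j; case: (ltnP j (psize al)) => kj; [left | by right].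
by rewrite -{2}(permKV u j) (colstab_col S) // in_Sk_lt.
Qed.

Definition colanti al t w : MF F N :=
  \sum_(s | colstab al t s) ((-1) ^+ odd_perm s) *: gact s w.

Lemma colanti_is_linear al t : linear (colanti al t).
Proof.
move=> a w v; rewrite /colanti scaler_sumr -big_split /=; apply: eq_bigr => s _.
by rewrite linearP scalerDr !scalerA mulrC.
Qed.
HB.instance Definition _ al t :=
  GRing.isLinear.Build F (MF F N) (MF F N) _ (colanti al t) (colanti_is_linear al t).

Lemma dot_colanti al t w v : dot (colanti al t w) v = dot w (colanti al t v).
Proof.
rewrite /colanti dot_suml dot_sumr (reindex_inj invg_inj) /=.
apply: eq_big => [s|s _]; first by rewrite colstabV.
by rewrite dotZl dotZr dot_gactl invgK odd_permV.
Qed.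

Lemma tabloid_act al t g : in_Sk (psize al) g ->
  tabloid_of al (tblact g t) = [ffun j => tabloid_of al t ((g^-1)%g j)].
Proof.
move=> gS; apply/ffunP=> j; rewrite !ffunE.
by rewrite (in_Sk_lt _ (_ : in_Sk (psize al) (g^-1)%g)) // in_SkV.
Qed.

Lemma polytabE al t : polytab F al t = colanti al t (tdelta F (tabloid_of al t)).
Proof.
apply: eq_bigr => s S; rewrite gact_tdelta; congr (_ *: tdelta F _).
by rewrite -(tabloid_act _ (colstab_Sk S)).
Qed.

Lemma gact_colanti al t s w : colstab al t s ->
  gact s (colanti al t w) = (-1) ^+ odd_perm s *: colanti al t w.
Proof.
move=> S; rewrite /colanti raddf_sum scaler_sumr /=.
rewrite [RHS](reindex_inj (mulIg s)) /=; apply: eq_big => u.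
  apply/idP/idP => U; first exact: colstabM.
  by rewrite -(mulgK s u) colstabM ?colstabV.
move=> U; rewrite linearZ /= gactM scalerA; congr (_ *: _).
by rewrite odd_permM -signr_addb addbC addbK.
Qed.

Definition ncolstab al t := #|[set s | colstab al t s]|.

Lemma colanti_colanti al t w : colanti al t (colanti al t w) = (ncolstab al t)%:R *: colanti al t w.
Proof.
rewrite {1}/colanti (eq_bigr (fun=> colanti al t w)) => [|s S].
  by rewrite sumr_const scaler_nat /ncolstab cardsE.
by rewrite gact_colanti // scalerA -signr_addb addbb scale1r.
Qed.

(** The transposition lies in the column stabiliser, so applying it to [w] first changes the sign of
    the antisymmetrised vector; as it fixes [w], that vector equals its own negative. *)
Lemma colanti_transp al t w (i j : 'I_N) : i != j -> (i < psize al)%N -> (j < psize al)%N ->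
  (t i).2 = (t j).2 -> gact (tperm i j) w = w -> [pchar F] =i pred0 -> colanti al t w = 0.
Proof.
move=> ij ik jk cij wE ch.
have S : colstab al t (tperm i j).
  apply/forallP=> l; case: tpermP => [->|->|/eqP _ /eqP _]; rewrite ?ik ?jk ?cij ?eqxx //.
  by case: ifP.
have E : colanti al t (gact (tperm i j) w) = - colanti al t w.
  rewrite /colanti -sumrN [LHS](reindex_inj (mulgI (tperm i j))) /=.
  apply: eq_big => u; first apply/idP/idP => U.
  - by rewrite -(mulKg (tperm i j) u) colstabM ?colstabV.
  - exact: colstabM.
  move=> _; rewrite gactM mulgA tperm2 mul1g odd_permM odd_tperm ij.
  by rewrite signr_addb expr1 mulN1r scaleNr.
move: E; rewrite wE => /eqP; rewrite -subr_eq0 opprK -mulr2n -scaler_nat scaler_eq0.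
by rewrite ((pcharf0P F).1 ch) => /orP[|/eqP].
Qed.

Lemma colstab_act al t g s : in_Sk (psize al) g ->
  colstab al (tblact g t) s = colstab al t (s ^ g^-1)%g.
Proof.
move=> gS.
have H t' g' s' : in_Sk (psize al) g' -> colstab al t' s' -> colstab al (tblact g' t') (s' ^ g')%g.
  move=> gS' S; apply/colstabP; split=> [|j].
    by rewrite conjgE !in_SkM ?in_SkV ?(colstab_Sk S).
  case: (ltnP j (psize al)) => kj; [left | by right].
  rewrite !ffunE conjgE !permM permK (colstab_col S) //.
  by rewrite in_Sk_lt ?in_SkV.
apply/idP/idP => S; last by rewrite -(conjgKV g s) H.
have -> : t = tblact (g^-1)%g (tblact g t).
  by apply/ffunP=> j; rewrite !ffunE invgK permK.
by rewrite H ?in_SkV.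
Qed.

Lemma gact_colanti_conj al t g w : in_Sk (psize al) g ->
  gact g (colanti al t w) = colanti al (tblact g t) (gact g w).
Proof.
move=> gS; rewrite /colanti raddf_sum /= (reindex_inj (conjg_inj (g^-1)%g)) /=.
apply: eq_big => s; first by rewrite colstab_act.
move=> S; rewrite linearZ /= !gactM; congr (_ *: gact _ w).
  by rewrite odd_permJ.
by rewrite conjgE invgK mulgA mulgKV.
Qed.

Lemma gact_polytab al t g : in_Sk (psize al) g ->
  gact g (polytab F al t) = polytab F al (tblact g t).
Proof. by move=> gS; rewrite !polytabE gact_colanti_conj // gact_tdelta tabloid_act. Qed.

Lemma tableau_act al t g : in_Sk (psize al) g -> is_tableau al t ->
  is_tableau al (tblact g t).
Proof.
move=> gS /andP[/forallP box /forallP inj]; apply/andP; split; apply/forallP=> j.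
  apply/implyP=> jk; rewrite ffunE; apply: (implyP (box _)).
  by rewrite in_Sk_lt ?in_SkV.
apply/forallP=> j'; apply/implyP=> /and3P[jk j'k].
rewrite !ffunE => E; rewrite -(inj_eq (@perm_inj _ (g^-1)%g)).
by apply: (implyP (forallP (inj _) _)); rewrite !in_Sk_lt ?in_SkV ?jk ?j'k.
Qed.

Lemma tableauP al t :
  reflect ((forall j : 'I_N, (j < psize al)%N -> ((t j).2 < al (t j).1)%N) /\
     (forall i j : 'I_N, (i < psize al)%N -> (j < psize al)%N -> t i = t j -> i = j))
  (is_tableau al t).
Proof.
apply: (iffP andP) => [[/forallP box /forallP inj]|[box inj]]; split.
- by move=> j /(implyP (box j)).
- move=> i j ik jk E; apply/eqP/(implyP (forallP (inj i) j)).
  by rewrite ik jk E eqxx.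
- by apply/forallP=> j; apply/implyP/box.
- apply/forallP=> i; apply/forallP=> j; apply/implyP=> /and3P[ik jk /eqP E].
  by rewrite (inj i j).
Qed.

Lemma polytab_specht al t : is_tableau al t -> polytab F al t \in specht F al.
Proof.
by move=> T; apply: memv_span; apply/mapP; exists t; rewrite // mem_filter T mem_enum.
Qed.

Lemma specht_ind al (V : {vspace MF F N}) :
  (forall t, is_tableau al t -> polytab F al t \in V) -> (specht F al <= V)%VS.
Proof.
by move=> H; apply/span_subvP => v /mapP[t]; rewrite mem_filter => /andP[T _] ->; apply: H.
Qed.

Lemma specht_eq (W : vectType F) al (f f' : {linear MF F N -> W}) :
  (forall t, is_tableau al t -> f (polytab F al t) = f' (polytab F al t)) ->
  {in specht F al, f =1 f'}.
Proof.
move=> H w; suff /subvP S : (specht F al <= lker (linfun f - linfun f'))%VS.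
  by move=> /S; rewrite memv_ker add_lfunE opp_lfunE !lfunE /= subr_eq0 => /eqP.
apply: specht_ind => t T; rewrite memv_ker add_lfunE opp_lfunE !lfunE /= H //.
by rewrite subrr.
Qed.

Lemma gact_specht al g w : in_Sk (psize al) g -> w \in specht F al ->
  gact g w \in specht F al.
Proof.
move=> gS; suff /subvP S : (specht F al <= linfun (@gact F N g) @^-1: specht F al)%VS.
  by move=> /S; rewrite -memv_preim lfunE.
apply: specht_ind => t T.
by rewrite -memv_preim lfunE /= gact_polytab // polytab_specht ?tableau_act.
Qed.

End Polytabloids.

(** * Tableaux as bijections from entries to boxes *)

Section Tableaux.
Variable N : nat.
Implicit Types (al la mu : Ptn N) (t q s : Tbl N).

Definition boxes al := [set b : 'I_N.+1 * 'I_N.+1 | (b.2 < al b.1)%N].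
Definition entries k := [set j : 'I_N | (j < k)%N].

Lemma card_entries k : (k <= N)%N -> #|entries k| = k.
Proof.
move=> kN; rewrite -sum1dep_card.
by rewrite -(big_ord_widen _ (fun=> 1%N) kN) sum1_card card_ord.
Qed.

Lemma card_row al i : #|[set c : 'I_N.+1 | (c < al i)%N]| = al i.
Proof.
rewrite -sum1dep_card.
by rewrite -(big_ord_widen _ (fun=> 1%N) (ltnW (ltn_ord (al i)))) sum1_card card_ord.
Qed.

Lemma sum_boxes al (f : 'I_N.+1 -> nat) :
  (\sum_(b in boxes al) f b.1 = \sum_i f i * al i)%N.
Proof.
transitivity (\sum_(i : 'I_N.+1) \sum_(c : 'I_N.+1 | (c < al i)%N) f i)%N.
  by rewrite pair_big_dep /=; apply: eq_bigl => b; rewrite inE.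
apply: eq_bigr => i _; rewrite sum_nat_const mulnC; congr (_ * _)%N.
by rewrite -[RHS]card_row cardsE.
Qed.

Lemma card_boxes al : #|boxes al| = psize al.
Proof.
rewrite -sum1_card (sum_boxes al (fun=> 1%N)); apply: eq_bigr => i _.
by rewrite mul1n.
Qed.

(** [is_tableau] asks only for injectivity into the diagram; there are as many entries as boxes, so
    counting gives surjectivity. *)
Lemma tableau_imset al t : is_tableau al t -> (psize al <= N)%N ->
  t @: entries (psize al) = boxes al.
Proof.
move=> /tableauP[box inj] kN; apply/eqP; rewrite eqEcard; apply/andP; split.
  by apply/subsetP=> _ /imsetP[j + ->]; rewrite !inE => /box.
rewrite card_boxes card_in_imset ?card_entries // => i j.
by rewrite !inE => ik jk /inj ->.
Qed.

Lemma tableau_surj al t (b : 'I_N.+1 * 'I_N.+1) : is_tableau al t -> (psize al <= N)%N ->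
  (b.2 < al b.1)%N -> exists2 j : 'I_N, (j < psize al)%N & t j = b.
Proof.
move=> T kN bB; have : b \in boxes al by rewrite inE.
by rewrite -(tableau_imset T kN) => /imsetP[j]; rewrite inE => jk ->; exists j.
Qed.

Lemma sum_tableau al t (R : nmodType) (f : 'I_N.+1 * 'I_N.+1 -> R) :
  is_tableau al t -> (psize al <= N)%N ->
  \sum_(j : 'I_N | (j < psize al)%N) f (t j) = \sum_(b in boxes al) f b.
Proof.
move=> T kN; rewrite -(tableau_imset T kN) big_imset /=.
  by apply: eq_bigl => j; rewrite inE.
case/tableauP: T => _ inj i j; rewrite !inE => ik jk; exact: inj.
Qed.

(** The statistic n(al) of symmetric function theory, with rows counted from 0. It decreases when
    the shape grows in the dominance order, so comparing these numbers stands in for comparing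
    shapes by dominance. *)
Definition row_weight al := (\sum_(i : 'I_N.+1) i * al i)%N.

Lemma sum_tableau_row al t : is_tableau al t -> (psize al <= N)%N ->
  (\sum_(j : 'I_N | j < psize al) (t j).1 = row_weight al)%N.
Proof.
move=> T kN; rewrite (sum_tableau (fun b => b.1 : nat) T kN).
exact: (sum_boxes al (fun i => i : nat)).
Qed.

Lemma row_count al t i : is_tableau al t -> (psize al <= N)%N ->
  #|[set j : 'I_N | (j < psize al)%N && ((t j).1 == i)]| = al i.
Proof.
move=> T kN; rewrite -sum1dep_card -[RHS]mul1n.
rewrite (eq_bigr (fun j => 1%N)) // big_mkcondr /=.
rewrite (sum_tableau (fun b => if b.1 == i then 1%N else 0%N) T kN).
rewrite (sum_boxes al (fun i' => if i' == i then 1 else 0)%N) (bigD1 i) //= eqxx.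
by rewrite big1 ?addn0 // => i' /negPf ->.
Qed.

Lemma tableau_ext al t q : (forall j : 'I_N, (j < psize al)%N -> q j = t j) ->
  is_tableau al t -> is_tableau al q.
Proof.
move=> E /tableauP[box inj]; apply/tableauP; split=> [j jk|i j ik jk].
  by rewrite E ?box.
by rewrite !E //; apply: inj.
Qed.

Lemma tableau_trans al t q : is_tableau al t -> is_tableau al q -> (psize al <= N)%N ->
  exists2 g, in_Sk (psize al) g & forall j : 'I_N, (j < psize al)%N -> q j = t (g j).
Proof.
move=> T Q kN; set k := psize al in kN *.
(* The permutation sends [j] to the entry that [t] has in the box of [j] in [q]; entries from [k] on
   are padding and stay fixed. *)
have surj (j : 'I_N) : exists i : 'I_N,
    if (j < k)%N then (i < k)%N && (t i == q j) else i == j.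
  case: ltnP => jk; last by exists j.
  have [i ik E] := tableau_surj (b := q j) T kN ((tableauP _ _ Q).1 _ jk).
  by exists i; rewrite ik E eqxx.
pose g0 j := xchoose (surj j).
have g0P (j : 'I_N) : if (j < k)%N then (g0 j < k)%N && (t (g0 j) == q j) else g0 j == j.
  exact: (xchooseP (surj j)).
have inj : injective g0.
  move=> i j E; move: (g0P i) (g0P j); rewrite E.
  case: (ltnP i k) => ik; case: (ltnP j k) => jk.
  - move=> /andP[gk /eqP Ei] /andP[_ /eqP Ej].
    by apply: (tableauP _ _ Q).2 => //; rewrite -Ei -Ej.
  - by move=> /andP[gk _] /eqP gj; rewrite gj ltnNge jk in gk.
  - by move=> /eqP gi /andP[gk _]; rewrite gi ltnNge ik in gk.
  by move=> /eqP <- /eqP.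
exists (perm inj) => [|j jk].
  by apply/in_SkP=> j kj; have := g0P j; rewrite ltnNge kj permE => /eqP.
by rewrite permE; have := g0P j; rewrite jk => /andP[_ /eqP].
Qed.

Lemma partitionP al : reflect (forall i j : 'I_N.+1, (i <= j)%N -> (al j <= al i)%N) (is_partition al).
Proof.
apply: (iffP forallP) => [H i j ij|H i]; first exact: (implyP (forallP (H i) j)).
by apply/forallP=> j; apply/implyP/H.
Qed.

(* Columns of a Young diagram are initial segments, so among column-injective row assignments
   with the columns of t, those filling the diagram are exactly the ones minimising the sum of rows:
   weigh a box (i, c) by i - h_c, with h_c the height of column c. *)
Lemma tableau_of_rows la t q : is_partition la -> is_tableau la t -> (psize la <= N)%N ->
  (forall j : 'I_N, (j < psize la)%N -> (q j).2 = (t j).2) ->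
  (forall i j : 'I_N, (i < psize la)%N -> (j < psize la)%N -> q i = q j -> i = j) ->
  (\sum_(j : 'I_N | j < psize la) (q j).1 <= row_weight la)%N -> is_tableau la q.
Proof.
move=> /partitionP P T kN qc qinj; set k := psize la in kN qc qinj *.
pose h (c : 'I_N.+1) := #|[set i : 'I_N.+1 | (c < la i)%N]|.
have hP (i c : 'I_N.+1) : (c < la i)%N = (i < h c)%N.
  have ci (l : nat) : (l <= N.+1)%N -> #|[set i' : 'I_N.+1 | (i' < l)%N]| = l.
    move=> lN; rewrite -sum1dep_card.
    by rewrite -(big_ord_widen _ (fun=> 1%N) lN) sum1_card card_ord.
  case: (ltnP c (la i)) => ic.
    rewrite /h -{1}(ci i.+1) ?ltn_ord //; apply/esym/subset_leq_card/subsetP=> i'.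
    by rewrite !inE ltnS => /P /(leq_trans ic).
  apply/esym/negbTE; rewrite -leqNgt /h -[X in (_ <= X)%N](ci i) ?(ltnW (ltn_ord _)) //.
  apply/subset_leq_card/subsetP=> i'; rewrite !inE => ci'.
  by rewrite ltnNge; apply/negP=> /P /(leq_trans ci'); rewrite ltnNge ic.
pose wt (b : 'I_N.+1 * 'I_N.+1) : int := (b.1 : nat)%:Z - (h b.2)%:Z.
pose Q := q @: entries k.
move=> le.
have qinj' : {in entries k &, injective q} by move=> i j; rewrite !inE => ik jk /qinj ->.
have cQ : #|Q| = k by rewrite card_in_imset ?card_entries.
(* Entry by entry the columns of [q] and [t] agree, so the height terms cancel and only the row sums
   are compared. *)
have leQ : \sum_(b in Q) wt b <= \sum_(b in boxes la) wt b.
  rewrite -(sum_tableau wt T kN) big_imset //= (eq_bigl (fun j : 'I_N => (j < k)%N)); last first.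
    by move=> j; rewrite inE.
  rewrite /wt !sumrB (eq_bigr (fun j => (h (t j).2)%:Z) (F1 := fun j => (h (q j).2)%:Z)); last first.
    by move=> j jk; rewrite qc.
  rewrite lerD2r -!(big_morph Posz PoszD (erefl _)) lez_nat.
  by rewrite (sum_tableau_row T kN).
(* The weight is negative exactly on the diagram. Replacing a box of the diagram by one outside
   therefore raises the total, which [leQ] forbids. *)
have neg : forall b, b \in boxes la -> wt b < 0.
  by move=> b; rewrite inE hP /wt subr_lt0 ltz_nat.
have sub : boxes la \subset Q.
  rewrite -setD_eq0; apply/eqP/setP=> b; rewrite in_set0; apply/negP=> bD.
  have : \sum_(b in boxes la) wt b < \sum_(b in Q) wt b.
    rewrite (big_setID Q) [ltRHS](big_setID (boxes la)) /= setIC.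
    rewrite ltrD2l; apply: (@lt_le_trans _ _ 0).
      rewrite (bigD1 b) //=; apply: ltr_wnDr; last first.
        by apply: neg; move: bD; rewrite inE => /andP[].
      by apply: sumr_le0 => b' /andP[]; rewrite inE => /andP[_ /neg /ltW].
    apply: sumr_ge0 => b'; rewrite !inE hP -leqNgt => /andP[hb _].
    by rewrite /wt subr_ge0 lez_nat.
  by rewrite ltNge leQ.
have QE : Q = boxes la.
  by apply/esym/eqP; rewrite eqEcard sub cQ card_boxes /=.
apply/tableauP; split=> // j jk.
have : q j \in boxes la by rewrite -QE imset_f // inE.
by rewrite inE.
Qed.

End Tableaux.

(** * The antisymmetriser as a rank one operator on Specht modules, and the frame operator *)

Section Antisymmetrizer.
Variables (F : fieldType) (N : nat).
Hypothesis char0 : [pchar F] =i pred0.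
Implicit Types (w v : MF F N) (g h : {perm 'I_N}) (al la mu : Ptn N) (t q s : Tbl N).

Lemma natF_eq0 n : ((n%:R : F) == 0) = (n == 0)%N.
Proof. exact: ((pcharf0P F).1 char0). Qed.

Lemma ncolstab_neq0 al t : (ncolstab al t)%:R != 0 :> F.
Proof.
rewrite natF_eq0 -lt0n; apply/card_gt0P; exists 1%g.
by rewrite inE colstab1.
Qed.

Lemma colanti_gact al t (s : {perm 'I_N}) w : colstab al t s -> colanti al t (gact s w) = (-1) ^+ odd_perm s *: colanti al t w.
Proof.
move=> S; rewrite /colanti scaler_sumr [RHS](reindex_inj (mulgI s)) /=.
apply: eq_big => u; first apply/idP/idP => U.
- exact: colstabM.
- by rewrite -(mulKg s u) colstabM ?colstabV.
by move=> _; rewrite gactM scalerA odd_permM -signr_addb addKb.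
Qed.

Lemma polytab_ext al t q : (forall j : 'I_N, (j < psize al)%N -> q j = t j) ->
  polytab F al q = polytab F al t.
Proof.
move=> E.
have tE g : in_Sk (psize al) g -> tabloid_of al (tblact g q) = tabloid_of al (tblact g t).
  move=> gS; apply/ffunP=> j; rewrite !ffunE; case: ifP => // jk.
  by rewrite E // in_Sk_lt // in_SkV.
rewrite /polytab; apply: eq_big => s.
  apply/idP/idP => S; apply/colstabP; (split; first exact: colstab_Sk S) => j;
  case: (ltnP j (psize al)) => jk; try (by right); left.
    by rewrite -!E ?(colstab_col S) // (in_Sk_lt _ (colstab_Sk S)).
  by rewrite !E ?(colstab_col S) // (in_Sk_lt _ (colstab_Sk S)).
move=> S; congr (_ *: tdelta F _); exact: (tE _ (colstab_Sk S)).
Qed.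

Lemma polytab_trans al t q : is_tableau al t -> is_tableau al q -> (psize al <= N)%N ->
  exists2 g, in_Sk (psize al) g & polytab F al q = gact g (polytab F al t).
Proof.
move=> T Q kN; have [g gS E] := tableau_trans T Q kN.
exists (g^-1)%g; first by rewrite in_SkV.
rewrite gact_polytab ?in_SkV //; apply: polytab_ext => j jk.
by rewrite ffunE invgK E.
Qed.

(** Only the identity contributes: a column permutation that also keeps every entry in its row
    preserves the box of each entry, and [t] is injective. *)
Lemma polytab_tabloid al t : is_tableau al t -> polytab F al t (tabloid_of al t) = 1.
Proof.
move=> T; rewrite /polytab sum_ffunE (bigD1 (1%g : {perm 'I_N})) ?colstab1 //= big1 => [|s /andP[S s1]].
  rewrite addr0 odd_perm1 expr0 scale1r ffunE (_ : [ffun j => _] = t) ?eqxx //.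
  by apply/ffunP=> j; rewrite ffunE invg1 perm1.
rewrite !ffunE; case: eqP => [E|_]; last by rewrite scaler0.
case/eqP: s1; apply/permP=> j; rewrite perm1; case: (ltnP j (psize al)) => jk; last first.
  by rewrite (in_SkP _ _ (colstab_Sk S)).
apply: (tableauP _ _ T).2 => //; first by rewrite (in_Sk_lt _ (colstab_Sk S)).
have := colstab_col S jk; move/ffunP/(_ (s j)): E.
rewrite !ffunE (in_Sk_lt _ (colstab_Sk S)) jk permK.
by case: (t (s j)) (t j) => [a b] [a' b'] /= -> ->.
Qed.

(** Let [q] take its rows from [s] and its columns from [t]. If two entries share a box of [q],
    their transposition fixes the tabloid of [s] and preserves the columns of [t], so the
    antisymmetriser kills it. Otherwise [tableau_of_rows] makes [q] a tableau of shape [la]; its row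
    lengths are those of [s], so the shapes agree, and the permutation from [t] to [q] lies in the
    column stabiliser and contributes only a sign. *)
Lemma colanti_tabloid la mu t s : is_partition la -> is_tableau la t -> is_tableau mu s ->
  psize mu = psize la -> (psize la <= N)%N -> (row_weight mu <= row_weight la)%N ->
  colanti la t (tdelta F (tabloid_of mu s)) != 0 ->
  mu = la /\ exists a, colanti la t (tdelta F (tabloid_of mu s)) = a *: polytab F la t.
Proof.
move=> P T S szE kN le ne0; set k := psize la in szE kN *.
pose q : Tbl N := [ffun j => ((s j).1, (t j).2)].
have Q : is_tableau la q.
  apply: (tableau_of_rows P T kN); first by move=> j _; rewrite ffunE.
  - move=> i j ik jk; rewrite !ffunE => -[Er Ec]; apply/eqP; apply: contraNT ne0 => ij.
    apply/eqP/(colanti_transp ij ik jk Ec _ char0).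
    rewrite gact_tdelta tpermV; congr tdelta; apply/ffunP=> l; rewrite !ffunE szE.
    by case: tpermP => [->|->|//]; rewrite ?ik ?jk /k ?ik ?jk.
  - rewrite (eq_bigr (fun j => (s j).1 : nat)) => [|j _]; last by rewrite ffunE.
    by rewrite -/k -szE sum_tableau_row ?szE.
have [g gS E] := tableau_trans T Q kN; split.
  apply/ffunP=> i; apply: val_inj; rewrite /= -(row_count i S) ?szE // -(row_count i Q) //=.
  by apply: eq_card => j; rewrite !inE ffunE.
have G : colstab la t g.
  apply/colstabP; split=> // j; case: (ltnP j k) => jk; [left | by right].
  by rewrite -E // ffunE.
have -> : tdelta F (tabloid_of mu s) = gact (g^-1)%g (tdelta F (tabloid_of la t)).
  rewrite gact_tdelta invgK; congr tdelta; apply/ffunP=> j.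
  rewrite !ffunE szE (in_Sk_lt _ gS) -/k; case: ifP => // jk.
  by rewrite -E // ffunE.
by eexists; rewrite colanti_gact ?colstabV // -polytabE.
Qed.

Lemma colanti_specht_line la mu t w : is_partition la -> is_tableau la t ->
  psize mu = psize la -> (psize la <= N)%N -> (row_weight mu <= row_weight la)%N ->
  w \in specht F mu -> colanti la t w \in (if mu == la then <[polytab F la t]>%VS else 0%VS).
Proof.
move=> P T szE kN le; set V := (if _ then _ else _).
suff /subvP S : (specht F mu <= linfun (colanti la t) @^-1: V)%VS.
  by move=> /S; rewrite -memv_preim lfunE.
apply: specht_ind => s S; rewrite -memv_preim lfunE /= polytabE [colanti mu s _]/colanti raddf_sum.
apply: rpred_sum => g G; rewrite /= linearZ; apply: rpredZ.
rewrite gact_tdelta -tabloid_act ?(colstab_Sk G) //.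
rewrite /=; case: (eqVneq (colanti la t (tdelta F (tabloid_of mu (tblact g s)))) 0) => [->|ne0].
  exact: rpred0.
have S' := tableau_act (colstab_Sk G) S.
have [E [a Ea]] := colanti_tabloid P T S' szE kN le ne0.
by rewrite Ea /V E eqxx memvZ ?memv_line.
Qed.

Lemma colanti_specht_neq la mu t w : is_partition la -> is_tableau la t ->
  psize mu = psize la -> (psize la <= N)%N -> (row_weight mu <= row_weight la)%N -> mu != la ->
  w \in specht F mu -> colanti la t w = 0.
Proof.
move=> P T szE kN le /negPf ne W.
by have := colanti_specht_line P T szE kN le W; rewrite ne memv0 => /eqP.
Qed.

(** The scalar is read off at the tabloid of [t], where the polytabloid has coefficient 1;
    self-adjointness of [colanti] turns that coefficient into a pairing with [w]. *)
Lemma colanti_specht la t w : is_partition la -> is_tableau la t -> (psize la <= N)%N ->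
  w \in specht F la -> colanti la t w = dot w (polytab F la t) *: polytab F la t.
Proof.
move=> P T kN W; have := colanti_specht_line P T (erefl _) kN (leqnn _) W.
rewrite eqxx => /vlineP[a E]; rewrite E; congr (_ *: _).
rewrite polytabE -dot_colanti E dotZl dot_tdelta polytab_tabloid //.
by rewrite mulr1.
Qed.

(** Integral form of the coefficients of a polytabloid: the sum of squares in [frame_scalar] is
    bounded below here, where there is an order. *)
Definition zpoly la t (r : Tab N) : int :=
  \sum_(s | colstab la t s) (-1) ^+ odd_perm s * (r == tabloid_of la (tblact s t))%:R.

Lemma polytab_zpoly la t r : polytab F la t r = (zpoly la t r)%:~R.
Proof.
rewrite /polytab sum_ffunE /zpoly rmorph_sum /=; apply: eq_bigr => s _.
by rewrite !ffunE rmorphM /= rmorphXn /= rmorphN1; congr (_ * _); case: eqP.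
Qed.

Definition zdot la t q : int := \sum_r zpoly la t r * zpoly la q r.

Lemma dot_zdot la t q : dot (polytab F la t) (polytab F la q) = (zdot la t q)%:~R.
Proof.
rewrite /dot /zdot rmorph_sum /=; apply: eq_bigr => r _.
by rewrite rmorphM /= !polytab_zpoly.
Qed.

Lemma dot_polytab la t : is_tableau la t ->
  dot (polytab F la t) (polytab F la t) = (ncolstab la t)%:R.
Proof.
move=> T; rewrite {2}polytabE -dot_colanti polytabE colanti_colanti dotZl dot_tdelta -polytabE.
by rewrite polytab_tabloid // mulr1.
Qed.

Lemma dot_polytab_neq0 la t : is_tableau la t -> dot (polytab F la t) (polytab F la t) != 0.
Proof. by move=> T; rewrite dot_polytab // ncolstab_neq0. Qed.

(** The frame operator of the spanning family of polytabloids. It is self-adjoint and equivariant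
    and needs no choice of basis; by [frame_scalar] it is a nonzero multiple of the orthogonal
    projection onto the Specht module. *)
Definition frame la w : MF F N :=
  \sum_(t | is_tableau la t) dot w (polytab F la t) *: polytab F la t.

Lemma frame_is_linear la : linear (frame la).
Proof.
move=> a w v; rewrite /frame scaler_sumr -big_split /=; apply: eq_bigr => t _.
by rewrite dotC dotDr dotZr !(dotC (polytab _ _ _)) scalerDl scalerA.
Qed.
HB.instance Definition _ la :=
  GRing.isLinear.Build F (MF F N) (MF F N) _ (frame la) (frame_is_linear la).

Lemma frame_specht la w : frame la w \in specht F la.
Proof. by apply: rpred_sum => t T; rewrite rpredZ // polytab_specht. Qed.

Lemma dot_frame la w v : dot (frame la w) v = dot w (frame la v).
Proof.
rewrite dot_suml dot_sumr; apply: eq_bigr => t _.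
by rewrite dotZl dotZr mulrC dotC [in RHS]dotC [in RHS]mulrC mulrC; congr (_ * _); rewrite dotC.
Qed.

Lemma tblactK g : cancel (@tblact N g) (tblact g^-1%g).
Proof. by move=> t; apply/ffunP=> j; rewrite !ffunE invgK permK. Qed.

Lemma frame_gact la g w : in_Sk (psize la) g -> frame la (gact g w) = gact g (frame la w).
Proof.
move=> gS; rewrite /frame raddf_sum /=.
rewrite (reindex_inj (can_inj (tblactK g))) /=; apply: eq_big => t.
  apply/idP/idP; last exact: tableau_act.
  by move=> H; rewrite -(tblactK g t); apply: tableau_act; rewrite ?in_SkV.
move=> T; rewrite linearZ /= gact_polytab // -gact_polytab // dot_gactl gactM mulgV.
by rewrite gact1.
Qed.

Lemma colanti_frame la s w : colanti la s (frame la w) = frame la (colanti la s w).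
Proof.
rewrite [X in _ = frame la X]/colanti [RHS]raddf_sum /=; apply: eq_bigr => g G.
by rewrite [RHS]linearZ /= frame_gact ?(colstab_Sk G).
Qed.

(** A substitute for Schur's lemma. [frame] commutes with [colanti], which maps the Specht module to
    the line of one polytabloid [e], so [e] is an eigenvector; its translates span, so the
    eigenvalue [c] is common to all. The pairing of [frame la e] with [e] is the sum of the squared
    integers given by the pairings of [e] with all polytabloids, and the term of [e] itself is
    nonzero. *)
Lemma frame_scalar la : is_partition la -> (psize la <= N)%N ->
  exists2 c, c != 0 & forall w, w \in specht F la -> frame la w = c *: w.
Proof.
move=> P kN.
case: (pickP (is_tableau la)) => [s S|none]; last first.
  exists 1; first exact: oner_neq0.
  move=> w; suff /subvP H : (specht F la <= 0)%VS.
    by move=> /H; rewrite memv0 => /eqP ->; rewrite raddf0 scaler0.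
  by apply: specht_ind => t; rewrite none.
set e := polytab F la s; pose c := dot (frame la e) e / (ncolstab la s)%:R.
have eS : e \in specht F la by apply: polytab_specht.
have n0 := ncolstab_neq0 la s.
have frE : frame la e = c *: e.
  have := colanti_frame la s e; rewrite {2}/e polytabE colanti_colanti -polytabE -/e.
  rewrite (colanti_specht P S kN (frame_specht la e)) linearZ /= => E.
  by rewrite /c mulrC -scalerA -/e E scalerA mulVf // scale1r.
exists c.
  rewrite mulf_neq0 ?invr_neq0 // /frame dot_suml.
  rewrite (eq_bigr (fun t => (zdot la s t ^+ 2)%:~R)) => [|t _]; last first.
    by rewrite dotZl dotC [dot (polytab _ _ t) _]dotC dot_zdot -rmorphM -expr2.
  rewrite -rmorph_sum /=; set z := \sum_(_ | _) _.
  have : 0 < z.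
    rewrite /z (bigD1 s) //=; apply: ltr_wpDr; first by apply: sumr_ge0 => t _; rewrite sqr_ge0.
    rewrite exprn_even_gt0 //=; apply: contra_neq (dot_polytab_neq0 S) => E.
    by rewrite dot_zdot E.
  by case: z => // n; rewrite ltz_nat -pmulrn natF_eq0 lt0n.
move=> w W; apply: (specht_eq (f := frame la) (f' := GRing.scale c) _ W) => t T.
have [g gS E] := polytab_trans S T kN.
by rewrite /= E frame_gact // frE linearZ.
Qed.

End Antisymmetrizer.

(** * Adding and dropping one entry: adjoint maps between Specht modules of neighbouring shapes *)

Definition adds N (r : 'I_N.+1) (al be : Ptn N) : bool :=
  [forall i, (be i : nat) == (al i + (i == r))%N].
Definition cov N (al be : Ptn N) : bool := [exists r, adds r al be].

Lemma addsP N (r : 'I_N.+1) (al be : Ptn N) :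
  reflect (forall i, be i = (al i + (i == r))%N :> nat) (adds r al be).
Proof. by apply: (iffP forallP) => H i; apply/eqP/H. Qed.

Lemma psize_adds N (r : 'I_N.+1) (al be : Ptn N) : adds r al be -> psize be = (psize al).+1.
Proof.
move=> /addsP H; rewrite /psize (eq_bigr _ (fun i _ => H i)) big_split /=.
have -> : (\sum_(i : 'I_N.+1) (i == r) = 1)%N; last by rewrite addn1.
by rewrite (bigD1 r) //= eqxx big1 // => i /negPf ->.
Qed.

Definition upd N (A : Type) (r : {ffun 'I_N -> A}) (o : 'I_N) (a : A) : {ffun 'I_N -> A} :=
  [ffun j => if j == o then a else r j].

Section Branching.
Variables (F : fieldType) (N : nat).
Hypothesis char0 : [pchar F] =i pred0.
Variables (o : 'I_N) (rr : 'I_N.+1) (al be : Ptn N).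
Implicit Types (w v : MF F N) (g h : {perm 'I_N}) (t q s : Tbl N).

(** Tabloids take the padding value [ord0] on entries outside the shape. So a tabloid with [o] in
    row [rr] is sent to the one with [o] reset to [ord0], and any other tabloid to 0. *)
Definition drop_entry w : MF F N := [ffun r : Tab N => if r o == ord0 then w (upd r o rr) else 0].
Definition add_entry w : MF F N := [ffun r : Tab N => if r o == rr then w (upd r o ord0) else 0].

Lemma drop_entry_is_linear : linear drop_entry.
Proof.
by move=> a w v; apply/ffunP=> r; rewrite !ffunE; case: ifP => _; rewrite ?ffunE ?scaler0 ?addr0.
Qed.
HB.instance Definition _ := GRing.isLinear.Build F (MF F N) (MF F N) _ drop_entry drop_entry_is_linear.
Lemma add_entry_is_linear : linear add_entry.
Proof.
by move=> a w v; apply/ffunP=> r; rewrite !ffunE; case: ifP => _; rewrite ?ffunE ?scaler0 ?addr0.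
Qed.
HB.instance Definition _ := GRing.isLinear.Build F (MF F N) (MF F N) _ add_entry add_entry_is_linear.

Lemma dot_drop_entry w v : dot (drop_entry w) v = dot w (add_entry v).
Proof.
rewrite /dot.
transitivity (\sum_(r : Tab N | r o == ord0) w (upd r o rr) * v r).
  rewrite [RHS]big_mkcond; apply: eq_bigr => r _; rewrite ffunE; case: ifP => //.
  by rewrite mul0r.
transitivity (\sum_(r : Tab N | r o == rr) w r * v (upd r o ord0)); last first.
  rewrite [LHS]big_mkcond; apply: eq_bigr => r _; rewrite !ffunE; case: ifP => //.
  by rewrite mulr0.
rewrite (reindex_onto (fun r : Tab N => upd r o ord0) (fun r : Tab N => upd r o rr)) /=.
  apply: eq_big => r; last first.
    move=> /andP[_ /eqP E]; rewrite E //.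
  rewrite ffunE !eqxx /=; apply/eqP/eqP => [<-|ro]; first by rewrite ffunE eqxx.
  by apply/ffunP=> j; rewrite !ffunE; case: eqP => // ->.
move=> r /eqP ro; apply/ffunP=> j; rewrite !ffunE; case: eqP => // -> //.
Qed.

Lemma drop_entry_gact g w : g o = o -> drop_entry (gact g w) = gact g (drop_entry w).
Proof.
move=> go; apply/ffunP=> r; rewrite !ffunE go; case: ifP => // _; congr (w _).
by apply/ffunP=> j; rewrite !ffunE -{1}go (inj_eq (@perm_inj _ g)).
Qed.

Lemma add_entry_gact g w : g o = o -> add_entry (gact g w) = gact g (add_entry w).
Proof.
move=> go; apply/ffunP=> r; rewrite !ffunE go; case: ifP => // _; congr (w _).
by apply/ffunP=> j; rewrite !ffunE -{1}go (inj_eq (@perm_inj _ g)).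
Qed.

Hypotheses (alP : is_partition al) (beP : is_partition be) (AB : adds rr al be)
  (alk : psize al = o).

Let bek : psize be = o.+1. Proof. by rewrite (psize_adds AB) alk. Qed.
Let oN : (psize al <= N)%N. Proof. by rewrite alk ltnW. Qed.
Let bN : (psize be <= N)%N. Proof. by rewrite bek. Qed.
Let Ar : be rr = (al rr).+1 :> nat. Proof. by rewrite (addsP _ _ _ AB) eqxx addn1. Qed.
Let Ai i : i != rr -> be i = al i.
Proof. by move=> /negPf ne; apply: val_inj; rewrite /= (addsP _ _ _ AB) ne addn0. Qed.

Lemma corner_tableau t : is_tableau be t -> t o = (rr, al rr) -> is_tableau al t.
Proof.
move=> /tableauP[box inj] to; apply/tableauP; rewrite alk; split=> [j jo|i j io jo].
  have jb : (j < psize be)%N by rewrite bek ltnS ltnW.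
  have := box j jb; case: (eqVneq (t j).1 rr) => [E|/Ai -> //].
  rewrite E Ar ltnS leq_eqVlt => /orP[/eqP E2|//].
  have jo' : j = o; last by rewrite jo' ltnn in jo.
  apply: inj => //; first by rewrite bek.
  rewrite to; case: (t j) E E2 => a b /= -> E2; congr (_, _); exact: val_inj.
by apply: inj; rewrite bek ltnS ltnW.
Qed.

(** Columns count from 0, so [(rr, al rr)] is the box by which [be] exceeds [al]. A column
    permutation [s] contributes only if the preimage of [o] under [s] sits in row [rr]; being in the
    column of [o], it then is [o]. The [s] that fix [o] form the column stabiliser of [t] as a
    tableau of shape [al]. *)
Lemma drop_entry_polytab t : is_tableau be t -> t o = (rr, al rr) ->
  drop_entry (polytab F be t) = polytab F al t.
Proof.
move=> T to; rewrite /polytab raddf_sum /=.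
rewrite [RHS]big_mkcond [LHS]big_mkcond /=; apply: eq_bigr => s _.
case: (boolP (colstab be t s)) => S; last first.
  case: ifP => // /colstabP[SS SC]; case/negP: S; apply/colstabP.
  move/in_SkP: SS => SS; split; first by apply/in_SkP=> j; rewrite bek => /ltnW jo; rewrite SS ?alk.
  move=> j; case: (SC j) => [|]; first by left.
  move=> jo; left; by rewrite SS.
have SbS := colstab_Sk S.
case: (eqVneq (s o) o) => so.
  have -> : colstab al t s.
    apply/colstabP; split=> [|j].
      apply/in_SkP=> j; rewrite alk leq_eqVlt => /orP[/eqP jo|jo].
        by rewrite (_ : j = o) //; apply: val_inj.
      by apply: (in_SkP _ _ SbS); rewrite bek.
    by case: (ltnP j (psize be)) => jb; [left; rewrite (colstab_col S)|right; rewrite (leq_trans _ jb) // bek alk].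
  rewrite linearZ /=; congr (_ *: _).
  have sVo : (s^-1)%g o = o by rewrite -{1}so permK.
  apply/ffunP=> r; rewrite !ffunE.
  set T1 := tabloid_of be _; set T2 := tabloid_of al _.
  have T1o : T1 o = rr by rewrite !ffunE bek ltnSn sVo to.
  have T2o : T2 o = ord0 by rewrite !ffunE alk ltnn.
  have T12 j : j != o -> T1 j = T2 j.
    by move=> jo; rewrite !ffunE bek alk ltnS leq_eqVlt (inj_eq val_inj) (negPf jo).
  case: eqP => ro.
    congr (_ %:R); congr (nat_of_bool _); apply/eqP/eqP => [E|->]; apply/ffunP=> j.
      case: (eqVneq j o) => [->|jo]; first by rewrite ro T2o.
      by rewrite -T12 // -E ffunE (negPf jo).
    by rewrite ffunE; case: eqVneq => [->|jo]; rewrite ?T1o // T12.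
  by case: eqP => // E; case: ro; rewrite E T2o.
rewrite (_ : colstab al t s = false); last first.
  by apply/negP=> /colstab_Sk /in_SkP H; rewrite H ?eqxx ?alk in so.
rewrite linearZ /=; apply/ffunP=> r; rewrite !ffunE; case: ifP => _; last by rewrite scaler0.
case: eqP => [E|_]; last by rewrite scaler0.
move/ffunP/(_ o): E; rewrite !ffunE eqxx bek ltnSn => E.
have sVS : colstab be t (s^-1)%g by rewrite colstabV.
have ob : (o < psize be)%N by rewrite bek.
case/eqP: so; rewrite -{2}(permKV s o); congr (s _).
apply/esym; apply: (tableauP _ _ T).2 => //; first by rewrite (in_Sk_lt _ (colstab_Sk sVS)).
have := colstab_col sVS ob; move: E; rewrite to.
by case: (t _) => a b /= -> ->.
Qed.

(** The outer [frame] is needed because adding or dropping an entry away from the corner box can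
    lead out of the Specht module; the inner one makes [up] and [down] adjoint on all of the tabloid
    module. *)
Definition up w := frame be (add_entry (frame al w)).
Definition down w := frame al (drop_entry (frame be w)).

Lemma up_is_linear : linear up.
Proof. by move=> a w v; rewrite /up !linearP. Qed.
HB.instance Definition _ := GRing.isLinear.Build F (MF F N) (MF F N) _ up up_is_linear.
Lemma down_is_linear : linear down.
Proof. by move=> a w v; rewrite /down !linearP. Qed.
HB.instance Definition _ := GRing.isLinear.Build F (MF F N) (MF F N) _ down down_is_linear.

Lemma dot_up w v : dot (up w) v = dot w (down v).
Proof. by rewrite /up /down dot_frame dotC -dot_drop_entry dotC -dot_frame. Qed.

Let SbS g : in_Sk (psize al) g -> in_Sk (psize be) g.
Proof. by move=> /in_SkP H; apply/in_SkP=> j; rewrite bek => /ltnW ?; rewrite H ?alk. Qed.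
Let So g : in_Sk (psize al) g -> g o = o.
Proof. by move=> /in_SkP H; rewrite H ?alk. Qed.

Lemma up_gact g w : in_Sk (psize al) g -> up (gact g w) = gact g (up w).
Proof. by move=> S; rewrite /up frame_gact // add_entry_gact ?So // frame_gact ?SbS. Qed.
Lemma down_gact g w : in_Sk (psize al) g -> down (gact g w) = gact g (down w).
Proof. by move=> S; rewrite /down frame_gact ?SbS // drop_entry_gact ?So // frame_gact. Qed.

Lemma polytab_neq0 mu t : is_tableau mu t -> polytab F mu t != 0.
Proof.
move=> T; apply/eqP=> E; have := @polytab_tabloid F N mu t T.
by rewrite E ffunE => /esym/eqP; rewrite oner_eq0.
Qed.

Lemma down_polytab : exists2 c : F, c != 0 &
  forall t, is_tableau be t -> t o = (rr, al rr) -> down (polytab F be t) = c *: polytab F al t.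
Proof.
have [a a0 aE] := frame_scalar char0 alP oN; have [b b0 bE] := frame_scalar char0 beP bN.
exists (b * a); first by rewrite mulf_neq0.
move=> t T to; rewrite /down bE ?polytab_specht // !linearZ /= drop_entry_polytab //.
by rewrite aE ?scalerA // polytab_specht // corner_tableau.
Qed.

(** Some entry [j] occupies the corner box, and the transposition of [j] and [o] moves [o] there,
    where [down_polytab] applies. *)
Lemma down_neq0 t : is_tableau be t ->
  exists2 g, in_Sk (psize be) g & down (gact g (polytab F be t)) != 0.
Proof.
move=> T.
have [j jb tj] : exists2 j : 'I_N, (j < psize be)%N & t j = (rr, al rr).
  by apply: tableau_surj => //=; rewrite Ar.
have gS : in_Sk (psize be) (tperm j o).
  apply/in_SkP=> i bi; rewrite tpermD //; apply: contraTneq bi => <-; rewrite -ltnNge //.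
  by rewrite bek.
exists (tperm j o) => //; rewrite gact_polytab //.
have T' := tableau_act gS T; have to : tblact (tperm j o) t o = (rr, al rr).
  by rewrite ffunE tpermV tpermR.
have [c c0 ->] := down_polytab => //.
by rewrite scaler_eq0 (negPf c0) /= polytab_neq0 // corner_tableau.
Qed.

(** Extend [t] to [t'] by putting [o] in the new box. By adjointness, pairing with the polytabloid
    of [t'] gives a nonzero multiple of the norm of the polytabloid of [t], which is the order of a
    column stabiliser. *)
Lemma up_neq0 t : is_tableau al t -> up (polytab F al t) != 0.
Proof.
move=> T; pose t' : Tbl N := upd t o (rr, al rr).
have tE (j : 'I_N) : (j < psize al)%N -> t' j = t j.
  by rewrite alk ffunE => jo; case: eqP => // E; rewrite E ltnn in jo.
have to : t' o = (rr, al rr) by rewrite ffunE eqxx.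
have T' : is_tableau be t'.
  have /tableauP[box inj] := T; apply/tableauP.
  have jb (j : 'I_N) : (j < psize be)%N -> j = o \/ (j < psize al)%N.
    rewrite bek alk ltnS leq_eqVlt => /orP[/eqP E|]; [left; exact: val_inj | by right].
  have alr (j : 'I_N) : (j < psize al)%N -> t j <> (rr, al rr).
    by move=> jk E; have := box j jk; rewrite E /= ltnn.
  split=> [j /jb[->|jk]|i j /jb[->|ik] /jb[->|jk]] //.
  - by rewrite to /= Ar.
  - rewrite tE //; apply: (leq_trans (box j jk)).
    by case: (eqVneq (t j).1 rr) => [->|/Ai ->//]; rewrite Ar.
  - by rewrite to tE // => /esym /alr.
  - by rewrite to tE // => /alr.
  - by rewrite !tE //; apply: inj.
have [c c0 cE] := down_polytab.
have tt : polytab F al t' = polytab F al t by apply: polytab_ext.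
apply/eqP=> E; have : dot (up (polytab F al t)) (polytab F be t') = 0 by rewrite E dot0l.
rewrite dot_up cE // tt dotZr => /eqP; rewrite mulf_eq0 (negPf c0) /=.
by rewrite (negPf (dot_polytab_neq0 char0 T)).
Qed.

End Branching.

(** * Separating shapes by antisymmetrisers *)

Section JointInjectivity.
Variables (F : fieldType) (N : nat).
Hypothesis char0 : [pchar F] =i pred0.

(** If all pairings vanish then so does [frame la w], a nonzero multiple of [w]. *)
Lemma specht_nondeg (la : Ptn N) (w : MF F N) : is_partition la -> (psize la <= N)%N ->
  w \in specht F la -> (forall t, is_tableau la t -> dot w (polytab F la t) = 0) -> w = 0.
Proof.
move=> P kN W H; have [c c0 cE] := frame_scalar char0 P kN.
have : frame la w = 0 by rewrite /frame big1 // => t T; rewrite H ?scale0r.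
by rewrite cE // => /eqP; rewrite scaler_eq0 (negPf c0) => /eqP.
Qed.

(* Among the shapes with nonzero component pick the one maximising row_weight: its column
   antisymmetrisers kill all the other components. *)
Lemma joint_inj (P : pred (Ptn N)) k (W : lmodType F) (L : Ptn N -> {linear MF F N -> W})
    (w : Ptn N -> MF F N) : (k <= N)%N ->
  (forall mu, P mu -> is_partition mu /\ psize mu = k) ->
  (forall mu, P mu -> w mu \in specht F mu) ->
  (forall mu t, P mu -> is_tableau mu t ->
     exists2 g, in_Sk k g & L mu (gact g (polytab F mu t)) != 0) ->
  (forall g, in_Sk k g -> \sum_(mu | P mu) L mu (gact g (w mu)) = 0) ->
  forall mu, P mu -> w mu = 0.
Proof.
move=> kN shP wS Lne sum0 mu1 P1; apply/eqP/negP => /negP w1.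
pose Q mu := P mu && (w mu != 0).
have Q1 : Q mu1 by rewrite /Q P1.
case: (arg_maxnP (@row_weight N) Q1) => la /andP[Pla wla] lamax.
have [laP lak] := shP _ Pla.
case/eqP: wla; apply: (specht_nondeg laP _ (wS _ Pla)); first by rewrite lak.
move=> t T; have [g gS gne] := Lne la t Pla T.
(* The maps [L mu] need not be equivariant. This is why the relation is assumed for all translates:
   a signed sum of translates puts the antisymmetriser inside. *)
have : \sum_(mu | P mu) L mu (gact g (colanti la t (w mu))) = 0.
  transitivity (\sum_(s | colstab la t s) (-1) ^+ odd_perm s *:
      \sum_(mu | P mu) L mu (gact (s * g)%g (w mu))).
    under [RHS]eq_bigr => s _ do rewrite scaler_sumr.
    rewrite exchange_big /=; apply: eq_bigr => mu _; rewrite /colanti !raddf_sum /=.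
    by apply: eq_bigr => s _; rewrite !linearZ /= gactM.
  by rewrite big1 // => s /colstab_Sk; rewrite lak => S; rewrite sum0 ?scaler0 // in_SkM.
rewrite (bigD1 la) //= big1 ?addr0; last first.
  move=> mu /andP[Pmu ne]; case: (eqVneq (w mu) 0) => [->|wne]; first by rewrite !raddf0.
  have [muP muk] := shP _ Pmu.
  rewrite (colanti_specht_neq char0 laP T _ _ _ ne (wS _ Pmu)) ?raddf0 ?lak ?muk //.
  by apply: lamax; rewrite /Q Pmu.
rewrite colanti_specht ?lak ?wS // !linearZ /= => /eqP; rewrite scaler_eq0.
by rewrite (negPf gne) orbF => /eqP.
Qed.

End JointInjectivity.

(** * Young's lattice *)

Section YoungLattice.
Variable N : nat.
Implicit Types (al be la mu : Ptn N).

Definition ups la := [set be | is_partition be && cov la be].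
Definition dns la := [set al | is_partition al && cov al la].

Lemma part_le_psize la i : (la i <= psize la)%N.
Proof. by rewrite /psize (bigD1 i) //= leq_addr. Qed.

Lemma adds_inj r la be be' : adds r la be -> adds r la be' -> be = be'.
Proof. by move=> /addsP A /addsP B; apply/ffunP=> i; apply: val_inj; rewrite /= A B. Qed.

Lemma adds_inj_l r la al al' : adds r al la -> adds r al' la -> al = al'.
Proof.
move=> /addsP A /addsP B; apply/ffunP=> i; apply: val_inj => /=.
by apply/eqP; rewrite -(eqn_add2r (i == r)) -A -B.
Qed.

Lemma adds_row la be r r' : adds r la be -> adds r' la be -> r = r'.
Proof.
move=> /addsP A /addsP B; apply/eqP; have := A r; rewrite B eqxx => /eqP.
by rewrite eqn_add2l; case: (r == r').
Qed.

Definition joinp la mu : Ptn N := [ffun i => if (la i <= mu i)%N then mu i else la i].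
Definition meetp la mu : Ptn N := [ffun i => if (la i <= mu i)%N then la i else mu i].

Lemma joinpE la mu i : joinp la mu i = maxn (la i) (mu i) :> nat.
Proof. by rewrite ffunE; case: leqP. Qed.
Lemma meetpE la mu i : meetp la mu i = minn (la i) (mu i) :> nat.
Proof. by rewrite ffunE; case: leqP. Qed.

Lemma joinp_partition la mu : is_partition la -> is_partition mu -> is_partition (joinp la mu).
Proof.
move=> /partitionP A /partitionP B; apply/partitionP=> i j ij.
by rewrite !joinpE geq_max !leq_max A // B // orbT.
Qed.
Lemma meetp_partition la mu : is_partition la -> is_partition mu -> is_partition (meetp la mu).
Proof.
move=> /partitionP A /partitionP B; apply/partitionP=> i j ij.
by rewrite !meetpE leq_min !geq_min A // B // orbT.
Qed.
Lemma joinpC la mu : joinp la mu = joinp mu la.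
Proof. by apply/ffunP=> i; apply: val_inj; rewrite /= !joinpE maxnC. Qed.
Lemma meetpC la mu : meetp la mu = meetp mu la.
Proof. by apply/ffunP=> i; apply: val_inj; rewrite /= !meetpE minnC. Qed.

(** Row by row, max(a, b) - a = b - min(a, b). *)
Lemma adds_join_meet r la mu : adds r la (joinp la mu) = adds r (meetp la mu) mu.
Proof.
apply: eq_forallb => i; rewrite joinpE meetpE.
by case: (i == r); case: (leqP (la i) (mu i)) => h; rewrite ?addn0 ?addn1 ?eqxx //; lia.
Qed.

Lemma cov_join r r' la mu be : adds r la be -> adds r' mu be -> la != mu -> be = joinp la mu.
Proof.
move=> A B ne; have rr : r != r'.
  by apply: contraNneq ne => E; rewrite (adds_inj_l A (al' := mu)) // E.
move/addsP: A => A; move/addsP: B => B.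
apply/ffunP=> i; apply: val_inj; rewrite /= joinpE; have := A i; rewrite B.
have := B i; case: (eqVneq i r) => [->|ir]; first by rewrite (negPf rr); lia.
by case: (i == r'); lia.
Qed.

Lemma cov_meet r r' la mu al : adds r al la -> adds r' al mu -> la != mu -> al = meetp la mu.
Proof.
move=> A B ne; have rr : r != r'.
  by apply: contraNneq ne => E; rewrite (adds_inj A (be' := mu)) // E.
move/addsP: A => A; move/addsP: B => B.
apply/ffunP=> i; apply: val_inj; rewrite /= meetpE; have := A i; have := B i.
case: (eqVneq i r) => [->|ir]; first by rewrite (negPf rr); lia.
by case: (i == r'); lia.
Qed.

(** Distinct shapes have at most one common upper cover, their join, and at most one common lower
    cover, their meet; by [adds_join_meet] either both occur or neither does. *)
Lemma card_ups_dns_neq la mu : is_partition la -> is_partition mu -> la != mu ->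
  #|ups la :&: ups mu| = #|dns la :&: dns mu|.
Proof.
move=> P Q ne.
have upE : ups la :&: ups mu \subset [set joinp la mu].
  apply/subsetP=> be; rewrite !inE => /andP[/andP[_ /existsP[r A]] /andP[_ /existsP[r' B]]].
  by rewrite (cov_join A B ne).
have dnE : dns la :&: dns mu \subset [set meetp la mu].
  apply/subsetP=> be; rewrite !inE => /andP[/andP[_ /existsP[r A]] /andP[_ /existsP[r' B]]].
  by rewrite (cov_meet A B ne).
have E : (joinp la mu \in ups la :&: ups mu) = (meetp la mu \in dns la :&: dns mu).
  rewrite !inE joinp_partition // meetp_partition //= andbC.
  by congr (_ && _); apply: eq_existsb => r; rewrite ?adds_join_meet // joinpC adds_join_meet meetpC.
have sub1 (S : {set Ptn N}) b : S \subset [set b] -> #|S| = (b \in S).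
  rewrite subset1 => /orP[/eqP->|/eqP->]; first by rewrite cards1 inE eqxx.
  by rewrite cards0 inE.
by rewrite (sub1 _ _ upE) (sub1 _ _ dnE) E.
Qed.

Definition addb la (r : 'I_N.+1) : Ptn N := [ffun i => inord (la i + (i == r))].
Definition subb la (r : 'I_N.+1) : Ptn N := [ffun i => inord (la i - (i == r))].

Lemma adds_addb la r : (psize la < N)%N -> adds r la (addb la r).
Proof.
move=> kN; apply/addsP=> i; rewrite ffunE inordK // ltnS.
have := part_le_psize la i; case: (i == r); lia.
Qed.

Lemma adds_subb la r : (0 < la r)%N -> adds r (subb la r) la.
Proof.
move=> kN; apply/addsP=> i; rewrite ffunE inordK.
  by case: (eqVneq i r) => [->|_]; lia.
by apply: (leq_ltn_trans (leq_subr _ _)).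
Qed.

(** If the last of the [N.+1] rows were nonempty, all of them would be, which takes more than [N]
    boxes. *)
Lemma partition_last la : is_partition la -> (psize la < N)%N -> la ord_max = 0%N :> nat.
Proof.
move=> /partitionP P kN; case E: (la ord_max : nat) => [//|c].
have : (\sum_(i < N.+1) 1 <= psize la)%N.
  by apply: leq_sum => i _; apply: (leq_trans _ (P i ord_max (leq_ord i))); rewrite E.
by rewrite sum1_card card_ord leqNgt ltnS ltnW.
Qed.

(** A box can be removed from row r exactly when row r + 1 is shorter, which is exactly when one can
    be added to row r + 1. This matches removals with additions outside row 0, and row 0 always
    accepts one more box. *)
Lemma card_ups_dns la : is_partition la -> (psize la < N)%N -> #|ups la| = #|dns la|.+1.
Proof.
move=> P kN; have := partition_last P kN; move/partitionP: (P) => PP last0.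
pose A := [set r : 'I_N.+1 | is_partition (addb la r)].
pose D := [set r : 'I_N.+1 | (0 < la r)%N && is_partition (subb la r)].
have -> : ups la = addb la @: A.
  apply/setP=> be; rewrite inE; apply/andP/imsetP => [[Q /existsP[r R]]|[r]].
    by have E := adds_inj R (adds_addb r kN); exists r; rewrite // inE -E.
  by rewrite inE => Q ->; split=> //; apply/existsP; exists r; apply: adds_addb.
have -> : dns la = subb la @: D.
  apply/setP=> al; rewrite inE; apply/andP/imsetP => [[Q /existsP[r R]]|[r]].
    have r0 : (0 < la r)%N by rewrite (addsP _ _ _ R) eqxx addn1.
    by have E := adds_inj_l R (adds_subb r0); exists r; rewrite // inE -E r0.
  by rewrite inE => /andP[r0 Q] ->; split=> //; apply/existsP; exists r; apply: adds_subb.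
rewrite !card_in_imset; first last.
- by move=> r r' _ _ E; apply: (adds_row (adds_addb r kN)); rewrite E adds_addb.
- move=> r r'; rewrite !inE => /andP[r0 _] /andP[r0' _] E.
  by apply: (adds_row (adds_subb r0)); rewrite E adds_subb.
have AE (r : 'I_N.+1) : (r \in A) = (r == ord0) || (la r < la (inord r.-1))%N.
  rewrite inE; apply/partitionP/idP => [Q|].
    case: (eqVneq r ord0) => //= r0; have r1 : (0 < r)%N by rewrite lt0n.
    have i1 : (@inord N r.-1 : nat) = r.-1 by rewrite inordK // (leq_ltn_trans (leq_pred _)).
    have := Q (inord r.-1) r; rewrite i1 leq_pred => /(_ isT).
    rewrite !(addsP _ _ _ (adds_addb r kN)) eqxx.
    have -> : (inord r.-1 == r :> 'I_N.+1) = false.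
      by apply/eqP=> /(congr1 val); rewrite /= i1; lia.
    by lia.
  move=> H i j ij; rewrite !(addsP _ _ _ (adds_addb r kN)).
  have := PP i j ij; case: (eqVneq j r) => [E|_]; last by lia.
  subst j; case: (eqVneq i r) => [-> //|ir].
  case/orP: H => [/eqP r0|lt].
    by move: ij; rewrite r0 leqn0 => /eqP i0; case/eqP: ir; rewrite r0; apply: val_inj.
  have ir' : (i < r)%N by rewrite ltn_neqAle ij andbT; exact: ir.
  have i1 : (@inord N r.-1 : nat) = r.-1 by rewrite inordK // (leq_ltn_trans (leq_pred _)).
  have := PP i (inord r.-1); rewrite i1 => /(_ ltac:(lia)); lia.
have DE (r : 'I_N.+1) : (r \in D) = (r != ord_max) && (la (inord r.+1) < la r)%N.
  rewrite inE; case: (eqVneq r ord_max) => [->|rm] /=; first by rewrite last0.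
  have rN : (r < N)%N by rewrite ltn_neqAle -ltnS ltn_ord andbT; exact: rm.
  have i1 : (@inord N r.+1 : nat) = r.+1 by rewrite inordK.
  apply/andP/idP => [[r0 /partitionP Q]|lt].
    have := Q r (inord r.+1); rewrite i1 leqnSn => /(_ isT).
    have := addsP _ _ _ (adds_subb r0) r; have := addsP _ _ _ (adds_subb r0) (inord r.+1).
    have -> : (inord r.+1 == r :> 'I_N.+1) = false.
      by apply/eqP=> /(congr1 val); rewrite /= i1; lia.
    by rewrite eqxx; lia.
  have r0 : (0 < la r)%N by lia.
  split=> //; apply/partitionP=> i j ij.
  have := addsP _ _ _ (adds_subb r0) i; have := addsP _ _ _ (adds_subb r0) j.
  have := PP i j ij; case: (eqVneq i r) => [E|_]; last by lia.
  subst i; case: (eqVneq j r) => [-> |jr]; first by lia.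
  have ir' : (r < j)%N by rewrite ltn_neqAle ij andbT eq_sym; exact: jr.
  have := PP (inord r.+1) j; rewrite i1 => /(_ ir'); lia.
(* Splitting off the first row on one side and the last on the other realises the shift by one. *)
rewrite -!sum1_card (eq_bigl _ _ AE) (eq_bigl _ _ DE) !(big_mkcond (fun _ => _ || _)) !(big_mkcond (fun _ => _ && _)).
rewrite big_ord_recl big_ord_recr /= eqxx addn0 add1n; congr _.+1.
apply: eq_bigr => i _; have iN := ltn_ord i.
have -> : (widen_ord (leqnSn N) i == ord_max :> 'I_N.+1) = false.
  by apply/eqP=> /(congr1 val) /=; lia.
have -> : inord (bump 0 i).-1 = widen_ord (leqnSn N) i :> 'I_N.+1.
  by apply: val_inj; rewrite /= inordK // ltnW // ltnS.
have -> : inord i.+1 = lift ord0 i :> 'I_N.+1 by apply: val_inj; rewrite /= inordK // ltnS.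
by [].
Qed.

(** In both double sums the coefficient of [f mu] counts the shapes linking [la] to [mu]; the counts
    agree off the diagonal and differ by one at [mu = la]. *)
Lemma young_lattice_identity la (f : Ptn N -> nat) : is_partition la -> (psize la < N)%N ->
  (\sum_(be in ups la) \sum_(mu in dns be) f mu =
   f la + \sum_(al in dns la) \sum_(mu in ups al) f mu)%N.
Proof.
move=> P kN.
transitivity (\sum_(mu | is_partition mu) #|ups la :&: ups mu| * f mu)%N.
  rewrite (exchange_big_dep (fun mu => is_partition mu)) /=; last first.
    by move=> be mu _; rewrite inE => /andP[].
  apply: eq_bigr => mu Q; rewrite sum_nat_const; congr (_ * _)%N.
  by apply: eq_card => be; rewrite [LHS]unfold_in /= !inE Q; case: (is_partition be); rewrite ?andbF.
transitivity (\sum_(mu | is_partition mu) ((mu == la) * f mu + #|dns la :&: dns mu| * f mu))%N.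
  apply: eq_bigr => mu Q; case: (eqVneq mu la) => [->|ne].
    by rewrite !setIid card_ups_dns // mulSn mul1n.
  by rewrite mul0n add0n card_ups_dns_neq // eq_sym.
rewrite big_split /=; congr (_ + _)%N.
  by rewrite (bigD1 la) //= eqxx mul1n big1 ?addn0 // => mu /andP[_ /negPf ->].
rewrite [RHS](exchange_big_dep (fun mu => is_partition mu)) /=; last first.
  by move=> al mu _; rewrite inE => /andP[].
apply: eq_bigr => mu Q; rewrite sum_nat_const; congr (_ * _)%N.
by apply: eq_card => be; rewrite [RHS]unfold_in /= !inE Q; case: (is_partition be); rewrite ?andbF.
Qed.

(** A box can always be removed from the last nonempty row. *)
Lemma dns_nonempty la : is_partition la -> (0 < psize la)%N -> exists al, al \in dns la.
Proof.
move=> P k0.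
have [r0 r0P] : exists r : 'I_N.+1, (0 < la r)%N.
  apply/existsP; apply: contraLR k0; rewrite negb_exists => /forallP H.
  by rewrite -leqNgt leqn0 /psize sum_nat_eq0; apply/forallP=> i /=; have := H i; rewrite -eqn0Ngt.
case: (arg_maxnP (P := fun r : 'I_N.+1 => (0 < la r)%N) (fun r : 'I_N.+1 => r : nat) r0P) => r rP rmax.
exists (subb la r); rewrite inE; apply/andP; split; last by apply/existsP; exists r; apply: adds_subb.
apply/partitionP=> i j ij; have := addsP _ _ _ (adds_subb rP) i; have := addsP _ _ _ (adds_subb rP) j.
have := partitionP _ P i j ij; case: (eqVneq i r) => [E|_]; last by lia.
subst i; case: (eqVneq j r) => [-> |jr]; first by lia.
have ir' : (r < j)%N by rewrite ltn_neqAle ij andbT eq_sym; exact: jr.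
case: (posnP (la j)) => [->|/rmax]; first by lia.
by rewrite /= leqNgt ir'.
Qed.

End YoungLattice.

(** * The branching rules *)

Section DirectSums.
Variable K : fieldType.

(** Joint injectivity makes the images independent and keeps their dimensions. The second half is
    held in reserve: once a count shows that the inequality is an equality, injectivity becomes
    surjectivity. *)
Lemma joint_dim (V W : vectType K) (I : finType) (P : pred I) (Vs : I -> {vspace V})
    (L : I -> 'Hom(V, W)) (U : {vspace W}) :
  (forall i v, P i -> v \in Vs i -> L i v \in U) ->
  (forall w, (forall i, P i -> w i \in Vs i) -> \sum_(i | P i) L i (w i) = 0 ->
     forall i, P i -> w i = 0) ->
  (\sum_(i | P i) \dim (Vs i) <= \dim U)%N /\
  ((\dim U <= \sum_(i | P i) \dim (Vs i))%N -> forall u, u \in U ->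
     exists2 w, forall i, P i -> w i \in Vs i & u = \sum_(i | P i) L i (w i)).
Proof.
move=> LU inj; set S := (\sum_(i | P i) (L i @: Vs i))%VS.
have SU : (S <= U)%VS.
  apply/subv_sumP => i Pi; apply/subvP => _ /memv_imgP[v vV ->]; exact: LU.
have pre us : (forall i, P i -> us i \in (L i @: Vs i)%VS) ->
    exists2 w, forall i, P i -> w i \in Vs i & forall i, P i -> us i = L i (w i).
  move=> H; have w i : exists v, P i ==> (v \in Vs i) && (us i == L i v).
    case: (boolP (P i)) => Pi; last by exists 0.
    by have /memv_imgP[v vV ->] := H i Pi; exists v; rewrite vV eqxx.
  exists (fun i => xchoose (w i)) => i Pi; have /implyP/(_ Pi)/andP[] := xchooseP (w i) => //.
  by move=> _ /eqP.
have dirS : directv S.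
  apply/directv_sum_independent => us H s0 i Pi.
  have [w wV wE] := pre us H; rewrite wE // (inj w wV) ?raddf0 //.
  by rewrite -[RHS]s0; apply: eq_bigr => j Pj; rewrite wE.
have dimS : \dim S = (\sum_(i | P i) \dim (Vs i))%N.
  have /directvP := dirS; rewrite /= => ->; apply: eq_bigr => i Pi.
  apply: limg_dim_eq; apply/eqP; rewrite -subv0; apply/subvP => v.
  rewrite memv_cap memv_ker memv0 => /andP[vV /eqP v0].
  (* A family supported at one index: joint injectivity contains the injectivity of each single
     map. *)
  pose w j := if j == i then v else 0.
  suff /(_ i Pi) : forall j, P j -> w j = 0 by rewrite /w eqxx => ->.
  apply: inj => [j Pj|]; first by rewrite /w; case: eqP => [->|_]; rewrite ?mem0v.
  rewrite (bigD1 i) //= /w eqxx v0 big1 ?addr0 // => j /andP[_ /negPf ->].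
  by rewrite raddf0.
rewrite -dimS; split=> [|le u uU]; first exact: dimvS.
have /eqP SE : S == U by rewrite eqEdim SU.
move: uU; rewrite -SE => /memv_sumP[us H ->].
by have [w wV wE] := pre us H; exists w => //; apply: eq_bigr.
Qed.

Variables (V : vectType K) (J : finType).

(** With partitions as index type this is the map underlying [inj_ds], so [memv_ds] also describes
    [dsU] and [dsR]; with entries as index type it gives the induced module [indspace]. *)
Definition dsin (i : J) (v : V) : {ffun J -> V} := [ffun j => if j == i then v else 0].

Lemma dsin_is_linear i : linear (dsin i).
Proof.
move=> a v w; apply/ffunP=> j; rewrite !ffunE; case: ifP => // _.
by rewrite scaler0 addr0.
Qed.
HB.instance Definition _ i :=
  GRing.isLinear.Build K V {ffun J -> V} _ (dsin i) (dsin_is_linear i).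

Lemma memv_ds (P : pred J) (Vs : J -> {vspace V}) (f : {ffun J -> V}) :
  reflect ((forall j, P j -> f j \in Vs j) /\ (forall j, ~~ P j -> f j = 0))
    (f \in (\sum_(i | P i) (linfun (dsin i) @: Vs i))%VS).
Proof.
apply: (iffP memv_sumP) => [[us H ->]|[H H0]].
  have E j : (\sum_(i | P i) us i) j = if P j then us j j else 0.
    rewrite sum_ffunE; case: (boolP (P j)) => Pj.
      rewrite (bigD1 j) //= big1 ?addr0 // => i /andP[Pi ij].
      have /memv_imgP[v _ ->] := H i Pi; rewrite lfunE ffunE eq_sym (negPf ij) //.
    rewrite big1 // => i Pi; have /memv_imgP[v _ ->] := H i Pi; rewrite lfunE ffunE.
    by case: eqP => // ji; rewrite ji Pi in Pj.
  split=> j Pj; rewrite E ?(negPf Pj) // Pj.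
  by have /memv_imgP[v vV ->] := H j Pj; rewrite lfunE ffunE eqxx.
exists (fun i => dsin i (f i)) => [i Pi|].
  by rewrite -lfunE; apply/memv_img/H.
apply/ffunP=> j; rewrite sum_ffunE; case: (boolP (P j)) => Pj.
  rewrite (bigD1 j) //= big1 ?addr0 ?ffunE ?eqxx // => i /andP[_ /negPf ij].
  by rewrite ffunE eq_sym ij.
rewrite H0 // big1 // => i Pi; rewrite ffunE; case: eqP => // ji.
by rewrite ji Pi in Pj.
Qed.

Lemma dim_ds (P : pred J) (Vs : J -> {vspace V}) :
  (\dim (\sum_(i | P i) (linfun (dsin i) @: Vs i))%VS <= \sum_(i | P i) \dim (Vs i))%N.
Proof.
apply: (leq_trans (dimv_leq_sum _ _ _)); apply: leq_sum => i _.
by rewrite -(limg_ker_dim (linfun (dsin i)) (Vs i)) leq_addl.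
Qed.

End DirectSums.

(** * Restricting and inducing Specht modules *)

Section BranchingRule.
Variables (F : fieldType) (N : nat).
Hypothesis char0 : [pchar F] =i pred0.
Implicit Types (al be la mu : Ptn N) (o : 'I_N).

Definition rowof al be : 'I_N.+1 := odflt ord0 [pick r | adds r al be].
Lemma rowofP al be : cov al be -> adds (rowof al be) al be.
Proof. by rewrite /rowof; case: pickP => //= H /existsP[r]; rewrite H. Qed.

Definition uphom o al be : {linear MF F N -> MF F N} := up o (rowof al be) al be.
Definition downhom o al be : {linear MF F N -> MF F N} := down o (rowof al be) al be.

Lemma psize_cov al be : cov al be -> psize be = (psize al).+1.
Proof. by case/existsP=> r; apply: psize_adds. Qed.

Lemma dnsP la al : al \in dns la -> [/\ is_partition al, cov al la & psize la = (psize al).+1].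
Proof. by rewrite inE => /andP[P C]; rewrite (psize_cov C). Qed.
Lemma upsP la be : be \in ups la -> [/\ is_partition be, cov la be & psize be = (psize la).+1].
Proof. by rewrite inE => /andP[P C]; rewrite (psize_cov C). Qed.

Lemma uphom_inj o la (w : Ptn N -> MF F N) : is_partition la -> psize la = o.+1 ->
  (forall al, al \in dns la -> w al \in specht F al) ->
  \sum_(al in dns la) uphom o al la (w al) = 0 -> forall al, al \in dns la -> w al = 0.
Proof.
move=> P lak wS s0.
have alk al : al \in dns la -> psize al = o.
  by move=> /dnsP[_ _]; rewrite lak => -[].
apply: (joint_inj char0 (k := o) (L := fun al => uphom o al la)) => //.
- by rewrite ltnW.
- by move=> mu muD; have [? _ _] := dnsP muD; rewrite (alk mu).
- move=> mu t muD T; have [muP C _] := dnsP muD; exists 1%g; first exact: in_Sk1.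
  by rewrite gact1 up_neq0 ?rowofP ?alk.
move=> g gS; transitivity (gact g (\sum_(mu in dns la) uphom o mu la (w mu))).
  rewrite raddf_sum; apply: eq_bigr => mu muD /=.
  have [muP C _] := dnsP muD.
  by rewrite up_gact ?rowofP ?alk.
by rewrite s0 raddf0.
Qed.

Lemma tperm_Sk (o j : 'I_N) : (j <= o)%N -> in_Sk o.+1 (tperm j o).
Proof.
move=> jo; apply/in_SkP=> i oi; rewrite tpermD //; apply: contraTneq oi => <-; lia.
Qed.

(** The transpositions of [j] and [o] with [j <= o] represent the cosets of S_o in S_{o+1}. As
    [downhom] is only S_o-equivariant, vanishing is assumed at these representatives, and factoring
    a general permutation through them gives what [joint_inj] asks. *)
Lemma downhom_inj o la (w : Ptn N -> MF F N) : is_partition la -> psize la = o ->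
  (forall be, be \in ups la -> w be \in specht F be) ->
  (forall j : 'I_N, (j <= o)%N -> \sum_(be in ups la) downhom o la be (gact (tperm j o) (w be)) = 0) ->
  forall be, be \in ups la -> w be = 0.
Proof.
move=> P lak wS s0.
apply: (joint_inj char0 (k := o.+1) (L := fun be => downhom o la be)) => //.
- by move=> mu /upsP[? _ ->]; rewrite lak.
- move=> mu t muD T; have [muP C sz] := upsP muD; rewrite -lak -sz.
  by apply: down_neq0; rewrite ?rowofP.
move=> g gS; pose j := (g^-1)%g o; pose h := (tperm j o * g)%g.
have jo : (j <= o)%N.
  by have := @in_Sk_lt N o.+1 (g^-1)%g o; rewrite in_SkV ltnS ltnSn => /(_ gS).
have hS : in_Sk (psize la) h.
  apply/in_SkP=> i; rewrite lak leq_eqVlt permM => /orP[/eqP/val_inj <-|oi].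
    by rewrite tpermR permKV.
  by rewrite (in_SkP _ _ (tperm_Sk jo)) // (in_SkP _ _ gS).
have -> : g = (tperm j o * h)%g by rewrite mulgA tperm2 mul1g.
transitivity (gact h (\sum_(be in ups la) downhom o la be (gact (tperm j o) (w be)))).
  rewrite raddf_sum; apply: eq_bigr => mu muD /=; have [muP C sz] := upsP muD.
  by rewrite -gactM down_gact ?rowofP.
by rewrite s0 // raddf0.
Qed.

Definition sdim la := \dim (specht F la).

Lemma uphom_joint o la : is_partition la -> psize la = o.+1 ->
  (\sum_(al in dns la) sdim al <= sdim la)%N /\
  ((sdim la <= \sum_(al in dns la) sdim al)%N -> forall u, u \in specht F la ->
     exists2 w, forall al, al \in dns la -> w al \in specht F al &
       u = \sum_(al in dns la) uphom o al la (w al)).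
Proof.
move=> P lak.
have [|w wS s0|le sur] := @joint_dim F _ _ _ (mem (dns la)) (fun al => specht F al)
    (fun al => linfun (uphom o al la)) (specht F la).
- by move=> al v aD vS; rewrite lfunE frame_specht.
- apply: (uphom_inj P lak) => //; rewrite -[RHS]s0; apply: eq_bigr => al _.
  by rewrite lfunE.
split=> // ge u uS; have [w wS ->] := sur ge u uS; exists w => //.
by apply: eq_bigr => al _; rewrite lfunE.
Qed.

Definition downs o la be (v : MF F N) : {ffun 'I_N -> MF F N} :=
  [ffun j : 'I_N => if (j <= o)%N then downhom o la be (gact (tperm j o) v) else 0].
Lemma downs_is_linear o la be : linear (downs o la be).
Proof.
move=> a v w; apply/ffunP=> j; rewrite !ffunE; case: ifP => // _; rewrite ?linearP //.
by rewrite scaler0 addr0.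
Qed.
HB.instance Definition _ o la be :=
  GRing.isLinear.Build F (MF F N) {ffun 'I_N -> MF F N} _ (downs o la be) (downs_is_linear o la be).

Lemma card_le_ord o : #|[set j : 'I_N | (j <= o)%N]| = o.+1.
Proof.
rewrite -sum1dep_card (eq_bigl (fun j : 'I_N => (j < o.+1)%N)) //.
by rewrite -(big_ord_widen _ (fun=> 1%N)) ?sum1_card ?card_ord.
Qed.

(** Coset model of the module induced from S_o to S_{o+1}: one copy of the Specht module for each
    transposition of [j] and [o]. *)
Definition indspace o la : {vspace {ffun 'I_N -> MF F N}} :=
  (\sum_(j : 'I_N | (j <= o)%N) (linfun (dsin j) @: specht F la))%VS.

Lemma dim_indspace o la : (\dim (indspace o la) <= o.+1 * sdim la)%N.
Proof.
apply: (leq_trans (dim_ds _ _)).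
by rewrite sum_nat_const -[X in (_ <= X * _)%N](card_le_ord o) cardsE.
Qed.

Lemma downhom_joint o la : is_partition la -> psize la = o ->
  (\sum_(be in ups la) sdim be <= o.+1 * sdim la)%N /\
  ((o.+1 * sdim la <= \sum_(be in ups la) sdim be)%N ->
   forall u, (forall j : 'I_N, (j <= o)%N -> u j \in specht F la) ->
   exists2 w, forall be, be \in ups la -> w be \in specht F be &
     forall j : 'I_N, (j <= o)%N ->
       u j = \sum_(be in ups la) downhom o la be (gact (tperm j o) (w be))).
Proof.
move=> P lak.
have E w (j : 'I_N) : (j <= o)%N -> (\sum_(be in ups la) linfun (downs o la be) (w be)) j =
    \sum_(be in ups la) downhom o la be (gact (tperm j o) (w be)).
  move=> jo; rewrite sum_ffunE; apply: eq_bigr => be _.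
  by rewrite lfunE ffunE jo.
have [|w wS s0|le sur] := @joint_dim F _ _ _ (mem (ups la)) (fun be => specht F be)
    (fun be => linfun (downs o la be)) (indspace o la).
- move=> be v bD vS; apply/memv_ds; rewrite lfunE /=; split=> j jo; rewrite ffunE.
    by rewrite jo frame_specht.
  by rewrite (negPf jo).
- by apply: (downhom_inj P lak) => // j jo; rewrite -E // s0 ffunE.
split=> [|ge u uS]; first exact: (leq_trans le (dim_indspace _ _)).
pose u' := [ffun j : 'I_N => if (j <= o)%N then u j else 0].
have u'S : u' \in indspace o la.
  by apply/memv_ds; split=> j jo; rewrite ffunE ?(negPf jo) // jo uS.
have [w wS wE] := sur (leq_trans (dim_indspace _ _) ge) u' u'S; exists w => // j jo.
by rewrite -E // -wE ffunE jo.
Qed.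

Lemma sdim_rules k : (k < N)%N ->
  (forall la, is_partition la -> psize la = k.+1 ->
     sdim la = (\sum_(al in dns la) sdim al)%N) /\
  (forall la, is_partition la -> psize la = k ->
     (k.+1 * sdim la = \sum_(be in ups la) sdim be)%N).
Proof.
(* Comparing [sum_be sum_(mu < be)] with [sum_al sum_(be > al)] by the lattice identity forces
   equality in all the dimension inequalities of [uphom_joint] and [downhom_joint]. *)
have step k' (kN : (k' < N)%N) : (forall la, is_partition la -> psize la = k' -> (0 < k')%N ->
     sdim la = (\sum_(al in dns la) sdim al)%N) ->
   ((0 < k')%N -> forall la, is_partition la -> psize la = k'.-1 ->
     (k' * sdim la = \sum_(be in ups la) sdim be)%N) ->
   forall la, is_partition la -> psize la = k' ->
     (k'.+1 * sdim la = \sum_(be in ups la) sdim be)%N /\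
     (forall be, be \in ups la -> sdim be = (\sum_(mu in dns be) sdim mu)%N).
  move=> A I la P lak; pose o := Ordinal kN.
  have [B _] := downhom_joint (o := o) P lak.
  have le1 be : be \in ups la -> (\sum_(mu in dns be) sdim mu <= sdim be)%N.
    move=> bU; have [Q _ sz] := upsP bU.
    by apply: (uphom_joint (o := o) Q _).1; rewrite sz lak.
  (* The lattice identity gives [sdim la] plus a sum over the shapes [al] below; the induction rule
     at [al] makes each term [k' * sdim al], and the restriction rule at [la] adds them up to
     [k' * sdim la]. *)
  have ge : (k'.+1 * sdim la = \sum_(be in ups la) \sum_(mu in dns be) sdim mu)%N.
    rewrite young_lattice_identity ?lak //.
    rewrite (eq_bigr (fun al => k' * sdim al)%N) => [|al /dnsP[Q _]]; last first.
      by rewrite lak => sz; rewrite I ?sz.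
    rewrite -big_distrr /= mulSn; congr (_ + _)%N.
    by case: (posnP k') => [->//|k0]; rewrite -A.
  have eqs : (\sum_(be in ups la) (sdim be - \sum_(mu in dns be) sdim mu) = 0)%N.
    rewrite sumnB //; apply/eqP; rewrite subn_eq0 -ge; exact: B.
  have eqb be : be \in ups la -> sdim be = (\sum_(mu in dns be) sdim mu)%N.
    move=> bU; apply/eqP; rewrite eqn_leq le1 // andbT -subn_eq0.
    by move/eqP: eqs; rewrite sum_nat_eq0 => /forall_inP/(_ be bU).
  by split=> //; rewrite ge; apply: eq_bigr => be bU; rewrite eqb.
suff H : forall k, (k < N)%N ->
  (forall la, is_partition la -> psize la = k -> (0 < k)%N ->
     sdim la = (\sum_(al in dns la) sdim al)%N) /\
  (forall la, is_partition la -> psize la = k ->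
     (k.+1 * sdim la = \sum_(be in ups la) sdim be)%N /\
     (forall be, be \in ups la -> sdim be = (\sum_(mu in dns be) sdim mu)%N)).
  move=> kN; split=> la P lak.
  (* The restriction rule at [la] comes out of the count made at a shape below it, so one such shape
     has to be exhibited. *)
  have [al aD] := @dns_nonempty N la P ltac:(by rewrite lak).
  have [Q C sz] := dnsP aD; have alk : psize al = k by move: sz; rewrite lak => -[].
  by have [_ ->] := (H k kN).2 al Q alk; rewrite ?inE ?P.
by case: ((H k kN).2 la P lak).
elim=> {k} [|k IH] kN; first by split=> // la P lak; apply: (step 0%N).
have [A B] := IH (ltnW kN).
have A' : forall la, is_partition la -> psize la = k.+1 -> (0 < k.+1)%N ->
     sdim la = (\sum_(al in dns la) sdim al)%N.
  move=> la P lak _; have [al aD] := @dns_nonempty N la P ltac:(by rewrite lak).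
  have [Q C sz] := dnsP aD; have alk : psize al = k by move: sz; rewrite lak => -[].
  by apply: (B al Q alk).2; rewrite inE P.
split=> // la P lak; apply: (step k.+1 kN A') => // _ mu Q muk.
by case: (B mu Q muk).
Qed.

Lemma uphom_surj o la u : is_partition la -> psize la = o.+1 -> u \in specht F la ->
  exists2 w, forall al, al \in dns la -> w al \in specht F al &
    u = \sum_(al in dns la) uphom o al la (w al).
Proof.
move=> P lak; apply: (uphom_joint P lak).2.
by rewrite ((sdim_rules (ltn_ord o)).1 la P lak).
Qed.

(** The map from the induced module to the Specht module of [be], applied to the sum of (j o) tensor
    [y j]. *)
Definition indsum o la be (y : 'I_N -> MF F N) : MF F N :=
  \sum_(j : 'I_N | (j <= o)%N) gact (tperm j o) (uphom o la be (y j)).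

(* The map to the sum of the Specht modules [be] is adjoint to the one of [downhom_joint]. *)
Lemma indsum_inj o la y : is_partition la -> psize la = o ->
  (forall j : 'I_N, (j <= o)%N -> y j \in specht F la) ->
  (forall be, be \in ups la -> indsum o la be y = 0) ->
  forall j : 'I_N, (j <= o)%N -> y j = 0.
Proof.
move=> P lak yS s0 j0 j0o.
have laN : (psize la <= N)%N by rewrite lak ltnW.
apply: (specht_nondeg char0 P laN (yS _ j0o)) => t T.
set e := polytab F la t.
have eS (j : 'I_N) : (j <= o)%N -> (if j == j0 then e else 0) \in specht F la.
  by case: eqP; rewrite ?polytab_specht ?mem0v.
(* Equality of dimensions makes the [downhom] map surjective, so the family with [e] at [j0] and 0
   elsewhere has a preimage [w]; pairing [y] with it moves the map over to [indsum]. *)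
have [w wS wE] := (downhom_joint P lak).2 (eq_leq ((sdim_rules (ltn_ord o)).2 la P lak)) _ eS.
have -> : dot (y j0) e = \sum_(j : 'I_N | (j <= o)%N) dot (y j) (if j == j0 then e else 0).
  rewrite (bigD1 j0) //= eqxx big1 ?addr0 // => j /andP[_ /negPf ->].
  by rewrite dot0r.
rewrite (eq_bigr (fun j => \sum_(be in ups la) dot (gact (tperm j o) (uphom o la be (y j))) (w be))).
  rewrite exchange_big big1 //= => be bU; rewrite -dot_suml.
  by rewrite [X in dot X _](s0 be bU) dot0l.
move=> j jo; rewrite wE // dot_sumr; apply: eq_bigr => be bU.
by rewrite dot_gactl tpermV dot_up.
Qed.

Definition indmap o la (j : 'I_N) (v : MF F N) : {ffun Ptn N -> MF F N} :=
  [ffun be => if be \in ups la then gact (tperm j o) (uphom o la be v) else 0].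
Lemma indmap_is_linear o la j : linear (indmap o la j).
Proof.
move=> a v w; apply/ffunP=> be; rewrite !ffunE; case: ifP => // _; rewrite ?linearP //.
by rewrite scaler0 addr0.
Qed.
HB.instance Definition _ o la j :=
  GRing.isLinear.Build F (MF F N) {ffun Ptn N -> MF F N} _ (indmap o la j)
    (indmap_is_linear o la j).

(** The [o.+1] copies of the Specht module embed by [indsum_inj], and the dimension of the target is
    at most that of the source by the induction rule. *)
Lemma indsum_surj o la (v : Ptn N -> MF F N) : is_partition la -> psize la = o ->
  (forall be, be \in ups la -> v be \in specht F be) ->
  exists2 y, forall j : 'I_N, (j <= o)%N -> y j \in specht F la &
    forall be, be \in ups la -> v be = indsum o la be y.
Proof.
move=> P lak vS.
pose U := (\sum_(be | be \in ups la) (linfun (dsin (K := F) be) @: specht F be))%VS.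
have UE be y : be \in ups la ->
    (\sum_(j : 'I_N | (j <= o)%N) linfun (indmap o la j) (y j)) be = indsum o la be y.
  move=> bU; rewrite sum_ffunE; apply: eq_bigr => j _.
  by rewrite lfunE /= ffunE bU.
have [|y yS s0|_ sur] := @joint_dim F _ _ _ (fun j : 'I_N => (j <= o)%N) (fun=> specht F la)
    (fun j => linfun (indmap o la j)) U.
- move=> j u jo uS; apply/memv_ds; rewrite lfunE /=; split=> be bU; rewrite ffunE.
    rewrite bU gact_specht ?frame_specht //; have [_ _ ->] := upsP bU.
    by rewrite lak tperm_Sk.
  by rewrite (negPf bU).
- apply: (indsum_inj P lak) => // be bU.
  by rewrite -UE // s0 ffunE.
have le : (\dim U <= \sum_(j : 'I_N | (j <= o)%N) sdim la)%N.
  rewrite sum_nat_const -[X in (_ <= X * _)%N]cardsE card_le_ord.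
  by rewrite ((sdim_rules (ltn_ord o)).2 la P lak) dim_ds.
pose f := [ffun be => if be \in ups la then v be else 0] : {ffun Ptn N -> MF F N}.
have [|y yS E] := sur le f.
  by apply/memv_ds; split=> be bU; rewrite ffunE ?bU ?vS // (negPf bU).
exists y => // be bU; rewrite -UE //.
by move/ffunP/(_ be): E; rewrite ffunE bU.
Qed.

End BranchingRule.

Local Close Scope ring_scope.

(** * Products of diagrams *)

Local Notation r0 := (@inord 2 0).
Local Notation r1 := (@inord 2 1).
Local Notation r2 := (@inord 2 2).

Lemma inord3_eq (i j : nat) : i < 3 -> j < 3 -> (@inord 2 i == @inord 2 j) = (i == j).
Proof. by move=> i3 j3; rewrite -val_eqE /= !inordK. Qed.

Lemma row_cases (r : 'I_3) : [\/ r = r0, r = r1 | r = r2].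
Proof.
by case: r => [[|[|[|//]]] lt]; [apply: Or31|apply: Or32|apply: Or33]; apply: val_inj; rewrite /= inordK.
Qed.

Section Stack.
Variable m : nat.
Implicit Types (a c d : rawd m) (v w : vtx m).

Lemma lower_inj : injective (@lower_emb m).
Proof.
move=> [[] i] [[] j] [] //=; try by move=> ->.
  by move/eqP; rewrite inord3_eq.
by move/eqP; rewrite inord3_eq.
Qed.
Lemma outer_inj : injective (@outer_emb m).
Proof.
move=> [[] i] [[] j] [] //=; try by move=> ->.
  by move/eqP; rewrite inord3_eq.
by move/eqP; rewrite inord3_eq.
Qed.

Lemma diagramP d : reflect (forall v, d (d v) = v) (is_diagram d).
Proof. by apply: (iffP forallP) => H v; apply/eqP/H. Qed.

Lemma diagram_inj d : is_diagram d -> injective d.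
Proof. by move=> /diagramP H; apply: can_inj H. Qed.

Lemma edge_sym a c : is_diagram a -> is_diagram c -> symmetric (stack_edge a c).
Proof.
move=> /diagramP A /diagramP C w w'; congr (_ || _); apply/existsP/existsP => -[v /and3P[ne /eqP <- /eqP <-]].
- by exists (a v); rewrite A eq_sym ne !eqxx.
- by exists (a v); rewrite A eq_sym ne !eqxx.
- by exists (c v); rewrite C eq_sym ne !eqxx.
- by exists (c v); rewrite C eq_sym ne !eqxx.
Qed.

Lemma conn_sym a c : is_diagram a -> is_diagram c -> connect_sym (stack_edge a c).
Proof. by move=> A C; apply: sym_connect_sym; apply: edge_sym. Qed.

Lemma conn_upper a c v : stack_conn a c (upper_emb v) (upper_emb (a v)).
Proof.
case: (eqVneq v (a v)) => [<-|ne]; first exact: connect0.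
by apply/connect1/orP; left; apply/existsP; exists v; rewrite ne !eqxx.
Qed.
Lemma conn_lower a c v : stack_conn a c (lower_emb v) (lower_emb (c v)).
Proof.
case: (eqVneq v (c v)) => [<-|ne]; first exact: connect0.
by apply/connect1/orP; right; apply/existsP; exists v; rewrite ne !eqxx.
Qed.

(** Induction along paths of the stack. With implication for [Q] it propagates a predicate; with a
    connectivity relation it carries paths through a map [f] to a simpler set. *)
Lemma conn_rel a c (T : Type) (f : 'I_3 * 'I_m -> T) (Q : T -> T -> Prop) :
  (forall x, Q x x) -> (forall y x z, Q x y -> Q y z -> Q x z) ->
  (forall v, Q (f (upper_emb v)) (f (upper_emb (a v)))) ->
  (forall v, Q (f (lower_emb v)) (f (lower_emb (c v)))) ->
  forall x y, stack_conn a c x y -> Q (f x) (f y).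
Proof.
move=> Q0 Qt Qu Ql x y /connectP[p + ->]; elim: p x => [|z p IH] x //=.
case/andP=> xz /IH; apply: Qt.
by case/orP: xz => /existsP[v /and3P[_ /eqP <- /eqP <-]].
Qed.

(** * The two ends of a path in the stack *)

Section OtherEnd.
Variables (a c : rawd m).
Hypotheses (aD : is_diagram a) (cD : is_diagram c).

Let A (w : 'I_3 * 'I_m) := if w.1 == r2 then w else upper_emb (a (w.1 == r1, w.2)).
Let C (w : 'I_3 * 'I_m) := if w.1 == r0 then w else lower_emb (c (w.1 == r2, w.2)).
(* Every component of the stack is traversed by alternating the two involutions [A] and [C];
   the flag records which one comes next. *)
Let nxt (x : 'I_3 * 'I_m * bool) := if x.2 then (A x.1, false) else (C x.1, true).
Let rho (x : 'I_3 * 'I_m * bool) := (x.1, ~~ x.2).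
Let start v : 'I_3 * 'I_m * bool := (outer_emb v, ~~ v.1).

Let AE v : A (upper_emb v) = upper_emb (a v).
Proof. by case: v => [[] i]; rewrite /A /= !inord3_eq. Qed.
Let CE v : C (lower_emb v) = lower_emb (c v).
Proof. by case: v => [[] i]; rewrite /C /= !inord3_eq. Qed.
Let AK : involutive A.
Proof.
move=> [r i]; case: (row_cases r) => ->; last by rewrite /A /= !eqxx.
  by rewrite -[(r0, i)]/(upper_emb (false, i)) !AE (diagramP _ aD).
by rewrite -[(r1, i)]/(upper_emb (true, i)) !AE (diagramP _ aD).
Qed.
Let CK : involutive C.
Proof.
move=> [r i]; case: (row_cases r) => ->; first by rewrite /C /= !eqxx.
  by rewrite -[(r1, i)]/(lower_emb (false, i)) !CE (diagramP _ cD).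
by rewrite -[(r2, i)]/(lower_emb (true, i)) !CE (diagramP _ cD).
Qed.
Let nrn x : nxt (rho (nxt x)) = rho x.
Proof. by case: x => [w []]; rewrite /nxt /rho /= ?AK ?CK. Qed.
Let rhoK : involutive rho.
Proof. by case=> w b; rewrite /rho /= negbK. Qed.
Let nxt_inj : injective nxt.
Proof. by apply: (can_inj (g := rho \o nxt \o rho)) => x; rewrite /= nrn rhoK. Qed.
(** [rho] reverses the direction of the walk. At an outer vertex the involution of the other diagram
    is the identity, so a walk arriving there turns back. *)
Let startP v : nxt (rho (start v)) = start v.
Proof. by case: v => [[] i]; rewrite /nxt /start /rho /= /A /C /= eqxx. Qed.

Let orbit_rho v y : fconnect nxt (start v) y -> fconnect nxt (start v) (rho y).
Proof.
move=> /iter_findex <-; elim: (findex _ _ _) => [|i IH] /=.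
  by rewrite (fconnect_sym nxt_inj) (connect_trans (fconnect1 _ _)) // startP.
apply: (connect_trans IH); rewrite (fconnect_sym nxt_inj).
by apply: (connect_trans (fconnect1 _ _)); rewrite nrn.
Qed.

Let orbit_conn v (w : 'I_3 * 'I_m) :
  stack_conn a c (outer_emb v) w -> fconnect nxt (start v) (w, true).
Proof.
move=> H; pose f (w : 'I_3 * 'I_m) := fconnect nxt (start v) (w, true).
apply: (conn_rel (f := f) (Q := fun b b' => b -> b') _ _ _ _ H) => //.
- by move=> y x z xy yz /xy /yz.
- move=> u xu; have := orbit_rho (connect_trans xu (fconnect1 _ _)).
  by rewrite /nxt /rho /= AE.
- move=> u xu; have := connect_trans (orbit_rho xu) (fconnect1 _ _).
  by rewrite /nxt /rho /= CE.
have st : fconnect nxt (start v) (start v) by exact: connect0.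
by have := orbit_rho st; move: st; rewrite /f /rho /start /=; case: (v.1).
Qed.

(** The orbit of [start v] runs along the path and back. It reaches the far end after [i] steps,
    turns with one more, returns with [i] and turns again, so [i] is determined by the length of the
    orbit and hence by [v] alone. *)
Let end_index v w : w != v -> stack_conn a c (outer_emb v) (outer_emb w) ->
  exists2 i, iter i nxt (start v) = rho (start w) & (i.+1).*2 = fingraph.order nxt (start v).
Proof.
move=> wv /orbit_conn W.
have {}W : fconnect nxt (start v) (rho (start w)).
  have := orbit_rho W; move: W; rewrite /rho /start /=.
  by case: (w.1).
exists (findex nxt (start v) (rho (start w))); first by rewrite iter_findex.
have lt := findex_max W; have := iter_findex W.
move: (findex _ _ _) lt => i lt iE; set L := fingraph.order _ _ in lt *.
have per j : 0 < j -> j < L -> iter j nxt (start v) = start v -> False.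
  by move=> j0 jL E; have := findex_iter jL; rewrite E findex0 => j0'; rewrite -j0' in j0.
have back k : iter k.+1 nxt (rho (iter k nxt (start v))) = start v.
  elim: k => [|k IH]; first by rewrite /= startP.
  by rewrite iterSr /= nrn.
have E2 : iter (i.+1 + i.+1) nxt (start v) = start v.
  by rewrite iterD -{2}(back i) iE rhoK /= iE startP.
have iL : i.+1 != L.
  apply: contraNneq wv => E; have := iter_order nxt_inj (start v).
  by rewrite -/L -E /= iE startP => /(congr1 (fun x => x.1)) /= /outer_inj ->.
(* Since [i < L] and [i.+1] differs from [L], the return time [(i.+1).*2] is below [2 * L]. If it
   were not [L], then it or its excess over [L] would be a return time shorter than [L]. *)
case: (ltngtP (i.+1).*2 L) => // H; exfalso.
  by apply: (per (i.+1).*2) => //; rewrite -addnn.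
apply: (per ((i.+1).*2 - L)); [lia | lia |].
have : iter ((i.+1).*2 - L) nxt (iter L nxt (start v)) = start v.
  by rewrite -iterD subnK ?(ltnW H) // -addnn.
by rewrite (iter_order nxt_inj).
Qed.

(** This makes the choice in [Gp] immaterial: a component of the stack has at most two outer
    vertices. *)
Lemma conn_unique v w w' : w != v -> w' != v ->
  stack_conn a c (outer_emb v) (outer_emb w) -> stack_conn a c (outer_emb v) (outer_emb w') ->
  w = w'.
Proof.
move=> wv w'v /(end_index wv)[i iE i2] /(end_index w'v)[j jE j2].
have ij : i = j by lia.
move: jE; rewrite -ij iE => /(congr1 rho); rewrite !rhoK => /(congr1 (fun x => x.1)) /=.
exact: outer_inj.
Qed.

Lemma Gp_conn v : stack_conn a c (outer_emb v) (outer_emb (Gp a c v)).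
Proof.
by rewrite ffunE; case: pickP => [w /andP[_]|_] //=; apply: connect0.
Qed.

Lemma Gp_eq v w : w != v -> stack_conn a c (outer_emb v) (outer_emb w) -> Gp a c v = w.
Proof.
move=> wv H; rewrite ffunE; case: pickP => [w' /andP[w'v H']|/(_ w)] /=.
  exact: conn_unique H' H.
by rewrite wv H.
Qed.

Lemma Gp_diagram : is_diagram (Gp a c).
Proof.
apply/diagramP => v; case: (eqVneq (Gp a c v) v) => [E|ne]; first by rewrite !E.
by apply: Gp_eq; rewrite 1?eq_sym // /stack_conn conn_sym //; apply: Gp_conn.
Qed.

Lemma Gp_fix v : (forall w, stack_conn a c (outer_emb v) (outer_emb w) -> w = v) -> Gp a c v = v.
Proof. by apply; apply: Gp_conn. Qed.

End OtherEnd.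

Lemma Gp_char a c (e : rawd m) :
  (forall v w, stack_conn a c (outer_emb v) (outer_emb w) -> w = v \/ w = e v) ->
  (forall v, stack_conn a c (outer_emb v) (outer_emb (e v))) -> Gp a c = e.
Proof.
move=> H1 H2; apply/ffunP=> v; rewrite ffunE; case: pickP => [w /andP[wv /H1]|none] /=.
  by case=> // E; rewrite E eqxx in wv.
by apply/eqP; rewrite eq_sym; have := none (e v); rewrite H2 andbT => /negbFE.
Qed.

Lemma Gp_bottom_isolated a c j : is_diagram a -> is_diagram c -> c (true, j) = (true, j) ->
  Gp a c (true, j) = (true, j).
Proof.
move=> aD cD cj; apply: Gp_fix => // w; rewrite {1}/outer_emb /= => H.
pose f (x : 'I_3 * 'I_m) := x == lower_emb (true, j).
have : outer_emb w == lower_emb (true, j).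
  rewrite -/(f _); apply: (conn_rel (f := f) (Q := fun b b' => b -> b') _ _ _ _ H) => //.
  - by move=> y x z xy yz /xy /yz.
  - by move=> v /eqP; case: v => [[] i] [] /eqP; rewrite inord3_eq.
  - by move=> v; rewrite /f !(inj_eq lower_inj) -{2}cj (inj_eq (diagram_inj cD)).
  - by rewrite /f eqxx.
by move=> /eqP/(@outer_inj w (true, j)).
Qed.

Lemma nvert_bottom d : is_diagram d -> nvert d = #|[set j : 'I_m | ~~ (d (true, j)).1]|.
Proof.
move=> dD; have dK := diagramP _ dD; rewrite /nvert.
have -> : [set j : 'I_m | ~~ (d (true, j)).1] = (fun i => (d (false, i)).2) @: [set i : 'I_m | (d (false, i)).1].
  apply/setP=> j; rewrite inE; apply/idP/imsetP => [|[i]].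
    case E: (d (true, j)) => [[] i] //= _; exists i; first by rewrite inE -E dK.
    by rewrite -E dK.
  rewrite inE; case E: (d (false, i)) => [[] j'] //= _ ->.
  by rewrite -E dK.
rewrite card_in_imset // => i i'; rewrite !inE => i1 i1' E.
have : (false, i) = (false, i') by apply: (diagram_inj dD); case: (d _) (d _) i1 i1' E => [[] x] [[] y] //= _ _ ->.
by case.
Qed.

(** By [memIu] these diagrams form the basis of the left factor of the cell module: the through
    strands end at the first [k] bottom vertices and the other bottom vertices are isolated. *)
Definition inD k d := is_diagram d &&
  [forall j : 'I_m, if (j < k)%N then ~~ (d (true, j)).1 else d (true, j) == (true, j)].

Lemma inDP k d : reflect [/\ is_diagram d, forall j : 'I_m, (j < k)%N -> (d (true, j)).1 = false &
  forall j : 'I_m, (k <= j)%N -> d (true, j) = (true, j)] (inD k d).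
Proof.
apply: (iffP andP) => [[D /forallP H]|[D H1 H2]]; split=> //.
- by move=> j jk; have := H j; rewrite jk => /negbTE.
- by move=> j jk; have := H j; rewrite ltnNge jk => /eqP.
apply/forallP=> j; case: ltnP => jk; [by rewrite H1 | by rewrite H2].
Qed.

Lemma card_lt_ord k : (k <= m)%N -> #|[set j : 'I_m | (j < k)%N]| = k.
Proof.
move=> km; rewrite -sum1dep_card -(big_ord_widen _ (fun=> 1%N) km).
by rewrite sum1_card card_ord.
Qed.

Lemma inD_nvert k d : (k <= m)%N -> is_diagram d ->
  (forall j : 'I_m, (k <= j)%N -> d (true, j) = (true, j)) -> inD k d = (nvert d == k).
Proof.
move=> km dD H; rewrite nvert_bottom //.
have sub : [set j : 'I_m | ~~ (d (true, j)).1] \subset [set j : 'I_m | (j < k)%N].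
  apply/subsetP=> j; rewrite !inE; apply: contraR; rewrite -leqNgt => /H -> //.
rewrite -{2}(card_lt_ord km) (subset_leqif_cards sub) eqEsubset sub /=.
apply/inDP/subsetP => [[_ H1 _] j|H1]; first by rewrite !inE => /H1 ->.
split=> // j jk; apply/negbTE; have := H1 j; rewrite !inE; exact.
Qed.

End Stack.

(** * Right multiplication by permutations and by [uD] *)

Section RightAction.
Variable m : nat.
Implicit Types (d : rawd m) (g h : {perm 'I_m}) (v : vtx m).

Definition botact g v : vtx m := (v.1, if v.1 then g v.2 else v.2).

Lemma botactM g h v : botact g (botact h v) = botact (h * g)%g v.
Proof. by case: v => [[] i]; rewrite /botact /= ?permM. Qed.
Lemma botact1 v : botact 1%g v = v.
Proof. by case: v => [[] i]; rewrite /botact /= ?perm1. Qed.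
Lemma botactK g : cancel (botact g) (botact g^-1%g).
Proof. by move=> v; rewrite botactM mulgV botact1. Qed.
Lemma botactVK g : cancel (botact g^-1%g) (botact g).
Proof. by move=> v; rewrite botactM mulVg botact1. Qed.

(** The product of [d] with the diagram of [g], written as a relabelling of the bottom row; see
    [Gp_permD]. *)
Definition rmul d g : rawd m := [ffun v => botact (g^-1)%g (d (botact g v))].

Lemma rmulM d g h : rmul (rmul d g) h = rmul d (h * g)%g.
Proof. by apply/ffunP=> v; rewrite !ffunE !botactM invMg. Qed.
Lemma rmul1 d : rmul d 1%g = d.
Proof. by apply/ffunP=> v; rewrite !ffunE invg1 !botact1. Qed.
Lemma rmulK g : cancel (rmul^~ g) (rmul^~ g^-1%g).
Proof. by move=> d; rewrite rmulM mulVg rmul1. Qed.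

Lemma rmulK' g : cancel (rmul^~ g^-1%g) (rmul^~ g).
Proof. by move=> d; rewrite rmulM mulgV rmul1. Qed.

Lemma rmul_diagram d g : is_diagram d -> is_diagram (rmul d g).
Proof.
by move=> /diagramP dK; apply/diagramP=> v; rewrite !ffunE botactVK dK botactK.
Qed.

Lemma inD_rmul k d g : in_Sk k g -> inD k d -> inD k (rmul d g).
Proof.
move=> gS /inDP[dD H1 H2]; apply/inDP; split=> [|j jk|j kj]; first exact: rmul_diagram.
  by rewrite ffunE /= H1 // (in_Sk_lt _ gS).
have gV : in_Sk k (g^-1)%g by rewrite in_SkV.
by rewrite ffunE {2}/botact /= (in_SkP _ _ gS) // H2 // /botact /= (in_SkP _ _ gV).
Qed.

Lemma permD_diagram g : is_diagram (permD g).
Proof.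
by apply/diagramP=> -[[] i]; rewrite /permD !ffunE /= ?permK ?permKV.
Qed.

Lemma permD_lower d g v : stack_conn d (permD g) (outer_emb v) (upper_emb (botact g v)).
Proof.
case: v => [[] i]; last exact: connect0.
by have := conn_lower d (permD g) (true, i); rewrite ffunE /=.
Qed.

(** The map [f] collapses the stack onto one diagram, reading the middle row as the bottom row moved
    by the inverse of [g]. Arcs of [permD g] collapse to points and arcs of [d] become arcs of
    [rmul d g]. *)
Lemma Gp_permD d g : is_diagram d -> Gp d (permD g) = rmul d g.
Proof.
move=> dD; have rD := diagramP _ (rmul_diagram g dD); apply: Gp_char => [v w H|v].
  pose f (x : 'I_3 * 'I_m) : vtx m :=
    if x.1 == r0 then (false, x.2) else if x.1 == r1 then (true, (g^-1)%g x.2) else (true, x.2).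
  have fo u : f (outer_emb u) = u by case: u => [[] j]; rewrite /f /= ?inord3_eq.
  have fu u : f (upper_emb u) = botact (g^-1)%g u by case: u => [[] j]; rewrite /f /= ?inord3_eq.
  rewrite -[v]fo -[w]fo.
  apply: (conn_rel (f := f) (Q := fun x y => y = x \/ y = rmul d g x) _ _ _ _ H).
  - by left.
  - by move=> y x z [->|->] [->|->]; rewrite ?rD; auto.
  - by move=> u; right; rewrite !fu ffunE botactVK.
  - by case=> [[] i]; left; rewrite /f ffunE /= !inord3_eq //= permK.
apply: (connect_trans (permD_lower d g v)); apply: (connect_trans (conn_upper _ _ _)).
have -> : d (botact g v) = botact g (rmul d g v) by rewrite ffunE botactVK.
by rewrite (conn_sym dD (permD_diagram g)); apply: permD_lower.
Qed.

Lemma ell_permD d g : is_diagram d -> ell d (permD g) = 0.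
Proof.
move=> dD; apply: eq_card0 => -[r i]; rewrite inE; apply/negP=> /andP[_ /forallP H].
have := H (r, i); rewrite /stack_conn connect0 /= => /eqP ri.
have := H (r2, (g^-1)%g i).
have -> : stack_conn d (permD g) (r, i) (r2, (g^-1)%g i).
  by rewrite ri; have := conn_lower d (permD g) (false, i); rewrite ffunE /=.
by rewrite /= inord3_eq.
Qed.

Lemma uD_diagram k : is_diagram (uD m k).
Proof.
apply/diagramP=> v; rewrite !ffunE; case: (boolP (v.2 < k)) => vk /=; rewrite ?vk ?(negPf vk) //=.
by rewrite negbK -surjective_pairing.
Qed.

Lemma Gp_uD k d : inD k d -> Gp d (uD m k) = d.
Proof.
move=> /inDP[dD H1 H2]; have dK := diagramP _ dD; apply: Gp_char => [v w H|v].
  pose f (x : 'I_3 * 'I_m) : vtx m := (x.1 != r0, x.2).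
  have fo u : f (outer_emb u) = u by case: u => [[] j]; rewrite /f /= ?inord3_eq.
  have fu u : f (upper_emb u) = u by case: u => [[] j]; rewrite /f /= ?inord3_eq.
  rewrite -[v]fo -[w]fo.
  apply: (conn_rel (f := f) (Q := fun x y => y = x \/ y = d x) _ _ _ _ H).
  - by left.
  - by move=> y x z [->|->] [->|->]; rewrite ?dK; auto.
  - by move=> u; right; rewrite !fu.
  - by case=> [[] i]; left; rewrite /f ffunE /=; case: (ltnP i k) => _ /=; rewrite ?inord3_eq.
have lo u : d u != u -> stack_conn d (uD m k) (outer_emb u) (upper_emb u).
  case: u => [[] j] uv; last exact: connect0.
  case: (ltnP j k) => jk; last by rewrite H2 ?eqxx in uv.
  by have := conn_lower d (uD m k) (true, j); rewrite ffunE /= jk.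
case: (eqVneq (d v) v) => [->|ne]; first exact: connect0.
apply: (connect_trans (lo v ne)); apply: (connect_trans (conn_upper _ _ _)).
by rewrite (conn_sym dD (uD_diagram k)); apply: lo; rewrite dK eq_sym.
Qed.

Lemma inD_Gp_uD k d : (k <= m)%N -> is_diagram d -> nvert (Gp d (uD m k)) = k ->
  inD k (Gp d (uD m k)).
Proof.
move=> km dD E; rewrite inD_nvert ?E ?Gp_diagram ?uD_diagram // => j kj.
rewrite Gp_bottom_isolated ?uD_diagram // ffunE /= ltnNge kj //.
Qed.

Lemma inD_Gp k b d : (k <= m)%N -> is_diagram b -> inD k d ->
  inD k (Gp b d) = (nvert (Gp b d) == k).
Proof.
move=> km bD /inDP[dD _ H2]; rewrite inD_nvert ?Gp_diagram // => j kj.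
by rewrite Gp_bottom_isolated ?H2.
Qed.

End RightAction.

(** * Products with [eps b] reduced to products with [b] *)

Section Extension.
Variable m : nat.

Definition wo (i : 'I_m) : 'I_m.+1 := lift ord_max i.
Definition wv (v : vtx m) : vtx m.+1 := (v.1, wo v.2).

Lemma wo_inj : injective wo. Proof. exact: lift_inj. Qed.

Lemma wo_neq i : wo i != ord_max.
Proof. by rewrite eq_sym neq_lift. Qed.

Variant wo_spec : 'I_m.+1 -> Type :=
 | WoMax : wo_spec ord_max
 | WoLift i : wo_spec (wo i).
Lemma woP i : wo_spec i.
Proof. by case: (unliftP ord_max i) => [j ->|->]; constructor. Qed.

Lemma wo_val i : wo i = i :> nat. Proof. exact: lift_max. Qed.

Lemma eps_wv (b : rawd m) v : @eps m.+1 b (wv v) = wv (b v).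
Proof.
rewrite ffunE [X in insub X](wo_val v.2); case: insubP => [i _ iE|]; last by rewrite ltn_ord.
have -> : ((wv v).1, i) = v by case: v iE => r j /= iE; congr (_, _); apply: val_inj.
by congr (_, _); apply: val_inj; apply: esym; apply: wo_val.
Qed.

Lemma eps_max (b : rawd m) r : @eps m.+1 b (r, ord_max) = (~~ r, ord_max).
Proof. by rewrite ffunE /=; case: insubP => [i + _|//]; rewrite ltnn. Qed.

Lemma eps_diagram (b : rawd m) : is_diagram b -> is_diagram (@eps m.+1 b).
Proof.
move=> /diagramP bK; apply/diagramP => -[r i]; case: (woP i) => [|j].
  by rewrite !eps_max negbK.
by rewrite -[(r, _)]/(wv (r, j)) !eps_wv bK.
Qed.

(** A common frame for three ways of adding a vertex: [nu] places the small diagram [d'] inside [d]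
    with its top vertices unmoved, while its bottom vertices may go anywhere else, even to the new
    top vertex. *)
Variables (nu : vtx m -> vtx m.+1) (b d' : rawd m) (d : rawd m.+1).
Hypotheses (nu_inj : injective nu) (nu_top : forall i, nu (false, i) = (false, wo i)).
Hypotheses (bD : is_diagram b) (dD' : is_diagram d') (dD : is_diagram d).
Hypothesis nu_d : forall v, d (nu v) = nu (d' v).
Local Notation e := (@eps m.+1 b).
Let eD : is_diagram e. Proof. exact: eps_diagram. Qed.

Let kappa (u : vtx m.+1) : ('I_3 * 'I_m) + vtx m.+1 :=
  if [pick v | nu v == u] is Some v then inl (lower_emb v) else inr u.
(** A retraction of the large stack onto the small one together with the vertices that [nu] misses.
    The last vertices of rows 0 and 1 are joined by the extra arc of [eps b], so both go to the same
    point. [phi] is a section of it, and together they show that connectivity in the small stack is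
    neither gained nor lost. *)
Let retr (x : 'I_3 * 'I_m.+1) : ('I_3 * 'I_m) + vtx m.+1 :=
  if x.1 == r0 then (if unlift ord_max x.2 is Some i then inl (r0, i) else kappa (false, ord_max))
  else kappa (x.1 == r2, x.2).
Let Q (x y : ('I_3 * 'I_m) + vtx m.+1) : Prop :=
  match x, y with
  | inl x, inl y => stack_conn b d' x y
  | inr u, inr u' => u' = u \/ u' = d u
  | _, _ => False
  end.
Let phi (x : 'I_3 * 'I_m) : 'I_3 * 'I_m.+1 :=
  if x.1 == r2 then lower_emb (nu (true, x.2)) else (x.1, wo x.2).

Let kappa_nu v : kappa (nu v) = inl (lower_emb v).
Proof.
by rewrite /kappa; case: pickP => [w /eqP/nu_inj ->//|/(_ v)]; rewrite eqxx.
Qed.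
Let kappa_compl u : u \notin codom nu -> kappa u = inr u.
Proof.
by rewrite /kappa; case: pickP => [w /eqP <-|//]; rewrite codom_f.
Qed.
Let compl_d u : u \notin codom nu -> d u \notin codom nu.
Proof.
apply: contra => /codomP[v E]; apply/codomP; exists (d' v).
by rewrite -nu_d -E (diagramP _ dD).
Qed.

Let Qd u : Q (kappa u) (kappa (d u)).
Proof.
case: (boolP (u \in codom nu)) => [/codomP[v ->]|uN].
  by rewrite nu_d !kappa_nu; apply: conn_lower.
by rewrite !kappa_compl ?compl_d //; right.
Qed.

Let retr_upper v : retr (upper_emb (wv v)) = inl (upper_emb v).
Proof.
case: v => [[] i]; rewrite /retr /= !inord3_eq //= ?liftK //.
by rewrite -nu_top kappa_nu.
Qed.
Let retr_lower u : retr (lower_emb u) = kappa u.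
Proof. by case: u => [[] i]; rewrite /retr /= !inord3_eq. Qed.

Let retr_conn x y : stack_conn e d x y -> Q (retr x) (retr y).
Proof.
apply: conn_rel => {x y}.
- by case=> [x|u] /=; [exact: connect0 | left].
- case=> [y|u] [x|u'] [z|u''] //=; first exact: connect_trans.
  by case=> -> [] ->; rewrite ?(diagramP _ dD); auto.
- case=> r i; case: (woP i) => [|j].
    rewrite eps_max.
    have max s : retr (upper_emb (s, ord_max)) = kappa (false, ord_max).
      by case: s; rewrite /retr /= !inord3_eq // unlift_none.
    rewrite !max; case: kappa => [x|u] /=; [exact: connect0 | by left].
  by rewrite -[(r, _)]/(wv (r, j)) eps_wv !retr_upper; apply: conn_upper.
by move=> u; rewrite !retr_lower.
Qed.

Let phi_lower v : phi (lower_emb v) = lower_emb (nu v).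
Proof. by case: v => [[] i]; rewrite /phi /= inord3_eq //= nu_top. Qed.
Let phi_upper v : phi (upper_emb v) = upper_emb (wv v).
Proof. by case: v => [[] i]; rewrite /phi /= inord3_eq. Qed.
Let retr_phi x : retr (phi x) = inl x.
Proof.
case: x => r i; case: (row_cases r) => ->.
- by rewrite -[(r0, i)]/(upper_emb (false, i)) phi_upper retr_upper.
- by rewrite -[(r1, i)]/(upper_emb (true, i)) phi_upper retr_upper.
by rewrite -[(r2, i)]/(lower_emb (true, i)) phi_lower retr_lower kappa_nu.
Qed.

Let phi_conn x y : stack_conn b d' x y = stack_conn e d (phi x) (phi y).
Proof.
apply/idP/idP => [|/retr_conn]; last by rewrite !retr_phi.
apply: (conn_rel (Q := fun x y => stack_conn e d x y)) => {x y}.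
- by move=> x; apply: connect0.
- by move=> y x z; apply: connect_trans.
- by move=> v; rewrite !phi_upper -eps_wv; apply: conn_upper.
- by move=> v; rewrite !phi_lower -nu_d; apply: conn_lower.
Qed.

Let conn_max : stack_conn e d (r0, ord_max) (r1, ord_max).
Proof. by have := conn_upper e d (false, ord_max); rewrite eps_max. Qed.

Let outer_lower u : (forall i, u <> (false, wo i)) -> stack_conn e d (outer_emb u) (lower_emb u).
Proof.
case: u => [[] i] H; first exact: connect0.
by move: H; case: (woP i) => [_|j /(_ j)//].
Qed.

Let outer_nu v : stack_conn e d (outer_emb (nu v)) (phi (outer_emb v)).
Proof.
case: v => [[] i]; last by rewrite nu_top -[outer_emb (false, i)]/(upper_emb (false, i)) phi_upper; apply: connect0.
rewrite -[outer_emb (true, i)]/(lower_emb (true, i)) phi_lower; apply: outer_lower => j.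
by rewrite -nu_top => /nu_inj.
Qed.

Let compl_top u : u \notin codom nu -> forall i, u <> (false, wo i).
Proof. by move=> uN i E; case/negP: uN; rewrite E -nu_top codom_f. Qed.

Let retr_outer u : retr (outer_emb u) = if u \in codom nu then
   (if [pick v | nu v == u] is Some v then inl (outer_emb v) else inr u) else inr u.
Proof.
case: u => [[] i].
  rewrite -[outer_emb (true, i)]/(lower_emb (true, i)) retr_lower /kappa.
  case: pickP => [v /eqP E|none].
    rewrite -E codom_f; case: v E => [[] j] // E.
    by rewrite nu_top in E.
  by case: ifP.
case: (woP i) => [|j].
  rewrite /retr /= eqxx unlift_none /kappa; case: pickP => [v /eqP E|none]; last by case: ifP.
  rewrite -E codom_f; case: v E => [[] j] // E.
  by have := wo_neq j; have := congr1 snd E; rewrite nu_top /= => ->; rewrite eqxx.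
rewrite -[outer_emb _]/(upper_emb (wv (false, j))) retr_upper -nu_top codom_f.
by case: pickP => [v /eqP/nu_inj -> //|/(_ (false, j))]; rewrite eqxx.
Qed.
Let retr_outer_nu v : retr (outer_emb (nu v)) = inl (outer_emb v).
Proof.
by rewrite retr_outer codom_f; case: pickP => [w /eqP/nu_inj ->//|/(_ v)]; rewrite eqxx.
Qed.
Let retr_outer_compl u : u \notin codom nu -> retr (outer_emb u) = inr u.
Proof. by rewrite retr_outer => /negPf ->. Qed.

Lemma Gp_ext v : Gp e d (nu v) = nu (Gp b d' v).
Proof.
case: (eqVneq (Gp b d' v) v) => [E|ne].
  rewrite E; apply: Gp_fix => // w /retr_conn; rewrite retr_outer_nu.
  case: (boolP (w \in codom nu)) => [/codomP[w' ->]|wN]; last by rewrite retr_outer_compl.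
  rewrite retr_outer_nu /= => H; congr nu; apply/eqP; apply: contraTT isT => w'v.
  by have := Gp_eq bD dD' w'v H; rewrite E => Ew; rewrite Ew eqxx in w'v.
apply: Gp_eq => //; first by rewrite (inj_eq nu_inj).
apply: (connect_trans (outer_nu v)); rewrite (conn_sym eD dD).
by apply: (connect_trans (outer_nu _)); rewrite (conn_sym eD dD) -/(stack_conn _ _ _ _) -phi_conn Gp_conn.
Qed.

Lemma Gp_ext_compl u : u \notin codom nu -> Gp e d u = d u.
Proof.
move=> uN; case: (eqVneq (d u) u) => [E|ne].
  rewrite E; apply: Gp_fix => // w /retr_conn; rewrite retr_outer_compl //.
  case: (boolP (w \in codom nu)) => [/codomP[w' ->]|wN]; first by rewrite retr_outer_nu.
  by rewrite retr_outer_compl //= E => -[].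
apply: Gp_eq => //; apply: (connect_trans (outer_lower (compl_top uN))).
apply: (connect_trans (conn_lower _ _ _)); rewrite (conn_sym eD dD).
by apply: outer_lower; apply: compl_top; apply: compl_d.
Qed.

(** A component inside the middle row avoids the last middle vertex, which [eps b] joins to the top
    row. So it lies in the image of [phi], which puts such components of the two stacks in
    bijection. *)
Lemma ell_ext : ell e d = ell b d'.
Proof.
pose a := [pred w : 'I_3 * 'I_m.+1 | [forall w', stack_conn e d w w' ==> (w'.1 == r1)]].
pose a' := [pred w : 'I_3 * 'I_m | [forall w', stack_conn b d' w w' ==> (w'.1 == r1)]].
have aP x y : x \in a -> stack_conn e d x y -> y.1 = r1.
  by move=> /forallP/(_ y)/implyP H /H /eqP.
have maxN : (r1, ord_max) \notin a.
  apply/negP=> H; have : stack_conn e d (r1, ord_max) (r0, ord_max).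
    by rewrite /stack_conn (conn_sym eD dD); apply: conn_max.
  by move=> /(aP _ _ H) /eqP; rewrite inord3_eq.
have -> : ell e d = n_comp (stack_edge e d) a.
  by rewrite /n_comp_mem /ell cardsE; apply: eq_card => x; rewrite !inE.
have -> : ell b d' = n_comp (stack_edge b d') a'.
  by rewrite /n_comp_mem /ell cardsE; apply: eq_card => x; rewrite !inE.
have cl : closed (stack_edge e d) a.
  apply: intro_closed; first exact: conn_sym.
  move=> x y /connect1 xy xa; apply/forallP=> z; apply/implyP=> yz; apply/eqP.
  by apply: (aP x) => //; apply: connect_trans yz.
rewrite (@adjunction_n_comp _ _ phi _ (stack_edge b d') (conn_sym eD dD) (conn_sym bD dD') a cl).
  apply: eq_n_comp_r => x; apply/forallP/forallP => H y; apply/implyP.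
    rewrite phi_conn => xy.
    have ya : phi y \in a.
      rewrite -(closed_connect cl xy); exact/forallP.
    have := aP _ _ ya (connect0 _ _); case: y {xy} ya => r i ya.
    case: (row_cases r) ya => -> ya //=; first by rewrite /phi /= inord3_eq //= => /eqP; rewrite inord3_eq.
    rewrite /phi /= eqxx; move: ya; rewrite /phi /= eqxx.
    case E: (nu (true, i)) => [[] j] ya /=; first by move/eqP; rewrite inord3_eq.
    move=> _; case: (woP j) E ya => [E ya|j' E]; first by case/negP: maxN.
    by move: E; rewrite -nu_top => /nu_inj.
  move=> xy; have := retr_conn xy; rewrite retr_phi.
  case: y xy => r i xy; case: (row_cases r) xy => -> xy //.
    rewrite /retr /= eqxx; case: unliftP => [j _|_].
      by move=> /(implyP (H (r0, j))); rewrite /= inord3_eq.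
    rewrite /kappa; case: pickP => //= -[[] j] /eqP; last first.
      by rewrite nu_top => /(congr1 snd) /= E; have := wo_neq j; rewrite E eqxx.
    by move=> _ /(implyP (H _)); rewrite /= inord3_eq.
  rewrite /retr /= !inord3_eq //= eqxx /kappa; case: pickP => //= -[[] j] /eqP; last by rewrite nu_top.
  by move=> _ /(implyP (H _)); rewrite /= inord3_eq.
split=> [x xa|x' y' xa]; last exact: phi_conn.
have := aP _ _ xa (connect0 _ _); case: x xa => r i /= xa rE; move: xa; rewrite rE.
case: (woP i) => [ma|j _]; first by case/negP: maxN.
by exists (r1, j); rewrite /phi /= inord3_eq //= connect0.
Qed.

End Extension.

(** * Transporting a diagram along an embedding of vertices *)

Section Extend.
Variables (m : nat) (nu : vtx m -> vtx m.+1) (s : vtx m.+1 -> vtx m.+1).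
Hypothesis nu_inj : injective nu.
Implicit Types (b c : rawd m) (d : rawd m.+1).

(** On the vertices outside the image of [nu] the diagram is prescribed by the fixed involution [s];
    [contr] undoes the construction for diagrams of this kind ([contrK]). *)
Definition extd (c : rawd m) : rawd m.+1 :=
  [ffun u => if [pick v | nu v == u] is Some v then nu (c v) else s u].
Definition contr d : rawd m := [ffun v => odflt v [pick v' | nu v' == d (nu v)]].

Lemma extd_nu c v : extd c (nu v) = nu (c v).
Proof.
by rewrite ffunE; case: pickP => [w /eqP/nu_inj ->//|/(_ v)]; rewrite eqxx.
Qed.
Lemma extd_compl c u : u \notin codom nu -> extd c u = s u.
Proof. by rewrite ffunE; case: pickP => [w /eqP <-|//]; rewrite codom_f. Qed.

Lemma extd_inj : injective extd.
Proof.
move=> d1 d2 E; apply/ffunP=> v; apply: nu_inj.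
by rewrite -!extd_nu E.
Qed.

Hypotheses (sK : involutive s) (s_compl : forall u, u \notin codom nu -> s u \notin codom nu).

Lemma extd_diagram c : is_diagram c -> is_diagram (extd c).
Proof.
move=> /diagramP dK; apply/diagramP=> u; case: (boolP (u \in codom nu)) => [/codomP[v ->]|uN].
  by rewrite !extd_nu dK.
by rewrite !extd_compl ?s_compl ?sK.
Qed.

Lemma extd_diagramE c : is_diagram (extd c) = is_diagram c.
Proof.
apply/idP/idP; last exact: extd_diagram.
by move=> /diagramP dK; apply/diagramP=> v; apply: nu_inj; rewrite -!extd_nu dK.
Qed.

Lemma contrK d : is_diagram d -> (forall u, u \notin codom nu -> d u = s u) -> extd (contr d) = d.
Proof.
move=> dD H; apply/ffunP=> u; case: (boolP (u \in codom nu)) => [/codomP[v ->]|uN]; last first.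
  by rewrite extd_compl ?H.
rewrite extd_nu ffunE; case: pickP => [v' /eqP //|none] /=.
have dN : d (nu v) \notin codom nu by apply/negP=> /codomP[v' E]; have := none v'; rewrite E eqxx.
by have := s_compl dN; rewrite -H // (diagramP _ dD) codom_f.
Qed.

Lemma rmul_extd c (h : {perm 'I_m}) (g : {perm 'I_m.+1}) :
  (forall v, nu (botact h v) = botact g (nu v)) ->
  (forall u, u \notin codom nu -> s (botact g u) = botact g (s u)) ->
  rmul (extd c) g = extd (rmul c h).
Proof.
move=> hg sg.
have hgV v : nu (botact (h^-1)%g v) = botact (g^-1)%g (nu v).
  by rewrite -{2}(botactVK h v) hg botactK.
apply/ffunP=> u; rewrite ffunE; case: (boolP (u \in codom nu)) => [/codomP[v ->]|uN].
  by rewrite -hg !extd_nu ffunE hgV.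
have guN : botact g u \notin codom nu.
  apply: contra uN => /codomP[v E]; apply/codomP; exists (botact (h^-1)%g v).
  by rewrite hgV -E botactK.
by rewrite !extd_compl // sg // botactK.
Qed.

Hypothesis nu_top : forall i, nu (false, i) = (false, wo i).

Lemma Gp_extd b c : is_diagram b -> is_diagram c ->
  Gp (@eps m.+1 b) (extd c) = extd (Gp b c).
Proof.
move=> bD dD; have eD := extd_diagram dD; have nd := extd_nu c.
apply/ffunP=> u; case: (boolP (u \in codom nu)) => [/codomP[v ->]|uN].
  by rewrite (Gp_ext nu_inj nu_top bD dD eD nd) extd_nu.
by rewrite (Gp_ext_compl nu_inj nu_top bD eD nd uN) !extd_compl.
Qed.

Lemma ell_extd b c : is_diagram b -> is_diagram c ->
  ell (@eps m.+1 b) (extd c) = ell b c.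
Proof.
by move=> bD dD; apply: (ell_ext nu_inj nu_top bD dD (extd_diagram dD) (extd_nu c)).
Qed.

End Extend.

(** * Adding the vertex n: isolated, on a through strand, or joined to a top vertex *)

Section Iota.
Variable m : nat.
Implicit Types (b c : rawd m) (d : rawd m.+1) (p : 'I_m).

Definition nu0 (v : vtx m) : vtx m.+1 := wv v.
Definition nu1 p (v : vtx m) : vtx m.+1 := if v == (true, p) then (true, ord_max) else wv v.
Definition nu2 p (v : vtx m) : vtx m.+1 := if v == (true, p) then (false, ord_max) else wv v.
Definition swap1 p (u : vtx m.+1) : vtx m.+1 :=
  if u == (false, ord_max) then (true, wo p) else
  if u == (true, wo p) then (false, ord_max) else u.

(* A diagram on n-1 points is extended to n points with n isolated, with n joined to the bottom
   vertex p' (whose former arc goes to n'), or with n put in the place of the bottom vertex p'. *)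
Definition iota0 := extd nu0 id.
Definition iota1 p := extd (nu1 p) (swap1 p).
Definition iota2 p := extd (nu2 p) id.

Lemma wv_inj : injective (@wv m).
Proof.
move=> [r i] [r' i'] E; have [-> _] := E.
by have /wo_inj -> : wo i = wo i' := congr1 snd E.
Qed.
Lemma wv_max (v : vtx m) (r : bool) : wv v != (r, ord_max).
Proof.
by apply/eqP=> /(congr1 snd) E; have := wo_neq v.2; rewrite (E : wo v.2 = ord_max) eqxx.
Qed.

Lemma nu0_inj : injective nu0. Proof. exact: wv_inj. Qed.
Lemma nu1_inj p : injective (nu1 p).
Proof.
move=> v w; rewrite /nu1; case: eqP => [->|_]; case: eqP => [->|_] //; last exact: wv_inj.
  by move=> /esym/eqP; rewrite (negPf (wv_max _ _)).
by move=> /eqP; rewrite (negPf (wv_max _ _)).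
Qed.
Lemma nu2_inj p : injective (nu2 p).
Proof.
move=> v w; rewrite /nu2; case: eqP => [->|_]; case: eqP => [->|_] //; last exact: wv_inj.
  by move=> /esym/eqP; rewrite (negPf (wv_max _ _)).
by move=> /eqP; rewrite (negPf (wv_max _ _)).
Qed.
Lemma nu0_top i : nu0 (false, i) = (false, wo i). Proof. by []. Qed.
Lemma nu1_top p i : nu1 p (false, i) = (false, wo i). Proof. by rewrite /nu1. Qed.
Lemma nu2_top p i : nu2 p (false, i) = (false, wo i). Proof. by rewrite /nu2. Qed.

Lemma nu0_compl u : (u \notin codom nu0) = (u.2 == ord_max).
Proof.
case: u => r i; case: (woP i) => [|j]; rewrite /= ?eqxx ?(negPf (wo_neq _)).
  by apply/codomP=> -[v] /esym/eqP; rewrite (negPf (wv_max _ _)).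
by apply/negbTE; rewrite negbK; apply/codomP; exists (r, j).
Qed.
Lemma nu1_compl p u : (u \notin codom (nu1 p)) = (u == (false, ord_max)) || (u == (true, wo p)).
Proof.
apply/idP/idP => [|/orP[]/eqP ->].
- apply: contraR; rewrite negb_or => /andP[u1 u2]; apply/codomP.
  case: u u1 u2 => r i; case: (woP i) => [|j] u1 u2.
    by exists (true, p); rewrite /nu1 eqxx; case: r u1 u2 => //; rewrite eqxx.
  exists (r, j); rewrite /nu1; case: eqP => // -[rE jE].
  by move: u2; rewrite rE jE eqxx.
- apply/codomP=> -[v]; rewrite /nu1; case: eqP => // _ /esym/eqP; rewrite (negPf (wv_max _ _)) //.
apply/codomP=> -[v]; rewrite /nu1; case: eqP => [_|ne].
  by move=> /(congr1 snd) /= E; have := wo_neq p; rewrite E eqxx.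
by move=> /(@wv_inj (true, p)) E; case: ne.
Qed.
Lemma nu2_compl p u : (u \notin codom (nu2 p)) = (u == (true, ord_max)) || (u == (true, wo p)).
Proof.
apply/idP/idP => [|/orP[]/eqP ->].
- apply: contraR; rewrite negb_or => /andP[u1 u2]; apply/codomP.
  case: u u1 u2 => r i; case: (woP i) => [|j] u1 u2.
    by exists (true, p); rewrite /nu2 eqxx; case: r u1 u2 => //; rewrite eqxx.
  exists (r, j); rewrite /nu2; case: eqP => // -[rE jE].
  by move: u2; rewrite rE jE eqxx.
- apply/codomP=> -[v]; rewrite /nu2; case: eqP => // _ /esym/eqP; rewrite (negPf (wv_max _ _)) //.
apply/codomP=> -[v]; rewrite /nu2; case: eqP => [_|ne] //.
by move=> /(@wv_inj (true, p)) E; case: ne.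
Qed.

Lemma swap1K p : involutive (swap1 p).
Proof.
move=> u; rewrite /swap1; case: (eqVneq u (false, ord_max)) => [->|u1]; first by rewrite eqxx.
by case: (eqVneq u (true, wo p)) => [->|u2] /=; rewrite ?eqxx // (negPf u1) (negPf u2).
Qed.
Lemma swap1_compl p u : u \notin codom (nu1 p) -> swap1 p u \notin codom (nu1 p).
Proof. by rewrite !nu1_compl /swap1 => /orP[] /eqP ->; rewrite !eqxx ?orbT. Qed.

Lemma iota0_inj : injective iota0. Proof. exact: extd_inj nu0_inj. Qed.
Lemma iota1_inj p : injective (iota1 p). Proof. exact: extd_inj (@nu1_inj p). Qed.
Lemma iota2_inj p : injective (iota2 p). Proof. exact: extd_inj (@nu2_inj p). Qed.

Lemma Gp_iota0 b c : is_diagram b -> is_diagram c -> Gp (@eps m.+1 b) (iota0 c) = iota0 (Gp b c).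
Proof. exact: (Gp_extd nu0_inj _ _ nu0_top). Qed.
Lemma Gp_iota1 p b c : is_diagram b -> is_diagram c ->
  Gp (@eps m.+1 b) (iota1 p c) = iota1 p (Gp b c).
Proof. exact: (Gp_extd (@nu1_inj p) (swap1K p) (@swap1_compl p) (nu1_top p)). Qed.
Lemma Gp_iota2 p b c : is_diagram b -> is_diagram c ->
  Gp (@eps m.+1 b) (iota2 p c) = iota2 p (Gp b c).
Proof. exact: (Gp_extd (@nu2_inj p) _ _ (nu2_top p)). Qed.
Lemma ell_iota0 b c : is_diagram b -> is_diagram c -> ell (@eps m.+1 b) (iota0 c) = ell b c.
Proof. exact: (ell_extd nu0_inj _ _ nu0_top). Qed.
Lemma ell_iota1 p b c : is_diagram b -> is_diagram c -> ell (@eps m.+1 b) (iota1 p c) = ell b c.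
Proof. exact: (ell_extd (@nu1_inj p) (swap1K p) (@swap1_compl p) (nu1_top p)). Qed.
Lemma ell_iota2 p b c : is_diagram b -> is_diagram c -> ell (@eps m.+1 b) (iota2 p c) = ell b c.
Proof. exact: (ell_extd (@nu2_inj p) _ _ (nu2_top p)). Qed.

Lemma iota0_max c : iota0 c (false, ord_max) = (false, ord_max).
Proof. by rewrite extd_compl ?nu0_compl. Qed.
Lemma iota1_max p c : iota1 p c (false, ord_max) = (true, wo p).
Proof. by rewrite extd_compl ?nu1_compl /swap1 ?eqxx. Qed.
Lemma nu2_p p : nu2 p (true, p) = (false, ord_max).
Proof. by rewrite /nu2 eqxx. Qed.
Lemma nu1_p p : nu1 p (true, p) = (true, ord_max).
Proof. by rewrite /nu1 eqxx. Qed.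
Lemma iota2_max p c : iota2 p c (false, ord_max) = nu2 p (c (true, p)).
Proof. by rewrite -{1}(nu2_p p) (extd_nu _ (@nu2_inj p)). Qed.

Lemma inD_iota0 k c : (k <= m)%N -> inD k (iota0 c) = inD k c.
Proof.
move=> km; have E (j : 'I_m) : iota0 c (true, wo j) = wv (c (true, j)).
  exact: (extd_nu _ nu0_inj c (true, j)).
rewrite /inD (extd_diagramE nu0_inj) //; congr (_ && _); apply/forallP/forallP => H j.
  have := H (wo j); rewrite E wo_val /=; case: ltnP => // _.
  by rewrite -[(true, wo j)]/(wv (true, j)) (inj_eq wv_inj).
case: (woP j) => [|i]; first by rewrite ltnNge km /= extd_compl ?nu0_compl.
have := H i; rewrite E wo_val /=; case: ltnP => // _.
by rewrite -[(true, wo i)]/(wv (true, i)) (inj_eq wv_inj).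
Qed.

(** The strand of n ends at bottom vertex [p], the last of the first [p.+1]. This vertex was
    isolated in [c], so its replacement n' is isolated too. *)
Lemma inD_iota1 p c : is_diagram c -> (forall j : 'I_m, (p <= j)%N -> c (true, j) = (true, j)) ->
  inD p.+1 (iota1 p c) = inD p c.
Proof.
move=> dD iso.
have E (j : 'I_m) : j != p -> iota1 p c (true, wo j) = nu1 p (c (true, j)).
  move=> /negPf jp; have -> : (true, wo j) = nu1 p (true, j) by rewrite /nu1 xpair_eqE jp.
  exact: (extd_nu _ (@nu1_inj p)).
have pE : iota1 p c (true, wo p) = (false, ord_max).
  by rewrite extd_compl ?nu1_compl ?eqxx ?orbT // /swap1 eqxx.
have mE : iota1 p c (true, ord_max) = (true, ord_max).
  by rewrite -(nu1_p p) (extd_nu _ (@nu1_inj p)) iso.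
have nu1_row v : (nu1 p v).1 = v.1 by rewrite /nu1; case: eqP => [->|].
rewrite /inD (extd_diagramE (@nu1_inj p) (swap1K p) (@swap1_compl p)); congr (_ && _).
apply/forallP/forallP => H j.
  case: (ltnP j p) => jp; last by rewrite iso.
  have := H (wo j); rewrite wo_val E; last by rewrite -val_eqE /= neq_ltn jp.
  by rewrite ltnS (ltnW jp) nu1_row.
case: (woP j) => [|i]; first by rewrite mE eqxx /= ltnNge ltn_ord.
rewrite wo_val ltnS; case: (ltngtP i p) => ip; last first.
- by rewrite (val_inj ip) pE.
- rewrite E ?iso ?(ltnW ip) //; last by rewrite -val_eqE /= neq_ltn ip orbT.
  by rewrite /nu1 xpair_eqE -val_eqE /= (gtn_eqF ip).
rewrite E; last by rewrite -val_eqE /= neq_ltn ip.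
by have := H i; rewrite ip nu1_row.
Qed.

(** The strand of [c] ending at bottom vertex [p] is bent upwards to n: one through strand is lost
    and vertex [p] of the bottom row becomes isolated. *)
Lemma inD_iota2 p c : inD p.+1 c -> inD p (iota2 p c).
Proof.
move=> /inDP[dD H1 H2].
have nE v : v != (true, p) -> nu2 p v = wv v by rewrite /nu2 => /negPf ->.
have E (j : 'I_m) : j != p -> iota2 p c (true, wo j) = nu2 p (c (true, j)).
  move=> /negPf jp; have -> : (true, wo j) = nu2 p (true, j) by rewrite /nu2 xpair_eqE jp.
  exact: (extd_nu _ (@nu2_inj p)).
apply/inDP; split=> [|j|j]; first by rewrite (extd_diagramE (@nu2_inj p)).
  case: (woP j) => [|i]; rewrite ?wo_val /=; first by have := ltn_ord p; lia.
  move=> ip; rewrite E; last by rewrite -val_eqE /= neq_ltn ip.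
  rewrite /nu2; case: eqP => // _; by rewrite /= H1 // ltnS ltnW.
case: (woP j) => [|i] pj; first by rewrite extd_compl // nu2_compl eqxx.
case: (eqVneq i p) => [->|ip]; first by rewrite extd_compl // nu2_compl eqxx orbT.
rewrite E // H2; last by rewrite ltn_neqAle eq_sym -val_eqE /= in ip *; move: pj; rewrite wo_val; lia.
by rewrite nE // xpair_eqE.
Qed.

Lemma iota0P k d : (k <= m)%N -> inD k d -> d (false, ord_max) = (false, ord_max) ->
  exists2 c, inD k c & d = iota0 c.
Proof.
move=> km dk dmax; have /inDP[dD H1 H2] := dk.
have E : iota0 (contr nu0 d) = d.
  apply: (contrK nu0_inj) => //; move=> [[] i]; rewrite nu0_compl /= => /eqP -> //.
  by rewrite H2.
by exists (contr nu0 d); rewrite // -(inD_iota0 _ km) E.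
Qed.

Lemma iota1P p d : inD p.+1 d -> d (false, ord_max) = (true, wo p) ->
  exists2 c, inD p c & d = iota1 p c.
Proof.
move=> dk dmax; have /inDP[dD H1 H2] := dk.
have E : iota1 p (contr (nu1 p) d) = d.
  apply: (contrK (@nu1_inj p) (@swap1_compl p)) => // u.
  rewrite nu1_compl => /orP[] /eqP ->; rewrite /swap1 eqxx //=.
  by rewrite -dmax (diagramP _ dD).
exists (contr (nu1 p) d) => //; rewrite -inD_iota1 ?E //.
  by rewrite -(extd_diagramE (@nu1_inj p) (swap1K p) (@swap1_compl p)) -/(iota1 p) E.
move=> j pj; apply: (@nu1_inj p); rewrite -(extd_nu (swap1 p) (@nu1_inj p)) -/(iota1 p _) E /nu1.
rewrite xpair_eqE /=; case: eqP => [_|jp]; first by rewrite H2.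
by rewrite H2 // (wo_val (true, j).2) /= ltn_neqAle pj andbT; apply/eqP=> /val_inj /esym.
Qed.

Lemma iota2P p d i : inD p d -> d (false, ord_max) = (false, wo i) ->
  exists2 c, inD p.+1 c & d = iota2 p c.
Proof.
move=> dk dmax; have /inDP[dD H1 H2] := dk.
have E : iota2 p (contr (nu2 p) d) = d.
  apply: (contrK (@nu2_inj p) (s := id)) => // u.
  by rewrite nu2_compl => /orP[] /eqP ->; rewrite H2 ?wo_val //= ltnW.
exists (contr (nu2 p) d) => //; set c := contr _ _ in E *.
have nu2E v : nu2 p (c v) = d (nu2 p v) by rewrite -[in RHS]E (extd_nu _ (@nu2_inj p)).
apply/inDP; split=> [|j|j].
- by rewrite -(extd_diagramE (s := id) (@nu2_inj p)) // -/(iota2 p) E.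
- rewrite ltnS leq_eqVlt => /orP[/eqP jp|jp].
    rewrite (val_inj jp); have := nu2E (true, p); rewrite /nu2 eqxx dmax.
    case: eqP => [_ /(congr1 snd) /= E1|_ /(congr1 fst) //].
    by have := wo_neq i; rewrite -E1 eqxx.
  have := nu2E (true, j); rewrite {2}/nu2 xpair_eqE -val_eqE (ltn_eqF jp) /= => E1.
  have r1 : (d (true, wo j)).1 = false by apply: H1; rewrite wo_val.
  rewrite -E1 /nu2 in r1; move: r1; case: eqP => // Ej.
  case: (c (true, j)) Ej E1 => a b' [-> ->] E1 _.
  move: E1; rewrite /nu2 eqxx => E1; have := diagramP _ dD (true, wo j).
  by rewrite -[d (true, wo j)]E1 dmax.
move=> pj; apply: (@nu2_inj p); rewrite nu2E {1 2}/nu2 xpair_eqE -val_eqE (gtn_eqF pj) /=.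
by rewrite H2 // (wo_val (true, j).2) ltnW.
Qed.

(** Stability of the submodule: [eps b] passes n straight through, so n stays isolated or joined to
    the same bottom vertex, and no horizontal arc at n arises. *)
Lemma Gp_not_iota2 p b d c' : is_diagram b -> inD p d ->
  (forall i, d (false, ord_max) <> (false, wo i)) -> inD p.+1 c' ->
  Gp (@eps m.+1 b) d <> iota2 p c'.
Proof.
move=> bD dk dmax /inDP[_ H1 _] E; have /inDP[dD _ _] := dk.
have eD := eps_diagram bD.
have : (Gp (@eps m.+1 b) d (false, ord_max)).1 = false /\
    (Gp (@eps m.+1 b) d (false, ord_max)) != (false, ord_max).
  rewrite E iota2_max; have := H1 p (ltnSn p); case: (c' (true, p)) => r i /= ->.
  by rewrite nu2_top xpair_eqE wo_neq.
case Em: (d (false, ord_max)) => [[] j] []; last first.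
  case: (woP j) Em => [Em|i /dmax //].
  have [|d0 d0k ->] := iota0P _ dk Em; first by rewrite ltnW.
  have /inDP[d0D _ _] := d0k.
  by rewrite Gp_iota0 // iota0_max eqxx.
suff -> : Gp (@eps m.+1 b) d (false, ord_max) = (true, j) by [].
apply: Gp_eq => //.
have := conn_lower (@eps m.+1 b) d (false, ord_max); rewrite Em.
by apply: connect_trans; have := conn_upper (@eps m.+1 b) d (false, ord_max); rewrite eps_max.
Qed.

Definition lperm (h : {perm 'I_m}) : {perm 'I_m.+1} := lift_perm ord_max ord_max h.

Lemma lperm_wo h j : lperm h (wo j) = wo (h j). Proof. exact: lift_perm_lift. Qed.
Lemma lperm_max h : lperm h ord_max = ord_max. Proof. exact: lift_perm_id. Qed.
Lemma botact_wv h (v : vtx m) : botact (lperm h) (wv v) = wv (botact h v).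
Proof. by case: v => [[] i]; rewrite /botact /wv //= lperm_wo. Qed.
Lemma botact_max h r : botact (lperm h) (r, ord_max) = (r, ord_max).
Proof. by case: r; rewrite /botact //= lperm_max. Qed.
Lemma botact_eq (h : {perm 'I_m}) p v : h p = p -> (botact h v == (true, p)) = (v == (true, p)).
Proof.
by move=> hp; rewrite -[(true, p)](_ : botact h (true, p) = _) ?(inj_eq (can_inj (botactK h))) /botact /= ?hp.
Qed.

Lemma rmul_iota0 h c : rmul (iota0 c) (lperm h) = iota0 (rmul c h).
Proof. by apply: (rmul_extd nu0_inj) => v; rewrite // botact_wv. Qed.

Lemma rmul_iota1 p (h : {perm 'I_m}) c : h p = p -> rmul (iota1 p c) (lperm h) = iota1 p (rmul c h).
Proof.
move=> hp; apply: (rmul_extd (@nu1_inj p)) => [v|u].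
  rewrite /nu1 botact_eq //; case: eqP => _; by rewrite ?botact_max ?botact_wv.
have bp : botact (lperm h) (true, wo p) = (true, wo p).
  by rewrite -[(true, wo p)]/(wv (true, p)) botact_wv /botact /= hp.
by rewrite nu1_compl => /orP[] /eqP ->; rewrite ?bp ?botact_max /swap1 /= !eqxx ?botact_max ?bp.
Qed.

Lemma rmul_iota2 p (h : {perm 'I_m}) c : h p = p -> rmul (iota2 p c) (lperm h) = iota2 p (rmul c h).
Proof.
move=> hp; apply: (rmul_extd (@nu2_inj p)) => [v|u] //.
rewrite /nu2 botact_eq //; case: eqP => _; by rewrite ?botact_max ?botact_wv.
Qed.

End Iota.

Local Open Scope ring_scope.

(** * Cell modules as subquotients *)

Lemma span_ind (F : fieldType) (V : vectType F) (X : seq V) (P : V -> Prop) :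
  P 0 -> (forall a u v, P u -> P v -> P (a *: u + v)) -> (forall u, u \in X -> P u) ->
  forall u, u \in <<X>>%VS -> P u.
Proof.
move=> P0 PD PX u; rewrite -(in_tupleE X) => /coord_span ->.
apply: (big_ind P) => // [u' v' Pu Pv|i _].
  by rewrite -[u']scale1r; apply: PD.
by rewrite -[_ *: _]addr0; apply: PD => //; apply/PX/mem_nth.
Qed.

Section CellModules.
Variables (F : fieldType) (x : F) (m : nat).
Hypotheses (char0 : [pchar F] =i pred0) (x0 : x != 0).
Implicit Types (v : Alg F m) (w : MF F m) (z : Amb F m) (a b c d : rawd m) (al : Ptn m).

Lemma dbasis_expand v : v = \sum_d v d *: dbasis F d.
Proof.
apply/ffunP=> d; rewrite sum_ffunE (bigD1 d) //= big1 ?addr0 => [|c cd].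
  by rewrite !ffunE eqxx [_ *: _]mulr1.
by rewrite !ffunE eq_sym (negPf cd) scaler0.
Qed.

Lemma tens_is_linear v : linear (tens v : MF F m -> Amb F m).
Proof.
move=> a w w'; apply/ffunP=> p; rewrite !ffunE mulrDr; congr (_ + _).
exact: mulrCA.
Qed.
HB.instance Definition _ v :=
  GRing.isLinear.Build F (MF F m) (Amb F m) _ (tens v) (tens_is_linear v).

Lemma tensDl v v' w : tens (v + v') w = tens v w + tens v' w.
Proof. by apply/ffunP=> p; rewrite !ffunE mulrDl. Qed.
Lemma tensZl (k : F) v w : tens (k *: v) w = k *: tens v w.
Proof. by apply/ffunP=> p; rewrite !ffunE; apply/esym/mulrA. Qed.
Lemma tens0l w : tens 0 w = 0.
Proof. by apply/ffunP=> p; rewrite !ffunE mul0r. Qed.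
Lemma tens_suml (I : Type) (r : seq I) (P : pred I) (f : I -> Alg F m) w :
  tens (\sum_(i <- r | P i) f i) w = \sum_(i <- r | P i) tens (f i) w.
Proof.
by apply: (big_morph (fun v => tens v w)) => [u v|]; rewrite ?tensDl ?tens0l.
Qed.

Definition elem d : {linear MF F m -> Amb F m} := tens (dbasis F d).

Definition slice d z : MF F m := [ffun r => z (d, r)].
Lemma slice_is_linear d : linear (slice d).
Proof. by move=> a z z'; apply/ffunP=> r; rewrite !ffunE. Qed.
HB.instance Definition _ d :=
  GRing.isLinear.Build F (Amb F m) (MF F m) _ (slice d) (slice_is_linear d).

Lemma slice_tens d v w : slice d (tens v w) = v d *: w.
Proof. by apply/ffunP=> r; rewrite !ffunE. Qed.
Lemma slice_elem d c w : slice d (elem c w) = if d == c then w else 0.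
Proof. by rewrite slice_tens ffunE; case: eqP; rewrite ?scale1r ?scale0r. Qed.

Lemma Amb_expand z : z = \sum_d elem d (slice d z).
Proof.
apply/ffunP=> -[d r]; rewrite sum_ffunE (bigD1 d) //= big1 ?addr0 => [|c cd].
  by rewrite !ffunE eqxx mul1r.
by rewrite !ffunE /= eq_sym (negPf cd) mul0r.
Qed.

Lemma prodIE k b c : prodI x k b c =
  if nvert (Gp b c) == k then x ^+ ell b c *: dbasis F (Gp b c) else 0.
Proof.
apply/ffunP=> d; rewrite ffunE; case: (eqVneq d (Gp b c)) => [->|dG] /=.
  by case: ifP => _; rewrite !ffunE // eqxx [_ *: _]mulr1.
by case: ifP => _; rewrite !ffunE // (negPf dG) scaler0.
Qed.

Lemma mulI_dbasis k v c : is_diagram c ->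
  mulI x k v (dbasis F c) = \sum_(a | is_diagram a) v a *: prodI x k a c.
Proof.
move=> cD; apply: eq_bigr => a _; rewrite (bigD1 c) //= big1 ?addr0 => [|c' /andP[_ ne]].
  by rewrite ffunE eqxx mulr1.
by rewrite ffunE (negPf ne) mulr0 scale0r.
Qed.

(** Multiplying such a [d] by [uD] returns [d] with a power of [x], one factor for each closed
    component in the middle. As [x] is nonzero the power can be divided out. *)
Lemma memIu k v : (k <= m)%N ->
  reflect (forall d, ~~ inD k d -> v d = 0) (v \in Iu_space x m k).
Proof.
move=> km; have uD' := uD_diagram m k.
have gen a : is_diagram a ->
    mulI x k (dbasis F a) (dbasis F (uD m k)) = prodI x k a (uD m k).
  move=> aD; rewrite mulI_dbasis // (bigD1 a) //= ffunE eqxx scale1r big1 ?addr0 // => c /andP[_ ca].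
  by rewrite ffunE (negPf ca) scale0r.
apply: (iffP idP) => [|H].
  move: v; apply: span_ind => [d _|a u v Hu Hv d dN|u]; rewrite ?ffunE ?Hu ?Hv ?scaler0 ?addr0 //.
  case/mapP=> a; rewrite mem_filter => /andP[/andP[aD _] _] -> d dN.
  rewrite gen // ffunE; case: eqP => //= dE; case: eqP => //= nk.
  by rewrite dE inD_Gp_uD -?dE in dN.
rewrite (dbasis_expand v); apply: rpred_sum => d _.
case: (boolP (inD k d)) => dk; last by rewrite H // scale0r rpred0.
have /inDP[dD _ H2] := dk.
have dE : dbasis F d = x ^- ell d (uD m k) *:
    mulI x k (dbasis F d) (dbasis F (uD m k)).
  rewrite gen // prodIE Gp_uD // -inD_nvert // dk scalerA mulVf ?scale1r //.
  by rewrite expf_neq0.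
rewrite dE !rpredZ // memv_span //; apply/mapP; exists d => //.
by rewrite mem_filter dD mem_enum -inD_nvert // dk.
Qed.

Lemma dbasis_Iu k d : (k <= m)%N -> inD k d -> dbasis F d \in Iu_space x m k.
Proof.
move=> km dk; apply/memIu => // c cN; rewrite ffunE; case: eqP => // E.
by rewrite E dk in cN.
Qed.

Lemma tens_modU al v w : v \in Iu_space x m (psize al) -> w \in specht F al ->
  tens v w \in modU x al.
Proof.
move=> vI wS; rewrite (coord_vbasis vI) tens_suml; apply: rpred_sum => i _.
rewrite tensZl rpredZ // (coord_vbasis wS) raddf_sum; apply: rpred_sum => j _ /=.
rewrite linearZ rpredZ // memv_span //=.
by apply/allpairsP; exists ((vbasis (Iu_space x m (psize al)))`_i, (vbasis (specht F al))`_j);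
  rewrite !mem_nth ?size_tuple.
Qed.

Lemma memU al z : (psize al <= m)%N ->
  reflect ((forall d, slice d z \in specht F al) /\
           (forall d, ~~ inD (psize al) d -> slice d z = 0)) (z \in modU x al).
Proof.
move=> km; apply: (iffP idP) => [|[H1 H2]].
  move: z; apply: span_ind => [|a u v [Hu1 Hu2] [Hv1 Hv2]|u].
  - by split=> d; rewrite raddf0 ?mem0v.
  - split=> d; first by rewrite linearP /= rpredD ?rpredZ.
    by move=> dN; rewrite linearP /= Hu2 // Hv2 // scaler0 addr0.
  case/allpairsP=> -[v w] /= [/vbasis_mem vI /vbasis_mem wS ->].
  split=> d; rewrite slice_tens; first exact: rpredZ.
  by move=> dN; rewrite (memIu _ km vI) ?scale0r.
rewrite (Amb_expand z); apply: rpred_sum => d _.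
case: (boolP (inD (psize al) d)) => dk; last by rewrite H2 // raddf0 mem0v.
by apply: tens_modU; rewrite ?dbasis_Iu.
Qed.

Lemma elem_modU al d w : (psize al <= m)%N -> inD (psize al) d -> w \in specht F al ->
  elem d w \in modU x al.
Proof. by move=> km dk wS; rewrite tens_modU ?dbasis_Iu. Qed.

Lemma mulI_perm k v g : (k <= m)%N -> v \in Iu_space x m k -> in_Sk k g ->
  mulI x k v (dbasis F (permD g)) = [ffun e => v (rmul e (g^-1)%g)].
Proof.
move=> km /(memIu _ km) vI gS; rewrite mulI_dbasis ?permD_diagram //.
apply/ffunP=> e; rewrite sum_ffunE [RHS]ffunE.
have rE a : (e == rmul a g) = (a == rmul e (g^-1)%g).
  by rewrite -(can2_eq (rmulK g) (rmulK' g)) eq_sym.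
case: (boolP (is_diagram (rmul e (g^-1)%g))) => eD; last first.
  rewrite vI; last by apply: contra eD => /inDP[].
  rewrite big1 // => a aD; rewrite !ffunE Gp_permD // rE; case: eqP => [E|_]; last by rewrite scaler0.
  by rewrite -E aD in eD.
rewrite (bigD1 (rmul e (g^-1)%g)) //= big1 ?addr0 => [|a /andP[aD ae]]; last first.
  by rewrite !ffunE Gp_permD // rE (negPf ae) scaler0.
rewrite !ffunE Gp_permD // rE eqxx /= ell_permD // expr0.
case: (boolP (inD k (rmul e (g^-1)%g))) => ek; last by rewrite vI // scale0r.
have ek' : inD k e by rewrite -(rmulK' g e) inD_rmul.
have /inDP[eD' _ H2] := ek'.
by rewrite -inD_nvert // ek' [_ *: _]mulr1.
Qed.

(** The component at [d] of the norm map from coinvariants to invariants of S_k, which acts on the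
    diagrams and the Specht factor at once. *)
Definition coinv k z d : MF F m := \sum_(h | in_Sk k h) gact h (slice (rmul d h) z).

Definition coinvs k z : {ffun rawd m -> MF F m} := [ffun d => coinv k z d].
Lemma coinvs_is_linear k : linear (coinvs k).
Proof.
move=> a u v; apply/ffunP=> d; rewrite !ffunE /coinv scaler_sumr -big_split /=.
by apply: eq_bigr => h _; rewrite !linearP.
Qed.
HB.instance Definition _ k :=
  GRing.isLinear.Build F (Amb F m) {ffun rawd m -> MF F m} _ (coinvs k) (coinvs_is_linear k).

(** Hence vanishing at one diagram of an orbit of the right action implies vanishing on the whole
    orbit. *)
Lemma coinv_rmul k z d g : in_Sk k g -> coinv k z d = gact g (coinv k z (rmul d g)).
Proof.
move=> gS; rewrite /coinv raddf_sum /= (reindex_inj (mulIg g)) /=.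
apply: eq_big => h; last by move=> _; rewrite gactM rmulM.
apply/idP/idP => hS; last exact: in_SkM.
by rewrite -(mulgK g h) in_SkM ?in_SkV.
Qed.

Lemma coinv_specht al z d : (psize al <= m)%N -> z \in modU x al ->
  coinv (psize al) z d \in specht F al.
Proof.
move=> km /(memU _ km)[H _]; apply: rpred_sum => h hS; exact: gact_specht.
Qed.

(** [modR] lists relations between basis vectors only; bilinearity gives the others. *)
Lemma rel_modR al v w g : v \in Iu_space x m (psize al) -> w \in specht F al ->
  in_Sk (psize al) g ->
  tens (mulI x (psize al) v (dbasis F (permD g))) w - tens v (gact g w) \in modR x al.
Proof.
move=> vI wS gS; have gD := permD_diagram g.
have mulI_suml (I : finType) (f : I -> F) (u : I -> Alg F m) :
    mulI x (psize al) (\sum_i f i *: u i) (dbasis F (permD g)) =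
    \sum_i f i *: mulI x (psize al) (u i) (dbasis F (permD g)).
  under [RHS]eq_bigr => i _ do rewrite mulI_dbasis // scaler_sumr.
  rewrite mulI_dbasis // exchange_big; apply: eq_bigr => a _ /=.
  rewrite sum_ffunE scaler_suml; apply: eq_bigr => i _.
  by rewrite ffunE scalerA.
rewrite (coord_vbasis vI) mulI_suml !tens_suml -sumrB; apply: rpred_sum => i _.
rewrite !tensZl -scalerBr rpredZ // (coord_vbasis wS) [X in X - _]raddf_sum [gact g _]raddf_sum [X in _ - X]raddf_sum -sumrB /=.
apply: rpred_sum => j _.
have tensZr u (a : F) w1 : tens u (a *: w1) = a *: tens u w1 by rewrite linearZ.
rewrite [gact g (_ *: _)]linearZ /= !tensZr -scalerBr rpredZ //.
set v' := _`_i; set w' := _`_j.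
have v'in : v' \in vbasis (Iu_space x m (psize al)) by rewrite mem_nth ?size_tuple.
have w'in : w' \in vbasis (specht F al) by rewrite mem_nth ?size_tuple.
rewrite /modR (big_rem _ v'in) /=; apply: (subvP (addvSl _ _)).
rewrite (bigD1 g) //=; apply: (subvP (addvSl _ _)).
rewrite (big_rem _ w'in) /=; apply: (subvP (addvSl _ _)).
exact: memv_line.
Qed.

Lemma elem_rel al d w g : (psize al <= m)%N -> inD (psize al) d -> w \in specht F al ->
  in_Sk (psize al) g -> elem (rmul d g) w - elem d (gact g w) \in modR x al.
Proof.
move=> km dk wS gS; have dI := dbasis_Iu km dk.
have := rel_modR dI wS gS; rewrite mulI_perm //.
have -> : [ffun e => dbasis F d (rmul e (g^-1)%g)] = dbasis F (rmul d g) => [|//].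
by apply/ffunP=> e; rewrite !ffunE (can2_eq (rmulK' g) (rmulK g)).
Qed.

Lemma modR_sub al : (psize al <= m)%N ->
  (modR x al <= modU x al :&: lker (linfun (coinvs (psize al))))%VS.
Proof.
move=> km; set k := psize al in km *; set V := (_ :&: _)%VS.
have sum_sub (I : Type) (r : seq I) (P : pred I) (f : I -> {vspace Amb F m}) :
    (forall i, P i -> (f i <= V)%VS) -> (\sum_(i <- r | P i) f i <= V)%VS.
  move=> H; apply: (big_ind (fun U => (U <= V)%VS)); [exact: sub0v | | exact: H].
  by move=> U W UV WV; rewrite subv_add UV.
rewrite /modR big_seq; apply: (sum_sub) => v /vbasis_mem vI.
apply: (sum_sub) => g gS; rewrite big_seq; apply: (sum_sub) => w /vbasis_mem wS.
rewrite -memvE memv_cap; apply/andP; split.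
  rewrite rpredB ?tens_modU ?gact_specht // mulI_perm //.
  apply/memIu => // d dN; rewrite ffunE; apply: (memIu _ km vI).
  by apply: contra dN => /(inD_rmul gS); rewrite rmulK'.
rewrite memv_ker lfunE /= mulI_perm //; apply/eqP/ffunP=> d; rewrite !ffunE /coinv.
under eq_bigr => h _ do rewrite raddfB /= !slice_tens ffunE rmulM.
have gactZ h (a : F) u : gact h (a *: u) = a *: gact h u by rewrite linearZ.
under eq_bigr => h _ do rewrite raddfB /= !gactZ gactM.
rewrite sumrB (reindex_inj (mulgI g)) /=.
under eq_bigr => h _ do rewrite mulKg.
apply/eqP; rewrite subr_eq0; apply/eqP; apply: eq_bigl => h.
apply/idP/idP => hS; last exact: in_SkM.
by rewrite -(mulKg g h) in_SkM ?in_SkV.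
Qed.

(** Relations have zero norm by reindexing the sum over the group. Conversely, the order of S_k
    times [z] differs from the norm by elementary relations, and in characteristic 0 that order can
    be divided out. *)
Lemma memR al z : (psize al <= m)%N ->
  reflect (z \in modU x al /\ forall d, coinv (psize al) z d = 0) (z \in modR x al).
Proof.
move=> km; set k := psize al in km *; apply: (iffP idP) => [zR|[zU z0]].
  have := subvP (modR_sub km) _ zR; rewrite memv_cap memv_ker lfunE => /andP[zU /eqP E].
  by split=> // d; move/ffunP/(_ d): E; rewrite !ffunE.
have [H1 H2] := memU _ km zU.
pose nS := #|[pred h : {perm 'I_m} | in_Sk k h]|.
have nS0 : (nS%:R : F) != 0.
  rewrite natF_eq0 // -lt0n; apply/card_gt0P; exists 1%g.
  by rewrite inE in_Sk1.
have : nS%:R *: z \in modR x al; last by rewrite rpredZeq (negPf nS0).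
(* For each [h] the first terms add up to [z]; the second terms, summed over [h], are the components
   of the norm and vanish. *)
have -> : nS%:R *: z = \sum_(h | in_Sk k h) \sum_d
    (elem (rmul d h) (slice (rmul d h) z) - elem d (gact h (slice (rmul d h) z))).
  under eq_bigr => h _ do rewrite sumrB.
  rewrite sumrB [X in _ - X]exchange_big /= [X in _ - X]big1 => [|d _]; last first.
    by rewrite -raddf_sum -/(coinv k z d) z0 raddf0.
  rewrite subr0 (eq_bigr (fun=> z)) ?sumr_const ?scaler_nat // => h _.
  by rewrite [RHS]Amb_expand [RHS](reindex_inj (can_inj (rmulK h))).
apply: rpred_sum => h hS; apply: rpred_sum => d _.
case: (boolP (inD k d)) => dk; last first.
  have -> : slice (rmul d h) z = 0.
    apply: H2; apply: contra dk => dhk.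
    by rewrite -(rmulK h d) inD_rmul ?in_SkV.
  by rewrite !raddf0 ?subr0 ?addr0 mem0v.
by apply: elem_rel.
Qed.

Lemma modact_is_linear k b : linear (@modact F x m k b).
Proof.
move=> a u v; apply/ffunP=> p; rewrite !ffunE scaler_sumr -big_split /=.
by apply: eq_bigr => c _; rewrite !ffunE mulrDl [_ *: (_ * _)]mulrA.
Qed.
HB.instance Definition _ k b :=
  GRing.isLinear.Build F (Amb F m) (Amb F m) _ (@modact F x m k b) (modact_is_linear k b).

Lemma modact_elem k b d w : (k <= m)%N -> is_diagram b -> inD k d ->
  modact x k b (elem d w) = if inD k (Gp b d) then x ^+ ell b d *: elem (Gp b d) w else 0.
Proof.
move=> km bD dk; have /inDP[dD _ _] := dk.
have -> : modact x k b (elem d w) = tens (prodI x k b d) w.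
  apply/ffunP=> p; rewrite [LHS]ffunE (bigD1 d) //= big1 ?addr0 => [|c /andP[_ cd]].
    by rewrite !ffunE /= eqxx mul1r mulrC.
  by rewrite !ffunE /= (negPf cd) !mul0r.
rewrite prodIE -inD_Gp //; case: ifP => _; last by rewrite tens0l.
by rewrite tensZl.
Qed.

End CellModules.

(** * Permutations fixing the last point, and coset sums *)

Section LiftPerm.
Variable m : nat.
Implicit Types (h : {perm 'I_m}) (g : {perm 'I_m.+1}).

Lemma lperm_inj : injective (@lperm m).
Proof.
move=> h h' E; apply/permP=> j; apply: wo_inj.
by rewrite -!lperm_wo E.
Qed.

Lemma lperm_ex g : g ord_max = ord_max -> exists h, g = lperm h.
Proof.
move=> gm.
pose h0 j := odflt j (unlift ord_max (g (wo j))).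
have h0E j : wo (h0 j) = g (wo j).
  rewrite /h0; case: unliftP => [i -> //|E].
  by have := wo_neq j; rewrite -(inj_eq (@perm_inj _ g)) gm E eqxx.
have h0i : injective h0.
  move=> i j E; apply: wo_inj; apply: (@perm_inj _ g).
  by rewrite -!h0E E.
exists (perm h0i); apply/permP=> i; case: (woP i) => [|j]; first by rewrite lperm_max.
by rewrite lperm_wo permE h0E.
Qed.

Lemma in_Sk_lperm k h : (k <= m)%N -> in_Sk k (lperm h) = in_Sk k h.
Proof.
move=> km; apply/in_SkP/in_SkP => H j kj.
  by apply: wo_inj; rewrite -lperm_wo H // wo_val.
case: (woP j) kj => [_|i]; first exact: lperm_max.
by rewrite wo_val lperm_wo => /H ->.
Qed.

Lemma sum_lperm (V : nmodType) (P : pred {perm 'I_m.+1}) (f : {perm 'I_m.+1} -> V) :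
  (forall g, P g -> g ord_max = ord_max) ->
  \sum_(g | P g) f g = \sum_(h | P (lperm h)) f (lperm h).
Proof.
move=> H; pose low g := odflt 1%g [pick h | lperm h == g].
have lowK g : P g -> lperm (low g) = g.
  move=> /H /lperm_ex[h ->]; rewrite /low; case: pickP => [h' /eqP //|/(_ h)].
  by rewrite eqxx.
rewrite (reindex_onto _ low lowK); apply: eq_bigl => h.
apply: andb_idr => /lowK/lperm_inj -> //.
Qed.

Lemma sum_Sk (V : nmodType) k (f : {perm 'I_m.+1} -> V) : (k <= m)%N ->
  \sum_(g | in_Sk k g) f g = \sum_(h : {perm 'I_m} | in_Sk k h) f (lperm h).
Proof.
move=> km; rewrite sum_lperm => [|g /in_SkP -> //].
by apply: eq_bigl => h; rewrite in_Sk_lperm.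
Qed.

Lemma lperm_tperm (i j : 'I_m) : lperm (tperm i j) = tperm (wo i) (wo j).
Proof.
apply/permP=> l; case: (woP l) => [|l'].
  by rewrite lperm_max tpermD // wo_neq.
by rewrite lperm_wo inj_tperm //; apply: wo_inj.
Qed.

End LiftPerm.

Section Cosets.
Variables (N : nat) (o : 'I_N).

(** The coset of [h] is determined by the image [j] of [o], and the transposition of [j] and [o]
    represents it. *)
Lemma sum_SkS (V : nmodType) (f : {perm 'I_N} -> V) :
  \sum_(h | in_Sk o.+1 h) f h =
  \sum_(j : 'I_N | (j <= o)%N) \sum_(g | in_Sk o g) f (g * tperm j o)%g.
Proof.
rewrite (partition_big (fun h : {perm 'I_N} => h o) (fun j : 'I_N => (j <= o)%N)) /=; last first.
  by move=> h hS; rewrite -ltnS (in_Sk_lt _ hS).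
apply: eq_bigr => j jo; rewrite (reindex_inj (mulIg (tperm j o))) /=.
apply: eq_bigl => g; rewrite permM; apply/andP/idP => [[gS /eqP gE]|gS].
  have go : g o = o by apply: (@perm_inj _ (tperm j o)); rewrite gE tpermR.
  have gS' : in_Sk o.+1 g.
    by rewrite -(mulgK (tperm j o) g) in_SkM // in_SkV tperm_Sk.
  apply/in_SkP=> i; rewrite leq_eqVlt => /orP[/eqP/val_inj <- //|oi].
  exact: (in_SkP _ _ gS').
have gS' : in_Sk o.+1 g by apply/in_SkP=> i /ltnW oi; exact: (in_SkP _ _ gS).
by rewrite in_SkM ?tperm_Sk // (in_SkP _ _ gS) // tpermR.
Qed.

End Cosets.

(** * Specht modules on m and on m + 1 entries *)

Section Transfer.
Variables (F : fieldType) (m : nat).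
Implicit Types (al : Ptn m) (r : Tab m) (t : Tbl m) (w : MF F m).

Definition ext_ord (A B : Type) (b0 : B) (f : A -> B) (r : {ffun 'I_m -> A}) : {ffun 'I_m.+1 -> B} :=
  [ffun j => if unlift ord_max j is Some i then f (r i) else b0].

Lemma ext_wo (A B : Type) (b0 : B) (f : A -> B) (r : {ffun 'I_m -> A}) i : ext_ord b0 f r (wo i) = f (r i).
Proof. by rewrite ffunE liftK. Qed.
Lemma ext_max (A B : Type) (b0 : B) (f : A -> B) (r : {ffun 'I_m -> A}) : ext_ord b0 f r ord_max = b0.
Proof. by rewrite ffunE unlift_none. Qed.

Definition ext (r : Tab m) : Tab m.+1 := ext_ord ord0 (@wo _) r.
Definition liftt (t : Tbl m) : Tbl m.+1 := ext_ord (ord0, ord0) (fun b => (wo b.1, wo b.2)) t.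

Lemma liftt1 t i : (liftt t (wo i)).1 = wo (t i).1.
Proof. by rewrite /liftt ext_wo. Qed.
Lemma liftt2 t i : (liftt t (wo i)).2 = wo (t i).2.
Proof. by rewrite /liftt ext_wo. Qed.

Lemma ext_inj : injective ext.
Proof.
by move=> r r' E; apply/ffunP=> j; apply: wo_inj; rewrite -!(ext_wo ord0 (@wo _)) -!/(ext _) E.
Qed.

Lemma ext_act r (h : {perm 'I_m}) :
  ext [ffun j => r (h j)] = [ffun j => ext r (lperm h j)].
Proof.
apply/ffunP=> j; rewrite [RHS]ffunE; case: (woP j) => [|i]; first by rewrite lperm_max !ext_max.
by rewrite lperm_wo !ext_wo ffunE.
Qed.

(** Shapes of the two algebras live in different types. [trans] adds the entry n as padding, in row
    0; [restr] is a left inverse, and a two-sided one on the Specht modules of [al] and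
    [liftp al]. *)
Definition trans w : MF F m.+1 := \sum_r w r *: tdelta F (ext r).
Definition restr (w : MF F m.+1) : MF F m := [ffun r => w (ext r)].

Lemma trans_is_linear : linear trans.
Proof.
move=> a w w'; rewrite /trans scaler_sumr -big_split; apply: eq_bigr => r _ /=.
by rewrite !ffunE scalerDl scalerA.
Qed.
HB.instance Definition _ := GRing.isLinear.Build F (MF F m) (MF F m.+1) _ trans trans_is_linear.
Lemma restr_is_linear : linear restr.
Proof. by move=> a w w'; apply/ffunP=> r; rewrite !ffunE. Qed.
HB.instance Definition _ := GRing.isLinear.Build F (MF F m.+1) (MF F m) _ restr restr_is_linear.

Lemma transK : cancel trans restr.
Proof.
move=> w; apply/ffunP=> r; rewrite ffunE sum_ffunE (bigD1 r) //= big1 ?addr0 => [|r' ne].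
  by rewrite !ffunE eqxx [_ *: _]mulr1.
by rewrite !ffunE (inj_eq ext_inj) eq_sym (negPf ne) scaler0.
Qed.

Lemma trans_tdelta r : trans (tdelta F r) = tdelta F (ext r).
Proof.
rewrite /trans (bigD1 r) //= big1 ?addr0 => [|r' ne].
  by rewrite ffunE eqxx scale1r.
by rewrite ffunE (negPf ne) scale0r.
Qed.

Lemma restr_gact (h : {perm 'I_m}) (w : MF F m.+1) : restr (gact (lperm h) w) = gact h (restr w).
Proof. by apply/ffunP=> r; rewrite !ffunE ext_act. Qed.

Lemma trans_gact (h : {perm 'I_m}) w : trans (gact h w) = gact (lperm h) (trans w).
Proof.
rewrite [w]MF_expand [gact h _]raddf_sum [LHS]raddf_sum [X in gact _ X]raddf_sum [RHS]raddf_sum.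
apply: eq_bigr => r _ /=; have gactZ n (g : {perm 'I_n}) (a : F) (u : MF F n) :
  gact g (a *: u) = a *: gact g u by rewrite linearZ.
have transZ (a : F) u : trans (a *: u) = a *: trans u by rewrite linearZ.
rewrite !(gactZ, transZ) gact_tdelta !trans_tdelta gact_tdelta; congr (_ *: tdelta F _).
by rewrite ext_act /lperm -lift_permV.
Qed.

Definition liftp al : Ptn m.+1 :=
  [ffun i => if unlift ord_max i is Some i' then wo (al i') else ord0].

Lemma liftp_wo al i : liftp al (wo i) = wo (al i).
Proof. by rewrite ffunE liftK. Qed.
Lemma liftp_max al : liftp al ord_max = ord0.
Proof. by rewrite ffunE unlift_none. Qed.

Lemma liftp_inj : injective liftp.
Proof.
by move=> al be E; apply/ffunP=> i; apply: wo_inj; rewrite -!liftp_wo E.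
Qed.

Lemma sum_wo n (f : 'I_n.+1 -> nat) : (\sum_i f i = \sum_(i < n) f (wo i) + f ord_max)%N.
Proof.
rewrite big_ord_recr /=; congr (_ + _)%N; apply: eq_bigr => i _; congr f.
by apply: val_inj; apply/esym/wo_val.
Qed.

Lemma psize_liftp al : psize (liftp al) = psize al.
Proof.
rewrite /psize sum_wo liftp_max addn0; apply: eq_bigr => i _.
by rewrite liftp_wo wo_val.
Qed.

Lemma partition_liftp al : is_partition (liftp al) = is_partition al.
Proof.
apply/partitionP/partitionP => H i j.
  by move=> ij; have := H (wo i) (wo j); rewrite !liftp_wo !wo_val; apply.
case: (woP j) => [|j']; first by rewrite liftp_max.
case: (woP i) => [|i']; first by rewrite wo_val leqNgt ltn_ord.
by rewrite !liftp_wo !wo_val; apply: H.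
Qed.

Lemma liftt_tableau al t : (psize al <= m)%N -> is_tableau (liftp al) (liftt t) = is_tableau al t.
Proof.
move=> km; apply/tableauP/tableauP; rewrite psize_liftp => -[box inj]; split.
- by move=> j jk; have := box (wo j); rewrite liftt1 liftt2 liftp_wo !wo_val; apply.
- move=> i j ik jk E; apply: wo_inj; apply: inj; rewrite ?wo_val //.
  by rewrite /liftt !ext_wo E.
- move=> j; case: (woP j) => [|i]; first by rewrite ltnNge km.
  by rewrite liftt1 liftt2 liftp_wo !wo_val; apply: box.
move=> i j; case: (woP j) => [|j']; first by rewrite (ltnNge ord_max) km.
case: (woP i) => [|i']; first by rewrite (ltnNge ord_max) km.
rewrite !wo_val => ik jk E; congr wo; apply: inj => //.
have := congr1 fst E; rewrite !liftt1 => /wo_inj E1.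
have := congr1 snd E; rewrite !liftt2 => /wo_inj E2.
by rewrite [t i']surjective_pairing [t j']surjective_pairing E1 E2.
Qed.

Lemma ext_tabloid al t : (psize al <= m)%N ->
  ext (tabloid_of al t) = tabloid_of (liftp al) (liftt t).
Proof.
move=> km; apply/ffunP=> j; rewrite [RHS]ffunE psize_liftp.
case: (woP j) => [|i]; first by rewrite /ext ext_max ltnNge km.
rewrite liftt1 /ext ext_wo ffunE wo_val; case: ifP => // _.
by apply: val_inj; rewrite [LHS]wo_val.
Qed.

Lemma liftt_act t (h : {perm 'I_m}) : liftt (tblact h t) = tblact (lperm h) (liftt t).
Proof.
apply/ffunP=> j; rewrite [RHS]ffunE /lperm lift_permV -/(lperm _); case: (woP j) => [|i].
  by rewrite lperm_max /liftt !ext_max.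
by rewrite lperm_wo /liftt !ext_wo ffunE.
Qed.

Lemma colstab_lperm al t (h : {perm 'I_m}) : (psize al <= m)%N ->
  colstab (liftp al) (liftt t) (lperm h) = colstab al t h.
Proof.
move=> km; apply/colstabP/colstabP; rewrite psize_liftp in_Sk_lperm // => -[hS H]; split=> // j.
  case: (H (wo j)); rewrite ?wo_val; [|by right].
  by rewrite lperm_wo !liftt2 => /wo_inj ->; left.
case: (woP j) => [|i]; first by right.
rewrite lperm_wo !liftt2 wo_val; case: (H i) => [->|]; by [left | right].
Qed.

Lemma trans_polytab al t : (psize al <= m)%N ->
  trans (polytab F al t) = polytab F (liftp al) (liftt t).
Proof.
move=> km; rewrite /polytab raddf_sum [RHS]sum_lperm => [|g /colstab_Sk /in_SkP]; last first.
  by rewrite psize_liftp; apply.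
apply: eq_big => h; first by rewrite colstab_lperm.
move=> _; rewrite /= linearZ /= trans_tdelta /lperm odd_lift_perm addbb /=.
congr (_ *: tdelta F _); rewrite ext_tabloid //.
by have := liftt_act t h; rewrite /tblact => ->.
Qed.

Lemma trans_specht al w : (psize al <= m)%N -> w \in specht F al -> trans w \in specht F (liftp al).
Proof.
move=> km; suff /subvP S : (specht F al <= linfun trans @^-1: specht F (liftp al))%VS.
  by move=> /S; rewrite -memv_preim lfunE.
apply: specht_ind => t T.
by rewrite -memv_preim lfunE /= trans_polytab // polytab_specht // liftt_tableau.
Qed.

Lemma specht_trans al (u : MF F m.+1) : (psize al <= m)%N -> u \in specht F (liftp al) ->
  exists2 w, w \in specht F al & u = trans w.
Proof.
move=> km; suff /subvP S : (specht F (liftp al) <= linfun trans @: specht F al)%VS.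
  by move=> /S /memv_imgP[w wS ->]; exists w; rewrite // lfunE.
apply: specht_ind => t T; have /tableauP[box inj] := T; rewrite psize_liftp in box inj.
(* Boxes of [liftp al] have both coordinates at most [m], so [inord] truncates nothing on the
   entries that count. *)
pose t' : Tbl m := [ffun i => (inord (t (wo i)).1, inord (t (wo i)).2)].
have tE (j : 'I_m.+1) : (j < psize al)%N -> liftt t' j = t j.
  case: (woP j) => [|i]; first by rewrite ltnNge km.
  rewrite wo_val => ik; rewrite [LHS]surjective_pairing liftt1 liftt2 ffunE.
  have := box (wo i); rewrite wo_val => /(_ ik).
  case: (t (wo i)) => a b; cbn [fst snd]; case: (woP a) => [|a']; first by rewrite liftp_max.
  rewrite liftp_wo !wo_val => bl; congr (_, _); first by congr wo; apply: val_inj; rewrite /= inordK.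
  apply: val_inj; rewrite [LHS]wo_val inordK //.
  exact: (leq_trans bl (ltnW (ltn_ord (al a')))).
have TE : polytab F (liftp al) t = trans (polytab F al t').
  by rewrite trans_polytab //; apply: polytab_ext => j; rewrite psize_liftp => /tE.
rewrite TE -lfunE memv_img // polytab_specht // -liftt_tableau //.
by apply: (tableau_ext _ T) => j; rewrite psize_liftp => /tE.
Qed.

Lemma restr_specht al (u : MF F m.+1) : (psize al <= m)%N -> u \in specht F (liftp al) ->
  restr u \in specht F al /\ trans (restr u) = u.
Proof. by move=> km /(specht_trans km)[w wS ->]; rewrite transK. Qed.

End Transfer.

(** * Adding and removing boxes across the two types of shapes *)

Section Covers.
Variable m : nat.
Implicit Types (al be : Ptn m) (la : Ptn m.+1).

Lemma pv_ord N (mu : Ptn N) (i : 'I_N.+1) : pv mu i = mu i.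
Proof.
rewrite /pv; case: insubP => [j _ E|]; last by rewrite ltn_ord.
by congr (nat_of_ord (mu _)); apply: val_inj.
Qed.

Lemma pv_ge N (mu : Ptn N) i : (N < i)%N -> pv mu i = 0%N.
Proof. by move=> Ni; rewrite /pv insubN // -leqNgt. Qed.

Lemma pv_liftp al i : pv (liftp al) i = pv al i.
Proof.
case: (ltnP i m.+2) => i2; last by rewrite !pv_ge // ltnW.
rewrite -[i]/(nat_of_ord (Ordinal i2)) pv_ord; case: (woP (Ordinal i2)) => [|j].
  by rewrite liftp_max pv_ge.
by rewrite liftp_wo !wo_val pv_ord.
Qed.

Lemma same_ptnP al la : same_ptn al la = (liftp al == la).
Proof.
have mE : (maxn m m.+1).+1 = m.+2 by rewrite (maxn_idPr (leqnSn m)).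
apply/forallP/eqP => [H|<- j]; last by rewrite pv_liftp.
apply/ffunP=> i; apply: val_inj; rewrite /= -!pv_ord pv_liftp.
by have := H (cast_ord (esym mE) i) => /eqP.
Qed.

Lemma covP al la : cov (liftp al) la <->
  exists2 r : 'I_m.+2, pv la r = (pv al r).+1 & forall i : 'I_m.+2, i != r -> pv la i = pv al i.
Proof.
split=> [/existsP[r /addsP H]|[r E H]].
  exists r => [|i /negPf ir]; rewrite -pv_liftp !pv_ord H ?eqxx ?addn1 //.
  by rewrite ir addn0.
apply/existsP; exists r; apply/addsP=> i; rewrite -!pv_ord pv_liftp.
by case: (eqVneq i r) => [->|ir]; rewrite ?E ?addn1 // H // addn0.
Qed.

Lemma box_removed_down al la : box_removed al la = cov (liftp al) la.
Proof.
have mE : (maxn m m.+1).+1 = m.+2 by rewrite (maxn_idPr (leqnSn m)).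
apply/existsP/idP => [[r /andP[/eqP E /forallP H]]|/covP[r E H]].
  apply/covP; exists (cast_ord mE r) => [|i ir]; first exact: esym.
  have /implyP Hi := H (cast_ord (esym mE) i).
  by apply/esym/eqP; apply: Hi; apply: contra ir => /eqP <-; apply/eqP/val_inj.
exists (cast_ord (esym mE) r); rewrite E eqxx; apply/forallP=> i; apply/implyP=> ir.
by rewrite (H (cast_ord mE i)).
Qed.

Lemma box_removed_up be la : box_removed la be = cov la (liftp be).
Proof.
have mE : (maxn m.+1 m).+1 = m.+2 by rewrite (maxn_idPl (leqnSn m)).
apply/existsP/existsP => [[r /andP[/eqP E /forallP H]]|[r /addsP H]].
  exists (cast_ord mE r); apply/addsP=> i; rewrite -!pv_ord pv_liftp.
  case: (eqVneq i (cast_ord mE r)) => [->|ir]; first by rewrite addn1 /= E.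
  have /implyP Hi := H (cast_ord (esym mE) i).
  rewrite addn0; apply/esym/eqP; apply: Hi; apply: contra ir => /eqP <-; exact/eqP/val_inj.
exists (cast_ord (esym mE) r); apply/andP; split.
  by rewrite /= !pv_ord -pv_liftp pv_ord H eqxx addn1.
apply/forallP=> i; apply/implyP=> ir.
have := H (cast_ord mE i); rewrite -!pv_ord pv_liftp /= => ->.
have -> : (cast_ord mE i == r) = false; last by rewrite addn0.
by apply/negbTE; apply: contra ir => /eqP <-; apply/eqP/val_inj.
Qed.

Lemma liftp_ex la : is_partition la -> (psize la <= m)%N -> exists al, la = liftp al.
Proof.
move=> P km; pose al : Ptn m := [ffun i => inord (la (wo i))]; exists al.
apply/ffunP=> i; case: (woP i) => [|j]; apply: val_inj.
  by rewrite liftp_max /= (partition_last P).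
rewrite liftp_wo; apply/esym; rewrite [LHS]wo_val ffunE inordK // ltnS.
exact: leq_trans (part_le_psize _ _) km.
Qed.

End Covers.

(** * The exact sequence *)

Lemma coinv_out (F : fieldType) (x : F) m (al : Ptn m) (z : Amb F m) (d : rawd m) :
  x != 0 -> (psize al <= m)%N -> z \in modU x al -> ~~ inD (psize al) d ->
  coinv (psize al) z d = 0.
Proof.
move=> x0 km /(memU x0 _ km)[_ H] dN; rewrite /coinv big1 // => h hS.
rewrite H ?raddf0 //; apply: contra dN => dhk.
by rewrite -(rmulK h d) inD_rmul ?in_SkV.
Qed.

(** * The two maps of the sequence and their effect on norms *)

Section Restriction.
Variables (F : fieldType) (x : F) (m : nat) (la : Ptn m.+1).
Hypotheses (char0 : [pchar F] =i pred0) (x0 : x != 0).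
Hypotheses (laP : is_partition la) (km : (psize la <= m)%N).
Local Notation k := (psize la).
Implicit Types (al be : Ptn m) (c : rawd m) (d : rawd m.+1) (v : DS F m) (z : Amb F m.+1).

Let km1 : (k <= m.+1)%N. Proof. exact: leqW. Qed.

Lemma alphasE al : (al \in alphas la) =
  [&& is_partition al, (psize al <= m)%N & cov (liftp al) la || (liftp al == la)].
Proof. by rewrite inE box_removed_down same_ptnP. Qed.
Lemma betasE be : (be \in betas la) =
  [&& is_partition be, (psize be <= m)%N & cov la (liftp be)].
Proof. by rewrite inE box_removed_up. Qed.

Lemma cov_psize al : cov (liftp al) la -> k = (psize al).+1.
Proof. by move=> /psize_cov ->; rewrite psize_liftp. Qed.

Lemma alphas_neq al : (al \in alphas la) && (liftp al != la) = (liftp al \in dns la).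
Proof.
rewrite alphasE inE partition_liftp; case: (is_partition al) => //=.
case: (boolP (cov (liftp al) la)) => C /=.
  have := cov_psize C => E; rewrite (leq_trans _ km) ?E //=.
  by apply/eqP=> E2; have := psize_liftp al; rewrite E2 E => /eqP; rewrite eqn_leq ltnn.
by case: eqP => _; rewrite ?andbF.
Qed.

Lemma alphas_eq al : (al \in alphas la) && (liftp al == la) = (liftp al == la).
Proof.
case: eqP => E; rewrite ?andbF // andbT alphasE E eqxx orbT andbT.
by rewrite -partition_liftp E laP -psize_liftp E.
Qed.

Lemma alphas_psize al : al \in alphas la -> (psize al <= m)%N.
Proof. by rewrite alphasE => /and3P[]. Qed.
Lemma betas_psize be : be \in betas la -> (psize be <= m)%N.
Proof. by rewrite betasE => /and3P[]. Qed.

(** The bound on the size of [be] forces [k < m]; for [k = m] the right-hand sum is empty. *)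
Lemma betas_ups be : be \in betas la -> [/\ liftp be \in ups la, psize be = k.+1 & (k < m)%N].
Proof.
rewrite betasE inE partition_liftp => /and3P[-> pm C]; rewrite C.
have E : psize be = k.+1 by rewrite -psize_liftp (psize_cov C).
by rewrite -E.
Qed.

Lemma ups_betas mu : (k < m)%N -> mu \in ups la -> exists2 be, be \in betas la & mu = liftp be.
Proof.
move=> km' /upsP[Q C sz]; have [|be E] := liftp_ex Q; first by rewrite sz.
by exists be => //; rewrite betasE -partition_liftp -psize_liftp -E Q C sz km'.
Qed.

Lemma sum_dns (V : nmodType) (f : Ptn m.+1 -> V) :
  \sum_(mu in dns la) f mu = \sum_(al in alphas la | liftp al != la) f (liftp al).
Proof.
rewrite (eq_bigl _ _ alphas_neq).
rewrite -(big_imset (h := @liftp m) f (A := [pred al | liftp al \in dns la])) /=; last first.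
  by move=> al al' _ _; apply: liftp_inj.
apply: eq_bigl => mu; apply/idP/imsetP => [D|[al]]; last by rewrite inE => ? ->.
have [Q C sz] := dnsP D; have [|al E] := liftp_ex Q; first by rewrite (leq_trans _ km) // sz.
exists al; last exact: E.
by rewrite unfold_in /= -E.
Qed.

(** How each summand enters the Specht module of [la]: as itself, or by adding the entry of index
    [k.-1], which is the bottom end of the strand of n in [iotaA]. *)
Definition psi al (w : MF F m) : MF F m.+1 :=
  if liftp al == la then trans w else uphom F (inord k.-1) (liftp al) la (trans w).
Lemma psi_is_linear al : linear (psi al).
Proof.
move=> a u w; rewrite /psi [trans _]linearP; case: ifP => _ //.
exact: linearP.
Qed.
HB.instance Definition _ al :=
  GRing.isLinear.Build F (MF F m) (MF F m.+1) _ (psi al) (psi_is_linear al).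

(* The default value of [iotaA] is taken only for k = 0, when no box can be removed from la, and
   that of [iotaB] only for k = m, when [betas la] is empty. *)
Definition iotaA c : rawd m.+1 := if insub k.-1 is Some p then iota1 p c else iota0 c.
Definition iotaB c : rawd m.+1 := if insub k is Some p then iota2 p c else iota0 c.
Definition io al c : rawd m.+1 := if liftp al == la then iota0 c else iotaA c.

Lemma iotaAP : (0 < k)%N ->
  {p : 'I_m | [/\ k = p.+1, (inord k.-1 : 'I_m.+1) = wo p & iotaA =1 iota1 p]}.
Proof.
move=> k0; have pm : (k.-1 < m)%N by rewrite prednK.
exists (Ordinal pm); split=> /= [||c]; first by rewrite prednK.
  by apply: val_inj; rewrite [RHS]wo_val; apply: inordK; rewrite ltnS ltnW.
by rewrite /iotaA insubT.
Qed.

Lemma iotaBP : (k < m)%N ->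
  {p : 'I_m | [/\ k = p, (inord k : 'I_m.+1) = wo p & iotaB =1 iota2 p]}.
Proof.
move=> pm; exists (Ordinal pm); split=> //= [|c].
  by apply: val_inj; rewrite [RHS]wo_val; apply: inordK; rewrite ltnS ltnW.
by rewrite /iotaB insubT.
Qed.

Lemma dns_k0 al : liftp al \in dns la -> (0 < k)%N.
Proof. by case/dnsP=> _ _ ->. Qed.

Lemma io_max al c i : al \in alphas la -> io al c (false, ord_max) <> (false, wo i).
Proof.
move=> alA; rewrite /io; case: (boolP (liftp al == la)) => E.
  by rewrite iota0_max => /(congr1 snd) /= E'; have := wo_neq i; rewrite -E' eqxx.
have D : liftp al \in dns la by rewrite -alphas_neq alA.
by have [p [_ _ ->]] := iotaAP (dns_k0 D); rewrite iota1_max.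
Qed.

Lemma inD_io al c : al \in alphas la -> inD (psize al) c -> inD k (io al c).
Proof.
move=> alA ck; rewrite /io; case: (boolP (liftp al == la)) => E.
  by rewrite inD_iota0 // -(eqP E) psize_liftp.
have D : liftp al \in dns la by rewrite -alphas_neq alA.
have [p [kp _ ->]] := iotaAP (dns_k0 D); have [_ C _] := dnsP D.
have pE : psize al = p by have := cov_psize C; rewrite kp => -[].
move: ck; rewrite pE kp => /inDP[cD H1 H2]; rewrite inD_iota1 //.
exact/inDP.
Qed.

Lemma psi_specht al w : al \in alphas la -> w \in specht F al -> psi al w \in specht F la.
Proof.
move=> alA wS; rewrite /psi; case: (boolP (liftp al == la)) => E; last exact: frame_specht.
by rewrite -(eqP E) trans_specht // alphas_psize.
Qed.

Definition fmap v : Amb F m.+1 :=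
  \sum_(al in alphas la) \sum_c elem F (io al c) (psi al (slice c (v al))).
Lemma fmap_is_linear : linear fmap.
Proof.
move=> a u v; rewrite /fmap scaler_sumr -big_split; apply: eq_bigr => al _ /=.
rewrite scaler_sumr -big_split; apply: eq_bigr => c _ /=.
by rewrite !ffunE !linearP.
Qed.
HB.instance Definition _ := GRing.isLinear.Build F (DS F m) (Amb F m.+1) _ fmap fmap_is_linear.

(** Only the diagrams bent at bottom vertex [k] are read, without averaging over the cosets of S_k
    in S_{k+1}: the norm of the target does that in [coinv_gmap]. *)
Definition gcomp be z : Amb F m :=
  \sum_(c | inD k.+1 c) elem F c (restr (uphom F (inord k) la (liftp be) (slice (iotaB c) z))).
Lemma gcomp_is_linear be : linear (gcomp be).
Proof.
move=> a u v; rewrite /gcomp scaler_sumr -big_split; apply: eq_bigr => c _ /=.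
by rewrite [slice _ _]linearP [uphom _ _ _ _ _]linearP [restr _]linearP [LHS]linearP.
Qed.
HB.instance Definition _ be :=
  GRing.isLinear.Build F (Amb F m.+1) (Amb F m) _ (gcomp be) (gcomp_is_linear be).

Definition gmap z : DS F m := [ffun be => if be \in betas la then gcomp be z else 0].
Lemma gmap_is_linear : linear gmap.
Proof.
move=> a u v; apply/ffunP=> be; rewrite [LHS]ffunE [RHS]ffunE [X in _ = X + _]ffunE.
rewrite [gmap u be]ffunE [gmap v be]ffunE.
case: (be \in betas la); last by rewrite scaler0 addr0.
exact: linearP.
Qed.
HB.instance Definition _ := GRing.isLinear.Build F (Amb F m.+1) (DS F m) _ gmap gmap_is_linear.

Lemma slice_fmap d v : slice d (fmap v) =
  \sum_(al in alphas la) \sum_c (if d == io al c then psi al (slice c (v al)) else 0).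
Proof.
rewrite raddf_sum; apply: eq_bigr => al _; rewrite raddf_sum; apply: eq_bigr => c _.
exact: slice_elem.
Qed.

Lemma slice_fmap_top d v i : d (false, ord_max) = (false, wo i) -> slice d (fmap v) = 0.
Proof.
move=> dE; rewrite slice_fmap big1 // => al alA; rewrite big1 // => c _.
by case: eqP => // E; case: (@io_max al c i alA); rewrite -E.
Qed.

Lemma slice_fmap0 c v :
  slice (iota0 c) (fmap v) = \sum_(al | liftp al == la) trans (slice c (v al)).
Proof.
rewrite slice_fmap (bigID (fun al => liftp al == la)) /= [X in _ + X]big1 ?addr0; last first.
  move=> al /andP[alA ne]; have D : liftp al \in dns la by rewrite -alphas_neq alA.
  rewrite big1 // => c' _; rewrite /io (negPf ne); have [p [_ _ ->]] := iotaAP (dns_k0 D).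
  by case: eqP => // E; have := iota1_max p c'; rewrite -E iota0_max.
rewrite (eq_bigl _ _ alphas_eq); apply: eq_bigr => al E.
rewrite (bigD1 c) //= big1 ?addr0 => [|c' ne]; first by rewrite /io /psi E eqxx.
by rewrite /io E (inj_eq (@iota0_inj m)) eq_sym (negPf ne).
Qed.

Section Through.
Variable p : 'I_m.
Hypotheses (kp : k = p.+1) (pE : (inord k.-1 : 'I_m.+1) = wo p) (iA : iotaA =1 iota1 p).

Lemma slice_fmap1 c v : slice (iota1 p c) (fmap v) =
  \sum_(al in alphas la | liftp al != la) psi al (slice c (v al)).
Proof.
rewrite slice_fmap (bigID (fun al => liftp al == la)) /= big1 ?add0r; last first.
  move=> al /andP[alA E]; rewrite big1 // => c' _; rewrite /io E.
  by case: eqP => // E'; have := iota1_max p c; rewrite E' iota0_max.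
apply: eq_bigr => al /andP[alA ne].
rewrite (bigD1 c) //= big1 ?addr0 => [|c' cc]; first by rewrite /io (negPf ne) iA eqxx.
by rewrite /io (negPf ne) iA (inj_eq (@iota1_inj m p)) eq_sym (negPf cc).
Qed.

Lemma slice_fmap1_neq d v j : d (false, ord_max) = (true, j) -> j != wo p -> slice d (fmap v) = 0.
Proof.
move=> dE jp; rewrite slice_fmap big1 // => al alA; rewrite big1 // => c _.
case: eqP => // E; move: dE; rewrite E /io; case: ifP => _; first by rewrite iota0_max.
by rewrite iA iota1_max => /(congr1 snd) /= E'; rewrite E' eqxx in jp.
Qed.

Lemma sum_Sk_fix (V : nmodType) (f : {perm 'I_m.+1} -> V) :
  (forall h, in_Sk k h -> h (wo p) != wo p -> f h = 0) ->
  \sum_(h | in_Sk k h) f h = \sum_(h : {perm 'I_m} | in_Sk p h) f (lperm h).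
Proof.
move=> f0; rewrite (bigID (fun h : {perm 'I_m.+1} => h (wo p) == wo p)) /=.
rewrite [X in _ + X]big1 ?addr0 => [|h /andP[]]; last exact: f0.
rewrite -(sum_Sk f (ltnW (ltn_ord p))); apply: eq_bigl => h; apply/andP/idP => [[hS /eqP hp]|hS].
  apply/in_SkP=> i; rewrite leq_eqVlt => /orP[/eqP E|pi].
    by rewrite (_ : i = wo p) //; apply: val_inj; rewrite [RHS]wo_val.
  by rewrite (in_SkP _ _ hS) // kp.
split; last by rewrite (in_SkP _ _ hS) // wo_val.
by apply/in_SkP=> i; rewrite kp => /ltnW pi; rewrite (in_SkP _ _ hS).
Qed.

Lemma psi_gact al (h : {perm 'I_m}) w : liftp al \in dns la -> in_Sk p h ->
  psi al (gact h w) = gact (lperm h) (psi al w).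
Proof.
move=> D hS; have [Q C sz] := dnsP D; have := D; rewrite -alphas_neq => /andP[_ /negPf ne].
rewrite /psi ne trans_gact pE /=.
have sE : psize (liftp al) = wo p by rewrite wo_val; move: sz; rewrite kp => -[].
rewrite up_gact ?rowofP //.
by rewrite sE wo_val in_Sk_lperm // ltnW.
Qed.

(** A permutation moving [p] turns [iota1 p c] into a diagram with n joined to another bottom
    vertex, where [fmap v] vanishes. So the sum over S_k shrinks to one over S_{k-1}, the group of
    the summands [al]. *)
Lemma coinv_fmap1 c v : coinv k (fmap v) (iota1 p c) =
  \sum_(al in alphas la | liftp al != la) psi al (coinv (psize al) (v al) c).
Proof.
rewrite /coinv sum_Sk_fix; last first.
  move=> h hS hp; rewrite (@slice_fmap1_neq _ _ ((h^-1)%g (wo p))) ?raddf0 //.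
    by rewrite ffunE {2}/botact /= iota1_max.
  by rewrite -(inj_eq (@perm_inj _ h)) permKV eq_sym.
transitivity (\sum_(h | in_Sk p h) \sum_(al in alphas la | liftp al != la)
    psi al (gact h (slice (rmul c h) (v al)))).
  apply: eq_bigr => h hS; rewrite rmul_iota1 ?(in_SkP _ _ hS) // slice_fmap1 raddf_sum /=.
  by apply: eq_bigr => al; rewrite alphas_neq => D; rewrite psi_gact.
rewrite exchange_big; apply: eq_bigr => al /=; rewrite alphas_neq => D.
have [_ C sz] := dnsP D; have -> : psize al = p by have := cov_psize C; rewrite kp => -[].
by rewrite raddf_sum.
Qed.

End Through.

Lemma coinv_fmap0 c v :
  coinv k (fmap v) (iota0 c) = \sum_(al | liftp al == la) trans (coinv (psize al) (v al) c).
Proof.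
rewrite /coinv sum_Sk //.
transitivity (\sum_(h : {perm 'I_m} | in_Sk k h) \sum_(al | liftp al == la)
    trans (gact h (slice (rmul c h) (v al)))).
  apply: eq_bigr => h hS; rewrite rmul_iota0 slice_fmap0 raddf_sum /=.
  by apply: eq_bigr => al _; rewrite trans_gact.
rewrite exchange_big; apply: eq_bigr => al /= /eqP <-.
by rewrite psize_liftp raddf_sum.
Qed.

Lemma coinv_fmap_top d v i : d (false, ord_max) = (false, wo i) -> coinv k (fmap v) d = 0.
Proof.
move=> dE; rewrite /coinv big1 // => h _; rewrite (@slice_fmap_top _ _ i) ?raddf0 //.
by rewrite ffunE {2}/botact /= dE.
Qed.

Lemma fmap_modU v : (forall al, al \in alphas la -> v al \in modU x al) -> fmap v \in modU x la.
Proof.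
move=> vU; apply: rpred_sum => al alA; apply: rpred_sum => c _.
have [H1 H2] := memU x0 _ (alphas_psize alA) (vU al alA).
case: (boolP (inD (psize al) c)) => ck; last by rewrite H2 // !raddf0 mem0v.
by apply: elem_modU; rewrite ?inD_io ?psi_specht.
Qed.

(** If n is on a through strand, a transposition in S_k moves its bottom end to the last of the [k]
    positions, the one for which [iota1] is made. *)
Lemma inD_cases d : inD k d ->
  [\/ exists2 c, inD k c & d = iota0 c,
      exists i, d (false, ord_max) = (false, wo i) |
      exists p : 'I_m, k = p.+1 /\ exists g c,
        [/\ in_Sk k g, inD p c & d = rmul (iota1 p c) g]].
Proof.
move=> dk; have /inDP[dD H1 H2] := dk; case E: (d (false, ord_max)) => [[] j]; last first.
  case: (woP j) E => [E|i E]; [apply: Or31|apply: Or32]; last by exists i.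
  by apply: iota0P.
apply: Or33; have jk : (j < k)%N.
  rewrite ltnNge; apply/negP=> kj; have := diagramP _ dD (false, ord_max).
  by rewrite E H2.
have [p [kp _ _]] := iotaAP (leq_ltn_trans (leq0n _) jk); exists p; split=> //.
pose g := tperm j (wo p); have gS : in_Sk k g.
  apply/in_SkP=> i ki; rewrite tpermD //; apply: contraTneq ki => <-.
    by rewrite -ltnNge.
  by rewrite -ltnNge wo_val kp.
have dgk := inD_rmul gS dk; rewrite {1}kp in dgk.
have [|c ck cE] := iota1P dgk.
  by rewrite ffunE {2}/botact /= E /botact /= tpermV tpermL.
by exists g, c; split=> //; rewrite -cE rmulM tperm2 rmul1.
Qed.

Lemma fmap_modR v : (forall al, al \in alphas la -> v al \in modR x al) -> fmap v \in modR x la.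
Proof.
move=> vR.
have vU al : al \in alphas la -> v al \in modU x al.
  by move=> alA; case: (memR char0 x0 _ (alphas_psize alA) (vR al alA)).
have v0 al c : al \in alphas la -> coinv (psize al) (v al) c = 0.
  by move=> alA; case: (memR char0 x0 _ (alphas_psize alA) (vR al alA)).
apply/memR => //; split=> [|d]; first exact: fmap_modU.
case: (boolP (inD k d)) => dk; last by apply: (coinv_out x0) => //; apply: fmap_modU.
case: (inD_cases dk) => [[c ck ->]|[i]|[p [kp [g [c [gS ck ->]]]]]].
- by rewrite coinv_fmap0 big1 // => al; rewrite -alphas_eq => /andP[alA _]; rewrite v0 ?raddf0.
- exact: coinv_fmap_top.
have k0 : (0 < k)%N by rewrite kp.
have [q [kq qE iA]] := iotaAP k0; have pq : p = q by apply: val_inj; move: kp; rewrite kq => -[].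
subst q.
have gV : in_Sk k (g^-1)%g by rewrite in_SkV.
rewrite (coinv_rmul _ _ gV) rmulK (coinv_fmap1 kq qE iA).
by rewrite big1 ?raddf0 // => al /andP[alA _]; rewrite v0 ?raddf0.
Qed.

(** Evaluating the norm at [iota0 c] isolates the summand [al = la]; at [iota1 p c] it gives the sum
    of the maps [uphom], whose joint injectivity separates the remaining summands. *)
Lemma fmap_inj v : (forall al, al \in alphas la -> v al \in modU x al) ->
  fmap v \in modR x la -> forall al, al \in alphas la -> v al \in modR x al.
Proof.
move=> vU /(memR char0 x0 _ km1)[_ z0] al alA; have am := alphas_psize alA.
apply/memR => //; split=> [|c]; first exact: vU.
case: (boolP (liftp al == la)) => E.
  have := coinv_fmap0 c v; rewrite z0 (big_pred1 al) => [|al'].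
    by move/(congr1 (@restr F m)); rewrite transK raddf0.
  by rewrite -(eqP E) (inj_eq (@liftp_inj m)).
have D : liftp al \in dns la by rewrite -alphas_neq alA.
have [p [kp pE iA]] := iotaAP (dns_k0 D).
have := coinv_fmap1 kp pE iA c v; rewrite z0 => /esym s0.
(* The norms reindexed by shapes on m + 1 points, as [uphom_inj] expects them; the value 0 occurs
   only outside the image of [liftp]. *)
pose w mu : MF F m.+1 :=
  if [pick al | liftp al == mu] is Some al then trans (coinv (psize al) (v al) c) else 0.
have wE al' : w (liftp al') = trans (coinv (psize al') (v al') c).
  rewrite /w; case: pickP => [b /eqP/(@liftp_inj m) -> //|/(_ al')]; by rewrite eqxx.
have wS mu : mu \in dns la -> w mu \in specht F mu.
  move=> muD; have [Q C sz] := dnsP muD; have [|b bE] := liftp_ex Q.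
    by rewrite (leq_trans _ km) // sz.
  have bA : b \in alphas la by move: muD; rewrite bE -alphas_neq => /andP[].
  have bm := alphas_psize bA.
  by rewrite bE wE trans_specht // (coinv_specht x0 _ bm) // vU.
have := uphom_inj char0 laP (o := wo p) (w := w); rewrite wo_val => /(_ kp wS).
rewrite sum_dns => /(_ _ (liftp al) D); rewrite wE => H.
rewrite -[LHS](@transK F m) H ?raddf0 //.
rewrite -[RHS]s0; apply: eq_bigr => b /andP[_ /negPf ne].
by rewrite wE /psi ne pE.
Qed.

Lemma slice_gmap be c z : be \in betas la -> slice c (gmap z be) =
  if inD k.+1 c then restr (uphom F (inord k) la (liftp be) (slice (iotaB c) z)) else 0.
Proof.
move=> bB; rewrite [gmap z be]ffunE bB /gcomp raddf_sum /=; case: ifP => ck.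
  rewrite (bigD1 c) //= big1 ?addr0 => [|c' /andP[_ cc]]; rewrite slice_elem ?eqxx //.
  by rewrite eq_sym (negPf cc).
by rewrite big1 // => c' ck'; rewrite slice_elem; case: eqP => // E; rewrite E ck' in ck.
Qed.

Lemma gmap_modU z be : be \in betas la -> gmap z be \in modU x be.
Proof.
move=> bB; have [_ bk _] := betas_ups bB; have bm := betas_psize bB.
apply/memU => //; rewrite bk; split=> c => [|/negPf ck]; rewrite slice_gmap //; last by rewrite ck.
case: ifP => _; last exact: mem0v.
by apply: (restr_specht bm _).1; apply: frame_specht.
Qed.

(** * Diagrams with n joined to a top vertex, and induced modules *)

Section Horizontal.
Variable p : 'I_m.
Hypotheses (kp : k = p) (pE : (inord k : 'I_m.+1) = wo p) (iB : iotaB =1 iota2 p).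

(** The element of the induced module that [z] defines at [c]: its component at the coset of the
    transposition of [i] and [p] is the norm at the diagram obtained by bending strand [i] of [c]
    instead of strand [p]. *)
Definition fibre z c (j : 'I_m.+1) : MF F m.+1 :=
  if unlift ord_max j is Some i then coinv k z (iota2 p (rmul c (tperm i p))) else 0.

Lemma fibre_wo z c i : fibre z c (wo i) = coinv k z (iota2 p (rmul c (tperm i p))).
Proof. by rewrite /fibre liftK. Qed.

Lemma wo_le (j : 'I_m.+1) : (j <= wo p)%N -> exists2 i : 'I_m, (i <= p)%N & j = wo i.
Proof.
case: (woP j) => [|i]; first by rewrite wo_val leqNgt ltn_ord.
by rewrite !wo_val => ip; exists i.
Qed.

Lemma fibre_specht z c (j : 'I_m.+1) : z \in modU x la -> (j <= wo p)%N -> fibre z c j \in specht F la.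
Proof. by move=> zU /wo_le[i _ ->]; rewrite fibre_wo (coinv_specht x0 _ km1). Qed.

Lemma sum_wo_le (V : nmodType) (f : 'I_m.+1 -> V) :
  \sum_(j : 'I_m.+1 | (j <= wo p)%N) f j = \sum_(i : 'I_m | (i <= p)%N) f (wo i).
Proof.
rewrite (wo_val p) big_mkcond big_ord_recr /= leqNgt ltn_ord addr0 [RHS]big_mkcond.
apply: eq_bigr => i _; have <- // : widen_ord (leqnSn m) i = wo i.
exact/val_inj/esym/wo_val.
Qed.

(** Split the sum over S_{k+1} into cosets of S_k: the inner sums commute with [uphom] and [iota2]
    and give norms of [z], and the outer transpositions assemble [indsum]. *)
Lemma coinv_gmap z be c : be \in betas la -> inD k.+1 c ->
  coinv k.+1 (gmap z be) c = restr (indsum (wo p) la (liftp be) (fibre z c)).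
Proof.
move=> bB ck; have [bU bk _] := betas_ups bB; have [Q C sz] := upsP bU.
rewrite /coinv kp sum_SkS /indsum sum_wo_le raddf_sum /=; apply: eq_bigr => i ip.
rewrite -lperm_tperm restr_gact fibre_wo /coinv kp sum_Sk ?(ltnW (ltn_ord p)) //.
rewrite [uphom _ _ _ _ _]raddf_sum [restr _]raddf_sum [RHS]raddf_sum; apply: eq_bigr => h hS /=.
have hS' : in_Sk p.+1 (h * tperm i p)%g.
  by rewrite in_SkM ?tperm_Sk //; apply/in_SkP=> l /ltnW pl; rewrite (in_SkP _ _ hS).
have laE : psize la = wo p by rewrite wo_val.
rewrite -gactM slice_gmap // inD_rmul -?kp // kp // iB -rmulM -rmul_iota2 ?(in_SkP _ _ hS) //.
have pE' : (inord p : 'I_m.+1) = wo p by rewrite -kp.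
rewrite pE' up_gact ?rowofP //; last by rewrite laE wo_val in_Sk_lperm // ltnW.
by rewrite restr_gact.
Qed.

Lemma indsum_restr be y : be \in betas la ->
  restr (indsum (wo p) la (liftp be) y) = 0 -> indsum (F := F) (wo p) la (liftp be) y = 0.
Proof.
move=> bB H; have bm := betas_psize bB; have [bU bk _] := betas_ups bB.
suff uS : indsum (F := F) (wo p) la (liftp be) y \in specht F (liftp be).
  by have [_ <-] := restr_specht bm uS; rewrite H raddf0.
apply: rpred_sum => j jp; apply: gact_specht; last exact: frame_specht.
by rewrite psize_liftp bk kp -(wo_val p) tperm_Sk.
Qed.

(** All the [indsum] of the fibre vanish, so by [indsum_inj] the fibre does; its component at the
    trivial coset is the norm in question. *)
Lemma gmap_ker z c : z \in modU x la -> (forall be, be \in betas la -> gmap z be \in modR x be) ->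
  inD k.+1 c -> coinv k z (iota2 p c) = 0.
Proof.
move=> zU gR ck.
have -> : coinv k z (iota2 p c) = fibre z c (wo p) by rewrite fibre_wo tperm1 rmul1.
apply: (indsum_inj char0 laP (o := wo p)) => //; first by rewrite wo_val.
- by move=> j jp; apply: fibre_specht.
move=> mu muU; have [|be bB ->] := ups_betas _ muU; first by rewrite kp.
apply: indsum_restr => //; rewrite -coinv_gmap //.
have [_ bk _] := betas_ups bB.
have [_ H] := memR char0 x0 _ (betas_psize bB) (gR be bB).
by rewrite -bk H.
Qed.

Lemma gmap_elem c w be : be \in betas la -> inD k.+1 c ->
  gmap (elem F (iota2 p c) w) be = elem F c (restr (uphom F (wo p) la (liftp be) w)).
Proof.
move=> bB ck; rewrite [LHS]ffunE bB /gcomp (bigD1 c) //= big1 ?addr0 => [|c' /andP[_ cc]].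
  by rewrite slice_elem iB eqxx pE.
by rewrite slice_elem iB (inj_eq (@iota2_inj m p)) (negPf cc) !raddf0.
Qed.

Lemma gmap_elem0 d w : (forall c, inD k.+1 c -> d <> iota2 p c) -> gmap (elem F d w) = 0.
Proof.
move=> dN; apply/ffunP=> be; rewrite [LHS]ffunE [RHS]ffunE; case: (be \in betas la) => //.
rewrite /gcomp big1 // => c ck; rewrite slice_elem iB; case: eqP => [E|_]; last by rewrite !raddf0.
by case: (dN c ck).
Qed.

(** For each [c] the slices of [v] are matched by one element of the induced module ([indsum_surj]),
    whose component at [i] is placed on the diagram with strand [i] bent. The transpositions then
    sit on the diagrams rather than on the Specht factor, so [v] is met only modulo relations. *)
Lemma gmap_surj v : (forall be, be \in betas la -> v be \in modU x be) ->
  exists2 z, z \in modU x la & forall be, be \in betas la -> gmap z be - v be \in modR x be.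
Proof.
move=> vU; have laE : psize la = wo p by rewrite wo_val.
(* One [y] serves all [be] at once; the boolean form allows the choice for every [c]. *)
have sol c : exists y : {ffun 'I_m.+1 -> MF F m.+1}, (inD k.+1 c ==>
    [forall j : 'I_m.+1, (j <= wo p)%N ==> (y j \in specht F la)] &&
    [forall be, (be \in betas la) ==>
       (trans (slice c (v be)) == indsum (wo p) la (liftp be) y)]).
  pose w mu : MF F m.+1 :=
    if [pick be | liftp be == mu] is Some be then trans (slice c (v be)) else 0.
  have wE be : w (liftp be) = trans (slice c (v be)).
    by rewrite /w; case: pickP => [b /eqP/(@liftp_inj m) -> //|/(_ be)]; rewrite eqxx.
  have [|y yS yE] := indsum_surj char0 laP laE (v := w).
    move=> mu muU; have [|be bB ->] := ups_betas _ muU; first by rewrite kp.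
    have bm := betas_psize bB; have [H _] := memU x0 _ bm (vU be bB).
    by rewrite wE trans_specht.
  exists [ffun j => y j]; apply/implyP=> _; apply/andP; split.
    by apply/forallP=> j; apply/implyP=> jp; rewrite ffunE yS.
  apply/forallP=> be; apply/implyP=> bB; have [bU _ _] := betas_ups bB.
  rewrite -wE yE //; apply/eqP; apply: eq_bigr => j _; by rewrite ffunE.
pose Y c := xchoose (sol c); have YP c := implyP (xchooseP (sol c)).
exists (\sum_(c | inD k.+1 c) \sum_(i : 'I_m | (i <= p)%N)
    elem F (iota2 p (rmul c (tperm i p))) (Y c (wo i))).
  apply: rpred_sum => c ck; apply: rpred_sum => i ip.
  have /andP[/forallP YS _] := YP c ck.
  apply: elem_modU => //; last by apply: (implyP (YS _)); rewrite !wo_val.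
  by rewrite kp inD_iota2 // inD_rmul ?tperm_Sk // -kp.
move=> be bB; have bm := betas_psize bB; have [bU bk _] := betas_ups bB.
have [vS v0] := memU x0 _ bm (vU be bB); rewrite bk in v0.
have gE z : gmap z be = gcomp be z by rewrite [LHS]ffunE bB.
have vE : v be = \sum_(c | inD k.+1 c) elem F c (slice c (v be)).
  rewrite {1}[v be]Amb_expand (bigID (inD k.+1)) /= [X in _ + X]big1 ?addr0 // => c cN.
  by rewrite v0 ?raddf0.
rewrite [X in _ - X]vE gE raddf_sum -sumrB; apply: rpred_sum => c ck /=.
have /andP[/forallP YS /forallP YE] := YP c ck.
have -> : slice c (v be) = restr (indsum (wo p) la (liftp be) (Y c)).
  by rewrite -(eqP (implyP (YE be) bB)) transK.
rewrite /indsum sum_wo_le [restr _]raddf_sum [X in X - _]raddf_sum [X in _ - X]raddf_sum -sumrB; apply: rpred_sum => i ip /=.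
have ckp : inD p.+1 c by rewrite -kp.
rewrite -gE gmap_elem //; last by rewrite kp inD_rmul ?tperm_Sk.
rewrite -lperm_tperm restr_gact.
apply: elem_rel => //; rewrite ?bk //; last by rewrite kp tperm_Sk.
by apply: (restr_specht bm _).1; apply: frame_specht.
Qed.

End Horizontal.

End Restriction.

Lemma mem_dsU (F : fieldType) (x : F) m (S : {set Ptn m}) (v : DS F m) :
  reflect ((forall al, al \in S -> v al \in modU x al) /\ (forall al, al \notin S -> v al = 0))
    (v \in dsU x S).
Proof. exact: (memv_ds (mem S) (fun al => modU x al) v). Qed.

Lemma mem_dsR (F : fieldType) (x : F) m (S : {set Ptn m}) (v : DS F m) :
  reflect ((forall al, al \in S -> v al \in modR x al) /\ (forall al, al \notin S -> v al = 0))
    (v \in dsR x S).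
Proof. exact: (memv_ds (mem S) (fun al => modR x al) v). Qed.

Lemma dsact_is_linear (F : fieldType) (x : F) m b : linear (@dsact F x m b).
Proof.
move=> a u v; apply/ffunP=> al; rewrite [LHS]ffunE [RHS]ffunE [X in _ = X + _]ffunE.
rewrite [dsact x b u al]ffunE [dsact x b v al]ffunE -linearP; congr (modact x _ b _).
by rewrite [LHS]ffunE [X in X + _]ffunE.
Qed.
HB.instance Definition _ (F : fieldType) (x : F) m b :=
  GRing.isLinear.Build F (DS F m) (DS F m) _ (@dsact F x m b) (dsact_is_linear x b).

Lemma dsact_dsin (F : fieldType) (x : F) m b al (u : Amb F m) :
  dsact x b (dsin al u) = dsin al (modact x (psize al) b u) :> DS F m.
Proof.
apply/ffunP=> be; rewrite [LHS]ffunE [RHS]ffunE [dsin _ _ _]ffunE.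
by case: eqP => [->|_] //; rewrite raddf0.
Qed.

(** * Kernel, image and equivariance *)

Section Exactness.
Variables (F : fieldType) (x : F) (m : nat) (la : Ptn m.+1).
Hypotheses (char0 : [pchar F] =i pred0) (x0 : x != 0).
Hypotheses (laP : is_partition la) (km : (psize la <= m)%N).
Local Notation k := (psize la).
Implicit Types (al be : Ptn m) (b c : rawd m) (d : rawd m.+1) (v : DS F m) (z : Amb F m.+1).
Local Notation f := (linfun (@fmap F m la)).
Local Notation g := (linfun (@gmap F m la)).

Let km1 : (k <= m.+1)%N. Proof. exact: leqW. Qed.

Lemma fmap_dsin al c w : al \in alphas la ->
  fmap la (dsin al (elem F c w)) = elem F (io la al c) (psi la al w).
Proof.
move=> alA; rewrite /fmap (bigD1 al) //= [X in _ + X]big1 ?addr0 => [|al' /andP[_ ne]].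
  rewrite (bigD1 c) //= [X in _ + X]big1 ?addr0 => [|c' cc].
    by rewrite [dsin _ _ _]ffunE eqxx slice_elem eqxx.
  by rewrite [dsin _ _ _]ffunE eqxx slice_elem (negPf cc) !raddf0.
by rewrite big1 // => c' _; rewrite [dsin _ _ _]ffunE (negPf ne) !raddf0.
Qed.

Lemma dsin_dsU al c w : al \in alphas la -> inD (psize al) c -> w \in specht F al ->
  (dsin al (elem F c w) : DS F m) \in dsU x (alphas la).
Proof.
move=> alA ck wS; apply/mem_dsU; split=> be bS; rewrite ffunE.
  case: eqP => [->|_]; last exact: mem0v.
  by rewrite elem_modU // (alphas_psize alA).
by case: eqP => // E; rewrite E alA in bS.
Qed.

(** If n is isolated, [w] comes from the summand [al = la]. If n is on a through strand, a relation
    moves its bottom end to position [p], and [uphom_surj] decomposes the Specht vector over the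
    shapes below [la]. *)
Lemma elem_fmap d w : inD k d -> w \in specht F la ->
  (forall i, d (false, ord_max) <> (false, wo i)) ->
  elem F d w \in (f @: dsU x (alphas la) + modR x la)%VS.
Proof.
move=> dk wS dmax; case: (inD_cases km dk) => [[c ck ->]|[i /dmax //]|[p [kp [h [c [hS ck ->]]]]]].
  have [al alE] := liftp_ex laP km.
  have alA : al \in alphas la.
    by have := alphas_eq laP km al; rewrite -alE eqxx andbT.
  have am := alphas_psize alA; rewrite alE in wS.
  have [w' w'S wE] := specht_trans am wS.
  have alk : psize al = k by rewrite alE psize_liftp.
  apply: (subvP (addvSl _ _)); have -> : elem F (iota0 c) w = f (dsin al (elem F c w')).
    by rewrite lfunE /= fmap_dsin // /io /psi -alE eqxx wE.
  by apply/memv_img/dsin_dsU; rewrite ?alk.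
have k0 : (0 < k)%N by rewrite kp.
have [q [kq qE iA]] := iotaAP km k0; have pq : p = q by apply: val_inj; move: kp; rewrite kq => -[].
subst q; have cD : inD k (iota1 p c).
  by have /inDP[cD _ c2] := ck; rewrite kp inD_iota1.
(* The permutation is carried from the diagram to the Specht factor at the cost of a relation. *)
rewrite -[elem F _ w](subrK (elem F (iota1 p c) (gact h w))) addrC.
apply: memv_add; last exact: elem_rel.
have uS : gact h w \in specht F la by apply: gact_specht.
have laE : psize la = (wo p).+1 by rewrite wo_val.
have [u uuS ->] := uphom_surj char0 laP laE uS.
rewrite (sum_dns km) raddf_sum; apply: rpred_sum => al alP.
have D : liftp al \in dns la by rewrite -(alphas_neq km).
have /andP[alA ne] := alP; have am := alphas_psize alA.
have [w' w'S wE] := specht_trans am (uuS _ D).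
have alk : psize al = p.
  by have [_ C _] := dnsP D; have := cov_psize C; rewrite kp => -[].
change (elem F (iota1 p c) (uphom F (wo p) (liftp al) la (u (liftp al))) \in (f @: dsU x (alphas la))%VS).
have -> : elem F (iota1 p c) (uphom F (wo p) (liftp al) la (u (liftp al))) = f (dsin al (elem F c w')).
  by rewrite lfunE /= fmap_dsin // /io /psi (negPf ne) iA wE qE.
by apply/memv_img/dsin_dsU; rewrite ?alk.
Qed.

(** The two ends of the horizontal arc are top vertices off the through strands, leaving room for at
    most m - 1 of these. *)
Lemma inD_top_lt d i : inD k d -> d (false, ord_max) = (false, wo i) -> (k < m)%N.
Proof.
move=> dk dE; have /inDP[dD _ H2] := dk.
have : nvert d = k by apply/eqP; rewrite -inD_nvert.
have dE' : d (false, wo i) = (false, ord_max) by rewrite -dE (diagramP _ dD).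
rewrite /nvert => <-; have sub : [set j | (d (false, j)).1] \subset ~: [set ord_max; wo i].
  apply/subsetP=> j; rewrite !inE; apply: contraL => /orP[] /eqP ->; by rewrite ?dE ?dE'.
apply: (leq_ltn_trans (subset_leq_card sub)).
have := cardsC [set ord_max; wo i]; rewrite cards2 eq_sym wo_neq card_ord.
clear x0 char0 laP; by have := ltn_ord i; lia.
Qed.

Lemma betas_lt be : be \in betas la -> (k < m)%N.
Proof. by case/betas_ups. Qed.

Lemma gmap_modR z be : z \in modR x la -> be \in betas la -> gmap la z be \in modR x be.
Proof.
move=> zR bB; have bm := betas_psize bB; have [_ bk kltm] := betas_ups bB.
have [p [kp pE iB]] := iotaBP kltm; have [zU z0] := memR char0 x0 _ km1 zR.
apply/memR => //; split=> [|c]; first exact: gmap_modU.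
case: (boolP (inD (psize be) c)) => ck; last by apply: (coinv_out x0) => //; apply: gmap_modU.
rewrite bk in ck *; rewrite (coinv_gmap kp pE iB) // /indsum big1 ?raddf0 // => j _.
rewrite (_ : fibre la p z c j = 0) ?raddf0 //.
by rewrite /fibre; case: unlift => // i; rewrite z0.
Qed.

(** Split [z] by whether n is joined to a top vertex. The part without such an arc is covered by
    [elem_fmap]; the other part has zero norm by [gmap_ker] and so is a relation. *)
Lemma gmap_kernel z : z \in modU x la -> (forall be, be \in betas la -> gmap la z be \in modR x be) ->
  z \in (f @: dsU x (alphas la) + modR x la)%VS.
Proof.
move=> zU gR; have [z1 z2] := memU x0 _ km1 zU.
pose top d := [exists i, d (false, ord_max) == (false, wo i)].
have topM d h : top (rmul d h) = top d.
  apply: eq_existsb => i; rewrite ffunE {2}/botact /=.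
  by case: (d (false, ord_max)) => [[] j].
rewrite [z]Amb_expand (bigID top) /= addrC; apply: rpredD.
  apply: rpred_sum => d dN; case: (boolP (inD k d)) => dk; last by rewrite z2 // raddf0 mem0v.
  by apply: elem_fmap => // i E; case/negP: dN; apply/existsP; exists i; rewrite E.
apply: (subvP (addvSr _ _)); set zt := \sum_(d | top d) _.
(* Since [top] is invariant under the right action, cutting [z] down to such diagrams commutes with
   taking norms. *)
have ztE d : slice d zt = if top d then slice d z else 0.
  rewrite raddf_sum /=; case: (boolP (top d)) => dt.
    rewrite (bigD1 d) //= big1 ?addr0 => [|d' /andP[_ dd]]; rewrite slice_elem ?eqxx //.
    by rewrite eq_sym (negPf dd).
  by rewrite big1 // => d' dt'; rewrite slice_elem; case: eqP => // E; rewrite E dt' in dt.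
apply/memR => //; split=> [|d].
  apply/memU => //; split=> d => [|dN]; rewrite ztE; case: ifP => // _; [exact: mem0v | exact: z2].
rewrite /coinv; under eq_bigr => h _ do rewrite ztE topM.
case: (boolP (top d)) => [/existsP[i /eqP dE]|_]; last by rewrite big1 // => h _; rewrite raddf0.
case: (boolP (inD k d)) => dk; last exact: (coinv_out x0).
have [p [kp pE iB]] := iotaBP (inD_top_lt dk dE).
rewrite {1}kp in dk; have [c ck ->] := iota2P dk dE.
by apply: (gmap_ker char0 x0 laP km kp pE iB) => //; rewrite kp.
Qed.

Lemma fmap_equivariant b v : is_diagram b -> v \in dsU x (alphas la) ->
  fmap la (dsact x b v) = modact x k (@eps m.+1 b) (fmap la v).
Proof.
move=> bD /mem_dsU[vU v0].
have -> : v = \sum_(al in alphas la) \sum_(c | inD (psize al) c) dsin al (elem F c (slice c (v al))).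
  apply/ffunP=> be; rewrite sum_ffunE; case: (boolP (be \in alphas la)) => bA; last first.
    rewrite v0 // big1 // => al alA; rewrite sum_ffunE big1 // => c _; rewrite ffunE.
    by case: eqP => // E; rewrite E alA in bA.
  rewrite (bigD1 be) //= [X in _ + X]big1 ?addr0 => [|al /andP[_ ne]]; last first.
    by rewrite sum_ffunE big1 // => c _; rewrite ffunE eq_sym (negPf ne).
  have [_ H2] := memU x0 _ (alphas_psize bA) (vU be bA).
  rewrite sum_ffunE {1}[v be]Amb_expand (bigID (inD (psize be))) /= [X in _ + X]big1 ?addr0.
    by apply: eq_bigr => c _; rewrite [RHS]ffunE eqxx.
  by move=> c /H2 ->; rewrite raddf0.
rewrite [dsact x b _]raddf_sum [LHS]raddf_sum [fmap la _]raddf_sum [RHS]raddf_sum.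
apply: eq_bigr => al alA /=.
rewrite [dsact x b _]raddf_sum [LHS]raddf_sum [fmap la _]raddf_sum [RHS]raddf_sum.
apply: eq_bigr => c ck /=; move: (slice c (v al)) => w.
have am := alphas_psize alA; have /inDP[cD _ c2] := ck.
change (fmap la (dsact x b (dsin al (elem F c w))) = modact x k (@eps m.+1 b) (fmap la (dsin al (elem F c w)))).
rewrite dsact_dsin fmap_dsin // modact_elem // modact_elem //; last first.
- exact: inD_io.
- exact: eps_diagram.
have [gE eE iE] : [/\ Gp (@eps m.+1 b) (io la al c) = io la al (Gp b c),
    ell (@eps m.+1 b) (io la al c) = ell b c &
    inD k (io la al (Gp b c)) = inD (psize al) (Gp b c)].
  rewrite /io; case: (boolP (liftp al == la)) => E.
    have alk : psize al = k by rewrite -psize_liftp (eqP E).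
    by rewrite Gp_iota0 // ell_iota0 // inD_iota0 // alk.
  have D : liftp al \in dns la by rewrite -(alphas_neq km) alA.
  have [p [kp _ iA]] := iotaAP km (dns_k0 D).
  have alk : psize al = p.
    by have [_ C _] := dnsP D; have := cov_psize C; rewrite kp => -[].
  rewrite !iA Gp_iota1 // ell_iota1 //; split=> //.
  rewrite kp alk inD_iota1 ?Gp_diagram // => j pj.
  by rewrite Gp_bottom_isolated // c2 // alk.
rewrite gE eE iE; case: ifP => _; last by rewrite !raddf0.
by rewrite [dsin _ _]linearZ [LHS]linearZ /= fmap_dsin.
Qed.

(** If n has no horizontal arc, both sides vanish by [Gp_not_iota2]; otherwise the diagram is
    [iota2 p c], and multiplication commutes with [iota2]. *)
Lemma gmap_equivariant b z : is_diagram b -> z \in modU x la ->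
  gmap la (modact x k (@eps m.+1 b) z) = dsact x b (gmap la z).
Proof.
move=> bD /(memU x0 _ km1)[_ z2]; have eD := eps_diagram bD.
have -> : z = \sum_(d | inD k d) elem F d (slice d z).
  rewrite {1}[z]Amb_expand (bigID (inD k)) /= [X in _ + X]big1 ?addr0 //.
  by move=> d /z2 ->; rewrite raddf0.
rewrite [modact _ _ _ _]raddf_sum [LHS]raddf_sum [gmap la _]raddf_sum [RHS]raddf_sum.
apply: eq_bigr => d dk /=; move: (slice d z) => w.
case: (ltnP k m) => [kltm|mk]; last first.
  have g0 z' : gmap la z' = 0.
    apply/ffunP=> be; rewrite [LHS]ffunE [RHS]ffunE; case: ifP => // /betas_lt.
    by rewrite ltnNge mk.
  by rewrite !g0 raddf0.
have [p [kp pE iB]] := iotaBP kltm.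
have dk' : inD p d by rewrite -kp.
have not_top : (forall i, d (false, ord_max) <> (false, wo i)) ->
    gmap la (modact x k (@eps m.+1 b) (elem F d w)) = dsact x b (gmap la (elem F d w)).
  move=> dmax; rewrite (gmap_elem0 iB w) ?raddf0; last first.
    move=> c; rewrite kp => /inDP[_ c1 _] E; have := iota2_max p c; rewrite -E.
    have := c1 p (ltnSn p); case: (c (true, p)) => r i /= ->.
    by rewrite nu2_top => /dmax.
  rewrite modact_elem //; case: ifP => _; last by rewrite raddf0.
  rewrite linearZ /= (gmap_elem0 iB w) ?scaler0 // => c; rewrite kp => ck.
  exact: (Gp_not_iota2 bD dk' dmax ck).
case E: (d (false, ord_max)) => [[] j]; first by apply: not_top => i; rewrite E.
case: (woP j) E => [|i] E.
  by apply: not_top => i; rewrite E => /(congr1 snd) /= Ei; have := wo_neq i; rewrite -Ei eqxx.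
have [c ck dE] := iota2P dk' E; have /inDP[cD _ _] := ck; rewrite dE in dk *.
apply/ffunP=> be; rewrite [RHS]ffunE.
case: (boolP (be \in betas la)) => bB; last first.
  rewrite [LHS]ffunE (negPf bB) [gmap la (elem _ _ _) be]ffunE (negPf bB).
  by rewrite raddf0.
have [_ bk _] := betas_ups bB; have bm := betas_psize bB.
have ck' : inD k.+1 c by rewrite kp.
pose u := restr (uphom F (wo p) la (liftp be) w).
have gE c' : inD k.+1 c' -> gmap la (elem F (iota2 p c') w) be = elem F c' u.
  exact: (gmap_elem pE iB w bB).
have actE := modact_elem x w km1 eD dk; rewrite Gp_iota2 // ell_iota2 // in actE.
have bm' : (k.+1 <= m)%N by rewrite -bk.
rewrite {}actE [X in modact _ _ _ X]gE // bk modact_elem //.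
case: (boolP (inD k.+1 (Gp b c))) => ek.
  have -> : inD k (iota2 p (Gp b c)) by rewrite kp inD_iota2 // -kp.
  rewrite -gE //; move: (elem F _ w) => y.
  by rewrite linearZ [LHS]ffunE.
(* The product can survive on the left even though [Gp b c] has lost a strand, namely the one bent
   to n. It is then [iota2 p] of a diagram outside [inD k.+1], which [gmap] does not see. *)
case: ifP => _; last by rewrite raddf0 ffunE.
rewrite linearZ /= (gmap_elem0 iB w) ?scaler0 ?ffunE // => c' c'k /(@iota2_inj m p) E'.
by rewrite E' c'k in ek.
Qed.

End Exactness.

Theorem theorem3p2 (F : fieldType) (x : F) (n t : nat) (la : Ptn n) :
  [pchar F] =i pred0 -> x != 0 -> (1 <= t <= n)%N ->
  is_partition la -> psize la = (n - t)%N ->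
  exists (f : 'Hom(DS F n.-1, Amb F n)) (g : 'Hom(Amb F n, DS F n.-1)),
    [/\ sq_exact (dsU x (alphas la)) (dsR x (alphas la))
                 (modU x la) (modR x la)
                 (dsU x (betas la)) (dsR x (betas la)) f g,
        sq_equivariant (@is_diagram n.-1) (@dsact F x n.-1)
                 (fun b => modact x (psize la) (eps b))
                 (dsU x (alphas la)) (modR x la) f &
        sq_equivariant (@is_diagram n.-1)
                 (fun b => modact x (psize la) (eps b)) (@dsact F x n.-1)
                 (modU x la) (dsR x (betas la)) g].
Proof.
case: n la => [|m] la char0 x0 /andP[t1 tn] laP laE; first by move: tn; rewrite leqNgt t1.
(* The bound [1 <= t] leaves room for [la] itself as a shape for the smaller algebra. *)
have km : (psize la <= m)%N by rewrite laE; lia.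
have g0 z be : be \notin betas la -> gmap (F := F) la z be = 0.
  by move=> /negPf bN; rewrite [LHS]ffunE bN.
exists (linfun (@fmap F m la)), (linfun (@gmap F m la)); split.
- split; split.
  + apply/subvP=> _ /memv_imgP[v /mem_dsU[vU _] ->]; rewrite lfunE; exact: fmap_modU.
  + apply/subvP=> _ /memv_imgP[v /mem_dsR[vR _] ->]; rewrite lfunE; exact: fmap_modR.
  + apply/subvP=> _ /memv_imgP[z zU ->]; rewrite lfunE; apply/mem_dsU; split=> be bB.
      exact: gmap_modU.
    exact: g0.
  + apply/subvP=> _ /memv_imgP[z zR ->]; rewrite lfunE; apply/mem_dsR; split=> be bB.
      exact: gmap_modR.
    exact: g0.
  + apply/subvP=> v; rewrite memv_cap -memv_preim lfunE => /andP[/mem_dsU[vU v0] fR].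
    by apply/mem_dsR; split=> //; apply: fmap_inj fR.
  + apply/subvP=> _ /memv_imgP[_ /memv_imgP[v /mem_dsU[vU _] ->] ->]; rewrite !lfunE /=.
    (* The composite is zero already before passing to quotients: [gmap] reads only diagrams with n
       joined to a top vertex, and [fmap] produces none. *)
    suff -> : gmap la (fmap la v) = 0 by exact: mem0v.
    apply/ffunP=> be; case: (boolP (be \in betas la)) => bB; last by rewrite g0 // ffunE.
    rewrite [LHS]ffunE bB /gcomp big1 ?ffunE // => c ck.
    have [p [kp pE iB]] := iotaBP (betas_lt bB); rewrite iB.
    have : (c (true, p)).1 = false by have /inDP[_ c1 _] := ck; rewrite c1 // kp.
    have := iota2_max p c; case: (c (true, p)) => r i /= + rE; rewrite rE nu2_top => /slice_fmap_top -> //.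
    by rewrite !raddf0.
  + apply/subvP=> z; rewrite memv_cap -memv_preim lfunE => /andP[zU /mem_dsR[gR _]].
    exact: gmap_kernel.
  (* For [k = m] every [be] would need more than n - 1 boxes, so the target is zero. *)
  apply/subvP=> v /mem_dsU[vU v0]; case: (ltnP (psize la) m) => [kltm|mk]; last first.
    suff -> : v = 0 by exact: mem0v.
    apply/ffunP=> be; rewrite v0 ?ffunE //; apply/negP=> /betas_lt.
    by rewrite ltnNge mk.
  have [p [kp pE iB]] := iotaBP kltm.
  have [z zU zE] := gmap_surj char0 x0 laP km kp pE iB vU.
  rewrite -[v](subrK (gmap la z)) addrC; apply: memv_add.
    by have := memv_img (linfun (gmap la)) zU; rewrite lfunE.
  have subE be : (v - gmap la z) be = v be - gmap la z be.
    by rewrite [LHS]ffunE [X in _ + X]ffunE.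
  apply/mem_dsR; split=> be bB; rewrite subE; first by rewrite -opprB rpredN zE.
  by rewrite v0 // g0 // subr0.
- move=> b bD v vU; rewrite !lfunE /=.
  by rewrite fmap_equivariant // subrr mem0v.
move=> b bD z zU; rewrite !lfunE /=.
by rewrite gmap_equivariant // subrr mem0v.
Qed.
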